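(* Suppose $C$ is an irreducible plane curve germ at the origin, defined by $f(x,y)=0$, of multiplicity greater than $1$. Let $\eta$ be the standard normalization of $C$, with exponents $n$ and $B_1$, and with the associated generators of $J(f)_D$. Then the fiber of $\mathrm{Projan}(\mathcal R(J(f)_D))$ over $(0,0)$, as a subset of $\mathbb P^3$, is: (i) $\mathbb P^1\times(0,0)$ if $B_1=n+1$ (which is the fiber of $\mathrm{Projan}(\mathcal R(J(f)_{D-}))$ over $(0,0)$); (ii) the tangent component, if $B_1>n+1$.
   Context: Standard normalization: $\eta:(\mathbb C,0)\to(C,0)$, $\eta(t)=(\eta_1(t),\eta_2(t))=(t^n,\ t^{B_1}+\cdots+a_{B_2}t^{B_2}+\cdots)$, with $B_1>n$ not a multiple of $n$, $B_2$ the first exponent not in the ideal of $\mathbb Z$ generated by $\{n,B_1\}$ (if there is one), and all terms of $\eta_2$ between $t^{B_1}$ and $a_{B_2}t^{B_2}$ having degree in that ideal. Projan: for a module $\mathcal N\subseteq\mathcal O_Y^q$ on an analytic space $Y$ with generators forming the columns of a $q\times m$ matrix $[\mathcal N]$, $\mathrm{Projan}(\mathcal R(\mathcal N))$ is the closure in $Y\times\mathbb P^{m-1}$ of the set of $(y,[\ell])$ with $[\mathcal N(y)]$ of maximal rank (equal to the generic rank of $\mathcal N$) and $\ell\neq0$ in the row space of $[\mathcal N(y)]$. Doubles: $J(f)$ is the $\mathcal O_C$-module (ideal) generated by $f_x,f_y$. With $\pi_1,\pi_2:C\times C\to C$ the projections and $h_D=(h\circ\pi_1,h\circ\pi_2)$,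 $J(f)_D\subseteq\mathcal O_{C\times C}^2$ is generated by all $h_D$, $h\in J(f)$, and $J(f)_{D-}$ is generated by $(f_x)_D,(f_y)_D$. The Projan of $J(f)_D$ over $(0,0)\in C\times C$ is computed after pulling back by $\eta\times\eta$ to $\mathbb C\times\mathbb C$ (the fibers over $(0,0)$ are identified). Since $f_x\circ\eta=-(f_y\circ\eta)\,\frac{d\eta_2/dt}{d\eta_1/dt}$ with $\frac{d\eta_2/dt}{d\eta_1/dt}$ analytic, the pulled back module is generated by the four columns $$(f_x)_D,\quad (f_y)_D,\quad (0,(x\circ\pi_1-x\circ\pi_2)\,f_y\circ\pi_2),\quad (0,(y\circ\pi_1-y\circ\pi_2)\,f_y\circ\pi_2)$$ pulled back by $\eta\times\eta$; these are the associated generators, so the fiber over $(0,0)$ lies in $\mathbb P^3$. The first two coordinates of $\mathbb P^3$ are called conormal coordinates, the third the tangent coordinate, the fourth the normal coordinate. The tangent component is the set of points of $\mathbb P^3$ whose normal (fourth) coordinate is zero. $\mathbb P^1\times(0,0)$ is the set of points whose third and fourth coordinates are zero; the fiber of $\mathrm{Projan}(\mathcal R(J(f)_{D-}))$, which lies in $\mathbb P^1$, is regarded as a subset of $\mathbb P^3$ via this inclusion. *)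

(* Defs.v *)
From HB Require Import structures.
From mathcomp Require Import all_boot all_order all_algebra.
From mathcomp Require Import generic_quotient complex.
From mathcomp Require Import all_classical all_reals all_analysis.

Set Implicit Arguments.
Unset Strict Implicit.
Unset Printing Implicit Defensive.

Import Order.TTheory GRing.Theory Num.Theory.
Import numFieldNormedType.Exports.

Local Open Scope classical_set_scope.
Local Open Scope quotient_scope.
Local Open Scope ring_scope.

(* The cast to numClosedFieldType is what lets the norm topology be inferred. *)
Definition Cplx (R : realType) : numClosedFieldType := R[i]%C.

Section ProjectiveSpace.
Variables (K : numFieldType) (m : nat).

Definition nonzero_vec := set_type [set v : 'rV[K]_m | v != 0].

HB.instance Definition _ := Topological.on nonzero_vec.

Definition collinear (v w : nonzero_vec) : bool :=
  `[< exists2 c : K, c != 0 & set_val v = c *: set_val w >].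

Lemma collinear_refl : reflexive collinear.
Proof. by move=> v; apply/asboolP; exists 1; rewrite ?oner_neq0 ?scale1r. Qed.

Lemma collinear_sym : symmetric collinear.
Proof.
suff H v w : collinear v w -> collinear w v by move=> v w; apply/idP/idP; exact: H.
move=> /asboolP [c c0 e]; apply/asboolP; exists c^-1; first by rewrite invr_eq0.
by rewrite e scalerA mulVf // scale1r.
Qed.

Lemma collinear_trans : transitive collinear.
Proof.
move=> w v u /asboolP [c c0 e] /asboolP [d d0 e']; apply/asboolP.
by exists (c * d); rewrite ?mulf_neq0 // e e' scalerA.
Qed.

Canonical collinear_equiv :=
  EquivRel collinear collinear_refl collinear_sym collinear_trans.

(* [projective m] is the projective space of dimension m - 1. *)
Definition projective := quotient_topology {eq_quot collinear_equiv}.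

HB.instance Definition _ := Topological.on projective.
HB.instance Definition _ := Quotient.on projective.

Definition projective_class (v : 'rV[K]_m) (v0 : v != 0) : projective :=
  (\pi_projective (exist _ v (mem_set v0) : nonzero_vec)).

(* A chosen vector of homogeneous coordinates; it is used only in conditions
   that are invariant under scaling. *)
Definition homog (z : projective) : 'rV[K]_m := set_val (repr z : nonzero_vec).

Lemma homog_neq0 (z : projective) : homog z != 0.
Proof. exact: (set_valP (repr z : nonzero_vec)). Qed.

End ProjectiveSpace.
Arguments projective K m : clear implicits.

Section Projan.
Variables (K : numFieldType) (Y : topologicalType) (q m : nat).
Implicit Type N : Y -> 'M[K]_(q, m).

(* Generic rank of N on the germ (Y, y0), assumed to be irreducible: the largest
   rank that N takes at points arbitrarily close to y0. *)
Definition generic_rank (y0 : Y) N (r : nat) : Prop :=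
  (\forall y \near y0, (\rank (N y) <= r)%N) /\
  (forall U : set Y, nbhs y0 U -> exists2 y, U y & \rank (N y) = r).

(* Only the part of this set over small neighbourhoods of y0 is meaningful. *)
Definition Projan (y0 : Y) N : set (Y * projective K m) :=
  closure [set yl : Y * projective K m |
    generic_rank y0 N (\rank (N yl.1)) /\ (homog yl.2 <= N yl.1)%MS].

Definition Projan_fiber (y0 : Y) N : set (projective K m) :=
  [set z | Projan y0 N (y0, z)].

End Projan.

Section Germs.
Variable K : numFieldType.

Definition power_series1 (b : nat -> K) (u : K -> K) : Prop :=
  exists2 r : K, 0 < r &
    forall t, `|t| < r -> [series b k * t ^+ k]_k @ \oo --> u t.

(* The bound makes the double series absolutely convergent on the polydisc. *)
Definition power_series2 (a : nat -> nat -> K) (h : K * K -> K) : Prop :=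
  exists r M : K, [/\ 0 < r,
    forall i j, `|a i j| * r ^+ (i + j) <= M &
    forall x y, `|x| < r -> `|y| < r ->
      (fun N => \sum_(i < N) \sum_(j < N) a i j * x ^+ i * y ^+ j) @ \oo
        --> h (x, y)].

(* A germ is represented by any total function having the right power series
   near the origin; identities between germs are identities near the origin. *)
Definition analytic1 (u : K -> K) : Prop := exists b, power_series1 b u.
Definition analytic2 (h : K * K -> K) : Prop := exists a, power_series2 a h.

Definition unit2 (h : K * K -> K) : Prop :=
  exists2 k, analytic2 k & \forall p \near (0 : K * K), h p * k p = 1.

Definition irreducible2 (f : K * K -> K) : Prop :=
  [/\ analytic2 f,
      ~ (\forall p \near (0 : K * K), f p = 0),
      ~ unit2 f &
      forall g h, analytic2 g -> analytic2 h ->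
        (\forall p \near (0 : K * K), f p = g p * h p) -> unit2 g \/ unit2 h].

Definition multiplicity (f : K * K -> K) (d : nat) : Prop :=
  exists a, [/\ power_series2 a f,
    forall i j, (i + j < d)%N -> a i j = 0 &
    exists i j, (i + j = d)%N /\ a i j != 0].

End Germs.

Section Normalization.
Variable K : numFieldType.
Implicit Types (f : K * K -> K) (eta : K -> K * K).

(* Composition with eta maps the local ring of f = 0 injectively to K{t}, and
   K{t} is the integral closure of the image in its field of fractions. *)
Definition is_normalization f eta : Prop :=
  [/\ [/\ eta 0 = 0,
          analytic1 (fun t => (eta t).1) & analytic1 (fun t => (eta t).2)],
      forall h, analytic2 h ->
        (\forall t \near (0 : K), h (eta t) = 0) <->
        (exists2 k, analytic2 k &
           \forall p \near (0 : K * K), h p = k p * f p),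
      forall u, analytic1 u -> exists g h, [/\ analytic2 g, analytic2 h,
        ~ (\forall t \near (0 : K), h (eta t) = 0) &
        \forall t \near (0 : K), u t * h (eta t) = g (eta t)] &
      forall u, analytic1 u -> exists (d : nat) (c : 'I_d -> K * K -> K),
        (forall i, analytic2 (c i)) /\
        \forall t \near (0 : K),
          u t ^+ d + \sum_(i < d) c i (eta t) * u t ^+ i = 0].

Definition in_ideal (n B k : nat) : Prop :=
  exists u v : int, k%:Z = u * n%:Z + v * B%:Z.

(* [None] when every exponent of the series lies in the ideal (n, B1). *)
Definition second_exponent (n B1 : nat) (b : nat -> K) (B2 : option nat) : Prop :=
  match B2 with
  | Some B => [/\ b B != 0, ~ in_ideal n B1 B &
                  forall k, (k < B)%N -> b k != 0 -> in_ideal n B1 k]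
  | None => forall k, b k != 0 -> in_ideal n B1 k
  end.

Definition standard_normalization f eta (n B1 : nat) (B2 : option nat) : Prop :=
  is_normalization f eta /\
  [/\ (0 < n)%N, (n < B1)%N, ~~ (n %| B1)%N,
      (\forall t \near (0 : K), (eta t).1 = t ^+ n) &
      exists b : nat -> K, [/\ power_series1 b (fun t => (eta t).2),
        forall k, (k < B1)%N -> b k = 0, b B1 = 1 &
        second_exponent n B1 b B2]].

End Normalization.

Section Double.
Variables (K : numFieldType) (f : K * K -> K) (eta : K -> K * K).

Definition f_x (p : K * K) : K := 'D_((1, 0) : K * K) f p.
Definition f_y (p : K * K) : K := 'D_((0, 1) : K * K) f p.

Definition col2 (a b : K) : 'cV[K]_2 := \col_i (if i == 0 then a else b).

Definition double (h : K * K -> K) (pq : (K * K) * (K * K)) : 'cV[K]_2 :=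
  col2 (h pq.1) (h pq.2).

Definition JD_minus_matrix (pq : (K * K) * (K * K)) : 'M[K]_(2, 2) :=
  row_mx (double f_x pq) (double f_y pq).

(* After pulling back by eta x eta these columns generate the module J(f)_D of
   all doubles of elements of (f_x, f_y): f_x o eta is an analytic multiple of
   f_y o eta, so the last two columns built from f_x are redundant. *)
Definition JD_matrix (pq : (K * K) * (K * K)) : 'M[K]_(2, 2 + (1 + 1)) :=
  row_mx (JD_minus_matrix pq)
    (row_mx (col2 0 ((pq.1.1 - pq.2.1) * f_y pq.2))
            (col2 0 ((pq.1.2 - pq.2.2) * f_y pq.2))).

Definition eta_eta (st : K * K) : (K * K) * (K * K) := (eta st.1, eta st.2).

Definition JD_fiber : set (projective K 4) :=
  Projan_fiber (0 : K * K) (JD_matrix \o eta_eta).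

Definition JD_minus_fiber : set (projective K 2) :=
  Projan_fiber (0 : K * K) (JD_minus_matrix \o eta_eta).

End Double.

Section P3.
Variable K : numFieldType.

Definition tangent_coord (z : projective K 4) : K := homog z 0 (inord 2).
Definition normal_coord (z : projective K 4) : K := homog z 0 (inord 3).

Definition tangent_component : set (projective K 4) := [set z | normal_coord z = 0].

Definition P1_00 : set (projective K 4) :=
  [set z | tangent_coord z = 0 /\ normal_coord z = 0].

Lemma incl_neq0 (z : projective K 2) : row_mx (homog z) (0 : 'rV[K]_2) != 0.
Proof.
apply/eqP => e; have /eqP := homog_neq0 z; apply.
by rewrite -(row_mxKl (homog z) (0 : 'rV[K]_2)) e linear0.
Qed.

Definition P1_incl (z : projective K 2) : projective K 4 :=
  projective_class (incl_neq0 z : (row_mx (homog z) 0 : 'rV[K]_4) != 0).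

End P3.

(* Main.v *)
(* Put x = t^n, phi = y o eta and psi = dy/dx = phi'/(n t^(n-1)). The chain rule
   gives f_x o eta = - psi (f_y o eta), and f_y o eta has no zero at t <> 0 close
   to 0. Hence, where the rank is 2, the row space at (s, t) is spanned by
   (- psi(s), 1, 0, 0) and (D psi, 0, D x, D phi), where D h = h(s) - h(t). As
   psi(0) = 0, the fiber is the union of the spans of (0, 1, 0, 0) and
   (p, 0, q, r) over the limits (p : q : r) of (D psi : D x : D phi).

   First, D phi = o(|D psi| + |D x|). The root rho of X^n = t^n nearest to s
   satisfies |s - rho| |s|^(n-1) <= |D x|, which disposes of the pair (s, rho);
   for the pair (rho, t) write rho = w t with w^n = 1 and compare leading terms:
   phi(wt) - phi(t) = O(|t|^n) (psi(wt) - psi(t)). So r = 0 always.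

   If B1 = n + 1, psi has a simple zero, so D x = o(|D psi|), and only (1 : 0 : 0)
   occurs. If B1 > n + 1, take (p, q) <> (0, 0). The series p x - q psi has order
   e >= 2; let z <> 1 with z^e = 1. A truncation of it takes the same value at t
   and at some s = z t + O(t^2), which forces (D psi : D x) -> (p : q), because
   |D psi| + |D x| is bounded below by a fixed power of |t| when s stays away
   from t. *)
Require Import Defs.
From mathcomp Require Import all_boot all_order all_algebra.
From mathcomp Require Import generic_quotient complex.
From mathcomp Require Import all_classical all_reals all_analysis.
From mathcomp Require Import ring lra zify.

Set Implicit Arguments.
Unset Strict Implicit.
Unset Printing Implicit Defensive.

Import Order.TTheory GRing.Theory Num.Theory.
Import numFieldNormedType.Exports.

Local Open Scope classical_set_scope.
Local Open Scope ring_scope.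

(** That [f_y] has no zero along the branch rests on the ideal of the curve. Zeros of a composite
    with eta are isolated; if [f_y] vanished identically along eta, so would [f_x], and both would
    be multiples of [f], since the functions vanishing along eta form the ideal of [f]. A gradient
    bounded by a multiple of [|f|], with [f] zero at the origin, forces [f] to vanish near it.
    Comparing leading terms for a rotation by [w] needs an exponent [k] of phi with [w ^+ k != 1].
    If there were none, eta would agree at [t] and [w * t], and [t] could not be a quotient of
    functions on the curve. Nearby roots come from algebra rather than from an inverse function: the
    sum of [1 / (z - rho)] over the roots of a polynomial [q] puts one of them within
    [deg q * |q(z) / q'(z)|] of [z]. Hence level sets are taken of truncations. The obstacle in the
    pair (s, rho) is psi: its order [B1 - n] may be below [n], so its difference need not be
    controlled by that of x. The factor [|t| ^ n] gained in the pair (rho, t) pays for it. *)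

Section Modulus.
Variable R : realType.
Local Notation C := (Cplx R).
Implicit Types (z w t : C) (r e : R).

(** The norm of [Cplx R] takes its values in [Cplx R] itself, where the order is partial. The
    modulus in [R] lives in a total order, on which [lra] and [nra] operate. *)
Definition nm z : R := ComplexField.Normc.normc (z : R[i]%C).
#[local] Arguments nm : simpl never.
Definition rc r : C := (r%:C)%C.

Lemma normE z : `|z| = rc (nm z).
Proof. by []. Qed.

Lemma lec_rc r r' : (rc r <= rc r') = (r <= r').
Proof. exact: lecR. Qed.

Lemma ltc_rc r r' : (rc r < rc r') = (r < r').
Proof. exact: ltcR. Qed.

Lemma rc_inj : injective rc.
Proof. exact: complexI. Qed.

Lemma nmD z w : nm (z + w) <= nm z + nm w.
Proof. exact: le_normcD. Qed.

Lemma nmM z w : nm (z * w) = nm z * nm w.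
Proof. exact: ComplexField.Normc.normcM. Qed.

Lemma nm0 : nm 0 = 0. Proof. exact: ComplexField.Normc.normc0. Qed.
Lemma nm1 : nm 1 = 1. Proof. exact: ComplexField.Normc.normc1. Qed.
Lemma nmN z : nm (- z) = nm z. Proof. exact: normcN. Qed.
Lemma nmV z : nm z^-1 = (nm z)^-1.
Proof. exact: ComplexField.Normc.normcV. Qed.

Lemma nm_eq0 z : (nm z == 0) = (z == 0).
Proof.
by apply/eqP/eqP => [|->]; [exact: ComplexField.Normc.eq0_normc|exact: nm0].
Qed.

Lemma nm_ge0 z : 0 <= nm z.
Proof. by rewrite -lec_rc -normE; exact: normr_ge0. Qed.

Lemma nm_gt0 z : (0 < nm z) = (z != 0).
Proof. by rewrite lt0r nm_eq0 nm_ge0 andbT. Qed.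

Lemma nmX z k : nm (z ^+ k) = nm z ^+ k.
Proof. by elim: k => [|k IH]; rewrite ?expr0 ?nm1 // !exprS nmM IH. Qed.

Lemma nm_rc r : 0 <= r -> nm (rc r) = r.
Proof.
by move=> r0; apply: rc_inj; rewrite -normE ger0_norm // -[0]/(rc 0) lec_rc.
Qed.

Lemma rc_nat k : rc k%:R = k%:R.
Proof. exact: rmorph_nat. Qed.

Lemma nm_nat k : nm k%:R = k%:R.
Proof. by rewrite -rc_nat nm_rc. Qed.

Lemma nmB z w : nm (z - w) <= nm z + nm w.
Proof. by rewrite -(nmN w) nmD. Qed.

Lemma nmC z w : nm (z - w) = nm (w - z).
Proof. by rewrite -nmN opprB. Qed.

Lemma nm_tri z w t : nm (z - t) <= nm (z - w) + nm (w - t).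
Proof. by rewrite -{1}(subrK w z) -addrA nmD. Qed.

Lemma nm_lb z w : nm z - nm w <= nm (z + w).
Proof. by rewrite lerBlDr -{1}(addrK w z) nmB. Qed.

Lemma nm_sum I (s : seq I) (P : pred I) (F : I -> C) :
  nm (\sum_(i <- s | P i) F i) <= \sum_(i <- s | P i) nm (F i).
Proof.
elim/big_rec2: _ => [|i x y _ le]; first by rewrite nm0.
by apply: le_trans (nmD _ _) _; rewrite lerD2l.
Qed.

Lemma nm_sum_le I (s : seq I) (P : pred I) (F : I -> C) (G : I -> R) :
  (forall i, P i -> nm (F i) <= G i) ->
  nm (\sum_(i <- s | P i) F i) <= \sum_(i <- s | P i) G i.
Proof. by move=> FG; apply: le_trans (nm_sum _ _ _) (ler_sum _ _). Qed.

Lemma gt0_rc (x : C) : 0 < x -> exists2 r : R, 0 < r & x = rc r.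
Proof.
move=> x0; exists (complex.Re x); last by rewrite /rc RRe_real// gtr0_real.
by rewrite -ltc_rc /rc RRe_real // gtr0_real.
Qed.

Lemma ge0_rc (x : C) : 0 <= x -> exists2 r : R, 0 <= r & x = rc r.
Proof.
move=> x0; exists (complex.Re x); last by rewrite /rc RRe_real// ger0_real.
by rewrite -lec_rc /rc RRe_real // ger0_real.
Qed.

Lemma near0P (P : C -> Prop) : (\forall t \near (0 : C), P t) <->
  exists2 r, 0 < r & forall t, nm t < r -> P t.
Proof.
split=> [/nbhs_norm0P [_ /= /gt0_rc [r r0 ->] sP]|[r r0 sP]].
  by exists r => // t tr; apply: sP; rewrite /= normE ltc_rc.
apply/nbhs_norm0P; exists (rc r); first by rewrite /= -[0]/(rc 0) ltc_rc.
by move=> t /=; rewrite normE ltc_rc => /sP.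
Qed.

Lemma norm_pair_lt z w r : (`|(z, w)| < rc r) = (nm z < r) && (nm w < r).
Proof.
rewrite prod_normE /= !normE comparable_gt_max ?ltc_rc //.
by rewrite real_comparable // ger0_real// -[0]/(rc 0) lec_rc nm_ge0.
Qed.

Lemma near0P2 (P : C * C -> Prop) : (\forall p \near (0 : C * C), P p) <->
  exists2 r, 0 < r & forall x y, nm x < r -> nm y < r -> P (x, y).
Proof.
split=> [/nbhs_norm0P [_ /= /gt0_rc [r r0 ->] sP]|[r r0 sP]].
  by exists r => // x y xr yr; apply: sP; rewrite /= norm_pair_lt xr.
apply/nbhs_norm0P; exists (rc r); first by rewrite /= -[0]/(rc 0) ltc_rc.
by move=> [x y] /=; rewrite norm_pair_lt => /andP[]; exact: sP.
Qed.

Lemma cvgnP (u : nat -> C) (l : C) : (u @ \oo --> l) <->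
  forall e, 0 < e -> exists N, forall k, (N <= k)%N -> nm (u k - l) < e.
Proof.
split=> [/cvgrPdist_lt ul e e0|ul].
  have /ul [N _ uN] : 0 < rc e by rewrite -[0]/(rc 0) ltc_rc.
  by exists N => k /uN /=; rewrite normE ltc_rc nmC.
apply/cvgrPdist_lt => _ /gt0_rc [e /ul [N uN] ->].
by exists N => // k /= /uN; rewrite normE ltc_rc nmC.
Qed.

Lemma eps_eq0 (x : R) : 0 <= x -> (forall e, 0 < e -> x <= e) -> x = 0.
Proof.
move=> x0 xe; apply/eqP; rewrite eq_le x0 andbT.
by apply/ler_addgt0Pr => e /xe; rewrite add0r.
Qed.

Lemma cvg_uniq (u : nat -> C) (l l' : C) : u @ \oo --> l -> u @ \oo --> l' -> l = l'.
Proof.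
move=> /cvgnP ul /cvgnP ul'; apply/eqP; rewrite -subr_eq0 -nm_eq0; apply/eqP.
apply: eps_eq0 (nm_ge0 _) _ => e e0.
have e2 : 0 < e / 2 by rewrite divr_gt0.
have [N uN] := ul _ e2; have [N' uN'] := ul' _ e2.
have := uN _ (leq_maxl N N'); have := uN' _ (leq_maxr N N').
have := nm_tri l (u (maxn N N')) l'; rewrite (nmC l (u _)); lra.
Qed.

Lemma cvg_nm_le (u : nat -> C) (l : C) (c : R) N0 : u @ \oo --> l ->
  (forall k, (N0 <= k)%N -> nm (u k) <= c) -> nm l <= c.
Proof.
move=> /cvgnP ul uc; apply/ler_addgt0Pr => e /ul [N uN].
have := uN _ (leq_maxl N N0); have := uc _ (leq_maxr N N0).
have := nmB (u (maxn N N0)) (u (maxn N N0) - l); rewrite subKr; lra.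
Qed.

Lemma cvg_ext (u v : nat -> C) (l : C) N0 : u @ \oo --> l ->
  (forall k, (N0 <= k)%N -> u k = v k) -> v @ \oo --> l.
Proof.
move=> /cvgnP ul uv; apply/cvgnP => e /ul [N uN]; exists (maxn N N0) => k.
by rewrite geq_max => /andP[/uN + /uv <-].
Qed.

Lemma cauchy_complex (u : nat -> C) :
  (forall e, 0 < e -> exists N, forall k, (N <= k)%N -> nm (u k - u N) < e) ->
  exists l : C, u @ \oo --> l.
Proof.
move=> cu.
pose re (z : C) : R := complex.Re z; pose im (z : C) : R := complex.Im z.
have nmRe z : `|re z| <= nm z by rewrite -lec_rc; exact: normc_ge_Re.
have nmIm z : `|im z| <= nm z.
  by rewrite /nm; case: z => a b /=; rewrite -sqrtr_sqr ler_wsqrtr // lerDr sqr_ge0.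
have cv (p : C -> R) : (forall z w, p (z - w) = p z - p w) ->
    (forall z, `|p z| <= nm z) -> cvgn (p \o u).
  move=> pB pn; apply/cauchy_cvgP/cauchy_exP => e e0.
  have [N uN] := cu _ e0; exists (p (u N)), N => // k /= /uN.
  by rewrite /ball /= -pB nmC; exact: le_lt_trans.
have [/cvgrPdist_lt ca /cvgrPdist_lt cb] : cvgn (re \o u) /\ cvgn (im \o u).
  by split; apply: cv => // [] [a b] [a' b'].
exists (Complex (limn (re \o u)) (limn (im \o u))); apply/cvgnP => e e0.
have e2 : 0 < e / 2 by rewrite divr_gt0.
have [N _ uN] := ca _ e2; have [N' _ uN'] := cb _ e2.
exists (maxn N N') => k; rewrite geq_max => /andP[/uN /= + /uN' /=].
set a := limn _; set b := limn _; case: (u k) => x y /=.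
move=> la lb.
rewrite [X in nm X](_ : _ = rc (x - a) + 'i * rc (y - b)); last first.
  by apply/eqP; rewrite eq_complex /= !(mul0r, mul1r, subr0, addr0, add0r, oppr0) !eqxx.
apply: le_lt_trans (nmD _ _) _.
have nmr r : nm (rc r) = `|r|.
  by rewrite /nm /= expr0n /= addr0 sqrtr_sqr.
rewrite nmM !nmr /nm /= expr0n expr1n /= add0r sqrtr1 mul1r.
rewrite (distrC x) (distrC y); lra.
Qed.

Lemma geometric_cvg (u : nat -> C) (c q : R) : 0 <= c -> 0 <= q < 1 ->
  (forall k, nm (u k.+1 - u k) <= c * q ^+ k) -> exists l : C, u @ \oo --> l.
Proof.
move=> c0 /andP[q0 q1] uc.
(* The exact partial geometric sum is kept: the induction on [k] would not close with the bound by
   the full sum. *)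
have H N k : nm (u (N + k)%N - u N) <= c * q ^+ N / (1 - q) * (1 - q ^+ k).
  have q10 : 1 - q != 0 by lra.
  elim: k => [|k IH]; first by rewrite addn0 subrr nm0 expr0 subrr mulr0.
  have := nm_tri (u (N + k.+1)%N) (u (N + k)%N) (u N).
  have := uc (N + k)%N; rewrite addnS.
  suff -> : c * q ^+ N / (1 - q) * (1 - q ^+ k.+1) =
    c * q ^+ (N + k) + c * q ^+ N / (1 - q) * (1 - q ^+ k) by lra.
  rewrite exprD exprS.
  field.
  exact: q10.
apply: cauchy_complex => e e0.
have : (fun N => c / (1 - q) * q ^+ N) @ \oo --> (c / (1 - q) * 0 : R).
  by apply: cvgMr; apply: cvg_expr; rewrite ger0_norm.
rewrite mulr0 => /cvgrPdist_lt /(_ _ e0) [N _ /(_ N (leqnn _))] /=.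
rewrite sub0r normrN => hN; exists N => k Nk.
have := H N (k - N)%N; rewrite subnKC // => le1.
apply: le_lt_trans le1 _; apply: le_lt_trans hN.
apply: le_trans (ler_norm _).
have p0 : 0 <= c / (1 - q) by rewrite divr_ge0 // subr_ge0 ltW.
rewrite -(mulrAC c) -[leRHS]mulr1; apply: ler_wpM2l.
  by rewrite mulr_ge0 // exprn_ge0.
by rewrite gerBl exprn_ge0.
Qed.

End Modulus.

Arguments nm : simpl never.

(** * Power series in one variable *)

Section PowerSeries1.
Variable R : realType.
Local Notation C := (Cplx R).
Implicit Types (z w s t x y h : C) (r e M : R) (b c : nat -> C) (u v : C -> C).

Definition psum1 c (N : nat) t : C := \sum_(i < N) c i * t ^+ i.

Definition coef_bound1 c r : Prop :=
  0 < r /\ exists M, forall i, nm (c i) * r ^+ i <= M.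

(** The geometric bound on the coefficients travels with the convergence, because every tail
    estimate is read off from it. *)
Definition is_psum1 c r u : Prop :=
  coef_bound1 c r /\ forall t, nm t < r -> (psum1 c ^~ t) @ \oo --> u t.

Lemma geo_half N : \sum_(i < N) (2^-1 : R) ^+ i <= 2.
Proof.
suff -> : \sum_(i < N) (2^-1 : R) ^+ i = 2 - 2 * 2^-1 ^+ N.
  by rewrite lerBlDr lerDl mulr_ge0 // exprn_ge0.
elim: N => [|N IH]; first by rewrite big_ord0 expr0; lra.
by rewrite big_ord_recr /= IH exprS; lra.
Qed.

Lemma natr_le_exp2 i : i%:R <= (2 : R) ^+ i.
Proof. by rewrite -natrX ler_nat ltnW // ltn_expl. Qed.

Lemma nat_seq_bounded (f : nat -> R) N K :
  (forall i, (N <= i)%N -> f i <= K) -> exists M, forall i, f i <= M.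
Proof.
elim: N K => [|N IH] K fK; first by exists K => i; exact: fK.
apply: (IH (Num.max K (f N))) => i; rewrite leq_eqVlt => /orP[/eqP <-|Ni].
  by rewrite le_max lexx orbT.
by rewrite le_max fK.
Qed.

(** The radius is halved so that [r / 2] is a point of convergence. There consecutive partial sums
    are eventually within 1 of the limit, so the terms are bounded by 2. *)
Lemma power_series1_psum b u : power_series1 b u -> exists r, is_psum1 b r u.
Proof.
case=> _ /gt0_rc [r r0 ->] bu.
have bu' t : nm t < r -> (psum1 b ^~ t) @ \oo --> u t.
  move=> tr; have /bu tu : `|t| < rc r by rewrite normE ltc_rc.
  by apply: (cvg_ext (N0 := 0) tu) => k _; rewrite /psum1 seriesEord.
exists (r / 2); split; last by move=> t tr; apply: bu'; lra.
split; first by rewrite divr_gt0.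
have tr : nm (rc (r / 2)) < r by rewrite nm_rc; lra.
have /cvgnP /(_ 1 ltr01) [N uN] := bu' _ tr.
apply: (@nat_seq_bounded _ N 2) => k Nk.
have := uN _ Nk; have := uN _ (leqW Nk); rewrite /psum1 big_ord_recr /=.
set S := \sum_(i < k) _; set z := _ * _ => l1 l2.
have -> : nm (b k) * (r / 2) ^+ k = nm z.
  by rewrite /z nmM nmX nm_rc // divr_ge0 // ltW.
have -> : z = (S + z - u (rc (r / 2))) - (S - u (rc (r / 2))) by ring.
apply: le_trans (nmB _ _) _; lra.
Qed.

Lemma psum1_power_series c r u : is_psum1 c r u -> power_series1 c u.
Proof.
case=> [[r0 _] cu]; exists (rc r); first by rewrite -[0]/(rc 0) ltc_rc.
move=> t; rewrite normE ltc_rc => /cu tu.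
by apply: (cvg_ext (N0 := 0) tu) => k _; rewrite /psum1 seriesEord.
Qed.

Lemma is_psum1_0 c r u : is_psum1 c r u -> u 0 = c 0%N.
Proof.
case=> [[r0 _] cu]; apply: (cvg_uniq (cu 0 _)); first by rewrite nm0.
apply: (@cvg_ext _ (fun _ => c 0%N) _ _ 1); first exact: cvg_cst.
move=> [//|N] _; rewrite /psum1 big_ord_recl expr0 mulr1 big1 ?addr0 // => i _.
by rewrite exprS mul0r mulr0.
Qed.

Lemma nm_subrX (mu : R) s t i : nm s <= mu -> nm t <= mu ->
  nm (s ^+ i.+1 - t ^+ i.+1) <= i.+1%:R * mu ^+ i * nm (s - t).
Proof.
move=> sm tm; rewrite subrXX nmM mulrC ler_wpM2r ?nm_ge0 //.
have -> : i.+1%:R * mu ^+ i = \sum_(j < i.+1) mu ^+ i.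
  by rewrite sumr_const card_ord mulr_natl.
apply: nm_sum_le => j _; rewrite nmM !nmX /=.
rewrite -[in leRHS](subnK (ltnSE (ltn_ord j))) exprD.
by rewrite ler_pM ?exprn_ge0 ?nm_ge0 // lerXn2r ?nnegrE ?nm_ge0 // (le_trans _ sm) ?nm_ge0.
Qed.

(** The workhorse of the estimates: truncation costs a power of [mu] and keeps the factor [s - t],
    so differences at two points can be compared even when the points merge. *)
Lemma psum1_lipschitz c r u : is_psum1 c r u -> exists2 sg, 0 < sg & forall k,
  exists2 K, 0 <= K & forall mu s t, nm s <= mu -> nm t <= mu -> mu <= sg ->
  nm (u s - u t - (psum1 c k.+1 s - psum1 c k.+1 t)) <= K * mu ^+ k * nm (s - t).
Proof.
(* Factoring out [s - t] in degree [k + 1 + i] produces a factor [k + i + 1], at most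
   [2 ^+ (k + i).+1]; the radius [r / 4] still leaves the ratio 1/2 for the sum over [i]. *)
case=> [[r0 [M cM]] cu]; exists (r / 4); first by rewrite divr_gt0.
have M0 : 0 <= M by apply: le_trans (cM 0%N); rewrite mulr_ge0 ?nm_ge0 ?exprn_ge0 // ltW.
move=> k; pose K := M * (2 / r) ^+ k.+1.
have K0 : 0 <= K by rewrite mulr_ge0 // exprn_ge0 // divr_ge0 // ltW.
exists (K * 2) => [|mu s t sm tm msg]; first by rewrite mulr_ge0.
have mu0 : 0 <= mu := le_trans (nm_ge0 s) sm.
have cv : (fun N => psum1 c N s - psum1 c N t - (psum1 c k.+1 s - psum1 c k.+1 t))
    @ \oo --> u s - u t - (psum1 c k.+1 s - psum1 c k.+1 t).
  by apply: cvgB; [apply: cvgB; apply: cu; lra|exact: cvg_cst].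
apply: (cvg_nm_le (N0 := k.+1) cv) => N /subnKC <-; set n := (N - k.+1)%N.
have -> : psum1 c (k.+1 + n) s - psum1 c (k.+1 + n) t -
    (psum1 c k.+1 s - psum1 c k.+1 t) =
    \sum_(i < n) c (k.+1 + i)%N * (s ^+ (k + i).+1 - t ^+ (k + i).+1).
  rewrite /psum1 !big_split_ord /=.
  under [in RHS]eq_bigr do rewrite mulrBr.
  by rewrite sumrB; ring.
apply: (@le_trans _ _ (\sum_(i < n) K * mu ^+ k * nm (s - t) * 2^-1 ^+ i)); last first.
  rewrite -mulr_sumr (_ : K * 2 * _ * _ = K * mu ^+ k * nm (s - t) * 2); last by ring.
  apply: ler_wpM2l (geo_half _).
  by rewrite mulr_ge0 ?nm_ge0 // mulr_ge0 ?exprn_ge0.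
apply: nm_sum_le => i _; rewrite nmM.
apply: le_trans (ler_wpM2l (nm_ge0 _) (nm_subrX _ sm tm)) _.
rewrite mulrA [leRHS]mulrAC ler_wpM2r ?nm_ge0 //.
have step1 : nm (c (k.+1 + i)%N) <= M / r ^+ (k.+1 + i).
  by rewrite ler_pdivlMr ?exprn_gt0.
have step2 : mu ^+ (k + i) <= mu ^+ k * (r / 4) ^+ i.
  by rewrite exprD ler_wpM2l ?exprn_ge0 // lerXn2r ?nnegrE // divr_ge0 // ltW.
have := natr_le_exp2 (k + i).+1 => step3.
apply: (@le_trans _ _ (M / r ^+ (k.+1 + i) * (2 ^+ (k + i).+1 * (mu ^+ k * (r / 4) ^+ i)))).
  by rewrite ler_pM ?nm_ge0 ?mulr_ge0 ?exprn_ge0 // ler_pM ?exprn_ge0.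
rewrite le_eqVlt; apply/orP; left; apply/eqP; rewrite /K addSn !exprMn !exprS !exprD !exprVn.
have -> : (4 : R) ^+ i = 2 ^+ i * 2 ^+ i by rewrite -exprMn; congr (_ ^+ _); ring.
have := expf_neq0 i (lt0r_neq0 r0); have := expf_neq0 k (lt0r_neq0 r0) => rk ri.
field.
by rewrite !expf_neq0 ?lt0r_neq0.
Qed.

End PowerSeries1.

(** * Power series in two variables *)

Section DominatedDoubleSums.
Variable R : realType.
Local Notation C := (Cplx R).
Implicit Types (F : nat -> nat -> C).

Definition dsum F N P : C := \sum_(i < N) \sum_(j < P) F i j.

Definition dominated F (K : R) := forall i j, nm (F i j) <= K * 2^-1 ^+ (i + j).

Lemma dominated_ge0 F K : dominated F K -> 0 <= K.
Proof. by move=> /(_ 0 0)%N; rewrite expr0 mulr1; exact: le_trans (nm_ge0 _). Qed.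

Lemma dsum_row F K N P : dominated F K ->
  nm (\sum_(j < P) F N j) <= 2 * K * 2^-1 ^+ N.
Proof.
move=> dF; have K0 := dominated_ge0 dF.
apply: (@le_trans _ _ (\sum_(j < P) K * 2^-1 ^+ N * 2^-1 ^+ j)).
  by apply: nm_sum_le => j _; rewrite -mulrA -exprD.
rewrite -mulr_sumr (_ : 2 * K * _ = K * 2^-1 ^+ N * 2); last by ring.
by apply: ler_wpM2l (geo_half _ _); rewrite mulr_ge0 ?exprn_ge0.
Qed.

Lemma dsum_swap F N P : dsum F N P = dsum (fun i j => F j i) P N.
Proof. by rewrite /dsum exchange_big. Qed.

Lemma dominated_swap F K : dominated F K -> dominated (fun i j => F j i) K.
Proof. by move=> dF i j; rewrite addnC. Qed.

Lemma dsum_bound F K N P : dominated F K -> nm (dsum F N P) <= 4 * K.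
Proof.
move=> dF; have K0 := dominated_ge0 dF.
apply: (@le_trans _ _ (\sum_(i < N) 2 * K * 2^-1 ^+ i)).
  by apply: nm_sum_le => i _; exact: dsum_row.
rewrite -mulr_sumr (_ : 4 * K = 2 * K * 2); last by ring.
by apply: ler_wpM2l (geo_half _ _); rewrite mulr_ge0.
Qed.

Lemma dsum_recl F N P : dsum F N.+1 P = dsum F N P + \sum_(j < P) F N j.
Proof. by rewrite /dsum big_ord_recr. Qed.

Lemma dsum_recr F N P : dsum F N P.+1 = dsum F N P + \sum_(i < N) F i P.
Proof. by rewrite dsum_swap dsum_recl dsum_swap. Qed.

Lemma dsum_cvg F K : dominated F K -> exists l : C, (fun N => dsum F N N) @ \oo --> l.
Proof.
move=> dF; have K0 := dominated_ge0 dF.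
apply: (@geometric_cvg _ _ (4 * K) 2^-1); [by rewrite mulr_ge0|lra|move=> k].
rewrite dsum_recl dsum_recr.
rewrite [X in nm X](_ : _ = \sum_(i < k) F i k + \sum_(j < k.+1) F k j); last by ring.
apply: le_trans (nmD _ _) _.
have := dsum_row k k.+1 dF; have := dsum_row k k (dominated_swap dF); lra.
Qed.

Lemma cvg_geo0 (u : nat -> C) (K : R) : (forall N, nm (u N) <= K * 2^-1 ^+ N) ->
  u @ \oo --> (0 : C).
Proof.
move=> uK; apply/cvgnP => e e0.
have : (fun N => K * 2^-1 ^+ N) @ \oo --> (K * 0 : R).
  by apply: cvgMr; apply: cvg_expr; rewrite ger0_norm //; lra.
rewrite mulr0 => /cvgrPdist_lt /(_ _ e0) [N _ hN]; exists N => k /hN /=.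
rewrite sub0r normrN subr0; apply: le_lt_trans; apply: le_trans (uK _) _.
exact: ler_norm.
Qed.

(** Square sums of a function correspond to sums of its partial derivatives that are one row or
    column off square; the extra row tends to 0. *)
Lemma dsum_rectl F K (l : C) : dominated F K ->
  (fun N => dsum F N N) @ \oo --> l -> (fun N => dsum F N.+1 N) @ \oo --> l.
Proof.
move=> dF cl; rewrite -[l]addr0; under eq_fun do rewrite dsum_recl.
apply: cvgD cl _; apply: (cvg_geo0 (K := 2 * K)) => N; exact: dsum_row.
Qed.

Lemma dsum_rectr F K (l : C) : dominated F K ->
  (fun N => dsum F N N) @ \oo --> l -> (fun N => dsum F N N.+1) @ \oo --> l.
Proof.
move=> dF cl; under eq_fun do rewrite dsum_swap.
apply: (dsum_rectl (dominated_swap dF)).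
by under eq_fun do rewrite -dsum_swap.
Qed.

End DominatedDoubleSums.

Section PowerSeries2.
Variable R : realType.
Local Notation C := (Cplx R).
Implicit Types (x y h l z w : C) (r M : R) (a : nat -> nat -> C) (f g : C * C -> C).

Definition mono2 a x y i j : C := a i j * x ^+ i * y ^+ j.

Definition bounded2 a r M := forall i j, nm (a i j) * r ^+ (i + j) <= M.

Definition is_psum2 a r f : Prop :=
  [/\ 0 < r, exists M, bounded2 a r M &
    forall x y, nm x < r -> nm y < r ->
      (fun N => dsum (mono2 a x y) N N) @ \oo --> f (x, y)].

Lemma power_series2P a f : power_series2 a f <-> exists r, is_psum2 a r f.
Proof.
split=> [[_ [M [/gt0_rc [r r0 ->] aM af]]]|[r [r0 [M aM] af]]].
  have M0 : 0 <= M.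
    by apply: le_trans (aM 0 0)%N; rewrite mulr_ge0 // exprn_ge0 // -[0]/(rc 0) lec_rc ltW.
  have [M' _ eM] := ge0_rc M0.
  exists r; split=> // [|x y xr yr]; last first.
    by apply: af; rewrite normE ltc_rc.
  exists M' => i j; rewrite -lec_rc -eM; apply: le_trans (aM i j).
  by rewrite normE /rc rmorphM rmorphXn.
exists (rc r), (rc M); split; first by rewrite -[0]/(rc 0) ltc_rc.
  by move=> i j; rewrite normE /rc -rmorphXn -rmorphM; rewrite -/(rc _) -/(rc _) lec_rc.
by move=> x y; rewrite !normE !ltc_rc; exact: af.
Qed.

Lemma mono2_dominated a r M x y : 0 < r -> bounded2 a r M ->
  nm x <= r / 2 -> nm y <= r / 2 -> dominated (mono2 a x y) M.
Proof.
move=> r0 aM xr yr i j; rewrite /mono2 !nmM !nmX.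
have M0 : 0 <= M by apply: le_trans (aM 0 0)%N; rewrite mulr1 nm_ge0.
apply: (@le_trans _ _ (nm (a i j) * (r / 2) ^+ (i + j))).
  rewrite exprD -mulrA ler_wpM2l ?nm_ge0 //.
  have r2 : 0 <= r / 2 by rewrite divr_ge0 // ltW.
  by rewrite ler_pM ?exprn_ge0 ?nm_ge0 // lerXn2r ?nnegrE ?nm_ge0.
by rewrite exprMn mulrA ler_wpM2r ?exprn_ge0.
Qed.

Definition dcoefx a i j : C := i.+1%:R * a i.+1 j.
Definition dcoefy a i j : C := j.+1%:R * a i j.+1.

Lemma dcoefx_bounded a r M : 0 < r -> bounded2 a r M ->
  bounded2 (dcoefx a) (r / 2) (M / r).
Proof.
move=> r0 aM i j; rewrite /dcoefx nmM nm_nat.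
have M0 : 0 <= M by apply: le_trans (aM 0 0)%N; rewrite mulr1 nm_ge0.
have H : i.+1%:R <= (2 : R) ^+ (i + j).
  by rewrite -natrX ler_nat (leq_trans (ltn_expl i (isT : 1 < 2)%N)) // leq_exp2l ?leq_addr.
apply: (@le_trans _ _ (2 ^+ (i + j) * (M / r ^+ (i.+1 + j)) * (r / 2) ^+ (i + j))).
  apply: ler_wpM2r; first by rewrite exprn_ge0 // divr_ge0 // ltW.
  by apply: ler_pM => //; rewrite ?nm_ge0 // ler_pdivlMr ?exprn_gt0.
rewrite le_eqVlt; apply/orP; left; apply/eqP.
rewrite addSn exprMn exprS exprVn; field.
by rewrite !expf_neq0 ?lt0r_neq0.
Qed.

Lemma dcoefy_bounded a r M : 0 < r -> bounded2 a r M ->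
  bounded2 (dcoefy a) (r / 2) (M / r).
Proof.
move=> r0 aM i j; rewrite addnC.
apply: (@dcoefx_bounded (fun i j => a j i) r M r0 _ j i) => {}i {}j.
by rewrite addnC.
Qed.

Lemma bounded2_psum a r M : 0 < r -> bounded2 a r M -> exists f, is_psum2 a (r / 2) f.
Proof.
move=> r0 aM.
have H (p : C * C) : exists l : C, nm p.1 < r / 2 -> nm p.2 < r / 2 ->
    (fun N => dsum (mono2 a p.1 p.2) N N) @ \oo --> l.
  (* Off the polydisc the value is a default 0; the function only has to be total. *)
  have [[p1 p2]|np] := pselect (nm p.1 < r / 2 /\ nm p.2 < r / 2); last first.
    by exists 0 => p1 p2; case: np.
  have [l cl] := dsum_cvg (mono2_dominated r0 aM (ltW p1) (ltW p2)).
  by exists l.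
have [f fP] := choice H; exists f; split; first by rewrite divr_gt0.
  have M0 : 0 <= M by apply: le_trans (aM 0 0)%N; rewrite mulr1 nm_ge0.
  exists M => i j; apply: le_trans (aM i j); apply: ler_wpM2l; first exact: nm_ge0.
  by apply: lerXn2r; rewrite ?nnegrE; lra.
by move=> x y; exact: (fP (x, y)).
Qed.

Lemma psum2_bounded a r f : is_psum2 a r f ->
  exists M, forall x y, nm x <= r / 2 -> nm y <= r / 2 -> nm (f (x, y)) <= M.
Proof.
case=> r0 [M aM] af; exists (4 * M) => x y xr yr.
apply: (cvg_nm_le (N0 := 0) (af x y _ _)); [lra|lra|move=> k _].
by apply: dsum_bound; exact: mono2_dominated aM xr yr.
Qed.

End PowerSeries2.

(** * First order Taylor expansion in two variables *)

Section Taylor2.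
Variable R : realType.
Local Notation C := (Cplx R).
Implicit Types (x y h l z w : C) (r M : R) (a : nat -> nat -> C) (f g : C * C -> C).

Lemma cvg_succ (u : nat -> C) l : u @ \oo --> l -> (fun N => u N.+1) @ \oo --> l.
Proof.
move=> /cvgnP ul; apply/cvgnP => e /ul [N uN]; exists N => k Nk.
exact: uN (leqW Nk).
Qed.

Section Term.
Variables (sg q : R) (sg0 : 0 <= sg) (q0 : 0 <= q).

Lemma natr_exp_le i : i%:R * sg ^+ i <= (2 * sg) ^+ i.
Proof. by rewrite exprMn ler_wpM2r ?exprn_ge0 ?natr_le_exp2. Qed.

Lemma nm_expr_le x (s : R) i : nm x <= s -> nm (x ^+ i) <= s ^+ i.
Proof.
move=> xs; rewrite nmX lerXn2r ?nnegrE ?nm_ge0 //.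
exact: le_trans (nm_ge0 x) xs.
Qed.

Lemma nm_dterm x h i : nm x <= sg -> nm h <= sg * q ->
  nm (i%:R * x ^+ i.-1 * h) <= i%:R * sg ^+ i * q.
Proof.
move=> xs hs; case: i => [|i]; first by rewrite !mul0r nm0.
rewrite !nmM nm_nat /= exprSr -!mulrA ler_wpM2l // ler_pM ?nm_ge0 //.
exact: nm_expr_le.
Qed.

(** Increments are measured as [sg * q], so that the remainders in all degrees share the factor
    [q ^+ 2] and no negative power of [sg] appears. In the induction the remainder in degree [i + 1]
    is [x + h] times the previous one plus [h] times the previous linear term. *)
Lemma nm_eterm x h i : nm x <= sg -> nm h <= sg * q -> q <= 1 ->
  nm ((x + h) ^+ i - x ^+ i - i%:R * x ^+ i.-1 * h) <= i%:R * (2 * sg) ^+ i * q ^+ 2.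
Proof.
move=> xs hs q1; elim: i => [|i IH]; first by rewrite !expr0 subrr !mul0r subr0 nm0.
rewrite [X in nm X](_ : _ = (x + h) * ((x + h) ^+ i - x ^+ i - i%:R * x ^+ i.-1 * h)
    + (i%:R * x ^+ i.-1 * h) * h); last first.
  case: i {IH} => [|i] /=; first by rewrite !expr1 !expr0; ring.
  by rewrite !exprS -!natr1; ring.
apply: le_trans (nmD _ _) _; rewrite !(nmM (x + h)) (nmM _ h).
have xh : nm (x + h) <= 2 * sg.
  apply: le_trans (nmD _ _) _; have : sg * q <= sg * 1 by exact: ler_wpM2l.
  lra.
have A : nm (x + h) * nm ((x + h) ^+ i - x ^+ i - i%:R * x ^+ i.-1 * h) <=
   2 * sg * (i%:R * (2 * sg) ^+ i * q ^+ 2) by exact: ler_pM (nm_ge0 _) (nm_ge0 _) xh IH.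
have B : nm (i%:R * x ^+ i.-1 * h) * nm h <= i%:R * sg ^+ i * q * (sg * q).
  exact: ler_pM (nm_ge0 _) (nm_ge0 _) (nm_dterm _ xs hs) hs.
have D : sg * q ^+ 2 * (i%:R * sg ^+ i) <= sg * q ^+ 2 * (2 * sg) ^+ i.
  by apply: ler_wpM2l (natr_exp_le _); rewrite mulr_ge0 ?exprn_ge0.
have E : 0 <= sg * q ^+ 2 * (2 * sg) ^+ i.
  by rewrite !mulr_ge0 ?exprn_ge0 // mulr_ge0.
rewrite exprS -natr1; nra.
Qed.

End Term.

(** With each power written as value, linear term and remainder, the product is
    [(X + D + E) * (Y + D' + E')]. Removing [X Y], [D Y] and [X D'] leaves six products, each
    carrying [q ^+ 2]. *)
Lemma nm_taylor_term (sg q : R) x y h l i j : 0 <= sg -> 0 <= q <= 1 ->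
  nm x <= sg -> nm y <= sg -> nm h <= sg * q -> nm l <= sg * q ->
  nm ((x + h) ^+ i * (y + l) ^+ j - x ^+ i * y ^+ j
      - (i%:R * x ^+ i.-1 * h * y ^+ j + x ^+ i * (j%:R * y ^+ j.-1 * l)))
    <= 6 * q ^+ 2 * (4 * sg) ^+ (i + j).
Proof.
move=> sg0 /andP[q0 q1] xs ys hs ls.
have sg4 k : sg ^+ k <= (4 * sg) ^+ k by apply: lerXn2r; rewrite ?nnegrE; lra.
have sg24 k : (2 * sg) ^+ k <= (4 * sg) ^+ k by apply: lerXn2r; rewrite ?nnegrE; lra.
have q2 : q ^+ 2 <= q by rewrite expr2 -[leRHS]mulr1 ler_wpM2l.
have q2_0 : 0 <= q ^+ 2 by exact: exprn_ge0.
have P4 k : 0 <= (4 * sg) ^+ k by rewrite exprn_ge0 // mulr_ge0.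
have bx z k : nm z <= sg -> nm (z ^+ k) <= (4 * sg) ^+ k.
  by move=> zs; apply: le_trans (nm_expr_le _ zs) (sg4 _).
have bd z w k : nm z <= sg -> nm w <= sg * q ->
    nm (k%:R * z ^+ k.-1 * w) <= (4 * sg) ^+ k * q.
  move=> zs ws; apply: le_trans (nm_dterm _ zs ws) _.
  by apply: ler_wpM2r => //; apply: le_trans (natr_exp_le sg0 _) (sg24 _).
have be z w k : nm z <= sg -> nm w <= sg * q ->
    nm ((z + w) ^+ k - z ^+ k - k%:R * z ^+ k.-1 * w) <= (4 * sg) ^+ k * q ^+ 2.
  move=> zs ws; apply: le_trans (nm_eterm sg0 q0 k zs ws q1) _.
  apply: ler_wpM2r => //.
  apply: le_trans (natr_exp_le _ _) _; first by rewrite mulr_ge0.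
  by rewrite mulrA -natrM.
have {bx be bd} := (bx x i xs, bx y j ys, bd x h i xs hs, bd y l j ys ls,
  be x h i xs hs, be y l j ys ls).
set X := x ^+ i; set Y := y ^+ j; set D := i%:R * _ * _; set D' := j%:R * _ * _.
set E := _ - D; set E' := _ - D'.
have -> : (x + h) ^+ i = X + D + E by rewrite /E; ring.
have -> : (y + l) ^+ j = Y + D' + E' by rewrite /E'; ring.
rewrite exprD; have := P4 i; have := P4 j; move: (_ ^+ i) (_ ^+ j) => A B B0 A0.
move=> [[[[[hX hY] hD] hD'] hE] hE'].
rewrite [X in nm X](_ : _ = X * E' + D * D' + D * E' + E * Y + E * D' + E * E'); last by ring.
have T z w (c d : R) : nm z <= A * c -> nm w <= B * d -> 0 <= c * d <= q ^+ 2 ->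
    nm (z * w) <= A * B * q ^+ 2.
  move=> zc wd /andP[_ cd]; rewrite nmM.
  apply: le_trans (ler_pM (nm_ge0 _) (nm_ge0 _) zc wd) _.
  by rewrite mulrACA ler_wpM2l ?mulr_ge0.
have q3 : q * q ^+ 2 <= q ^+ 2 by rewrite -[leRHS]mul1r ler_wpM2r.
have q4 : q ^+ 2 * q ^+ 2 <= q ^+ 2.
  by rewrite -[leRHS]mul1r ler_wpM2r // (le_trans q2).
rewrite -[A]mulr1 in hX; rewrite -[B]mulr1 in hY.
have t1 := T _ _ _ _ hX hE'; have t2 := T _ _ _ _ hD hD'.
have t3 := T _ _ _ _ hD hE'; have t4 := T _ _ _ _ hE hY.
have t5 := T _ _ _ _ hE hD'; have t6 := T _ _ _ _ hE hE'.
have -> : 6 * q ^+ 2 * (A * B) = A * B * q ^+ 2 + A * B * q ^+ 2 + A * B * q ^+ 2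
   + A * B * q ^+ 2 + A * B * q ^+ 2 + A * B * q ^+ 2 by ring.
apply: le_trans (nmD _ _) _; apply: lerD; last by apply: t6; rewrite q4 andbT mulr_ge0.
apply: le_trans (nmD _ _) _; apply: lerD; last first.
  by apply: t5; rewrite mulrC q3 andbT mulr_ge0.
apply: le_trans (nmD _ _) _; apply: lerD; last by apply: t4; rewrite mulr1 lexx andbT.
apply: le_trans (nmD _ _) _; apply: lerD; last by apply: t3; rewrite q3 andbT mulr_ge0.
apply: le_trans (nmD _ _) _; apply: lerD; first by apply: t1; rewrite mul1r lexx andbT.
by apply: t2; rewrite -expr2 lexx andbT.
Qed.

(** A uniform expansion with quadratic error; both the directional derivatives of [f] and the chain
    rule along eta are drawn from it. *)
Definition taylor2 f fx fy (sg K : R) : Prop :=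
  forall x y h l (d : R), nm x <= sg -> nm y <= sg -> nm h <= d -> nm l <= d ->
  d <= sg -> nm (f (x + h, y + l) - f (x, y) - (h * fx (x, y) + l * fy (x, y)))
    <= K * d ^+ 2.

Lemma psum2_taylor a r f : is_psum2 a r f -> exists fx fy,
  [/\ is_psum2 (dcoefx a) (r / 4) fx, is_psum2 (dcoefy a) (r / 4) fy &
    exists2 K, 0 <= K & taylor2 f fx fy (r / 8) K].
Proof.
case=> r0 [M aM] af.
have M0 : 0 <= M by apply: le_trans (aM 0 0)%N; rewrite mulr1 nm_ge0.
have bx := dcoefx_bounded r0 aM; have by_ := dcoefy_bounded r0 aM.
have r20 : 0 < r / 2 by rewrite divr_gt0.
have [fx hx] := bounded2_psum r20 bx; have [fy hy] := bounded2_psum r20 by_.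
have r24 : r / 2 / 2 = r / 4 by field.
rewrite r24 in hx hy.
exists fx, fy; split=> //; exists (4 * (M * 6 * (8 / r) ^+ 2)).
  by have := exprn_ge0 2 (ltW (divr_gt0 (ltr0n _ 8) r0)); nra.
move=> x y h l d xs ys hd ld ds.
have d0 : 0 <= d := le_trans (nm_ge0 h) hd.
(* With [sg = r / 8] the termwise bound carries [(4 * sg) ^+ (i + j)], that is [(r / 2) ^+ (i + j)],
   which against the coefficient bound leaves powers of 1/2. *)
pose q := d / (r / 8).
have q0 : 0 <= q by rewrite divr_ge0 // divr_ge0 // ltW.
have q1 : q <= 1 by rewrite ler_pdivrMr ?mul1r // divr_gt0.
have qd : r / 8 * q = d by rewrite /q mulrC divfK // lt0r_neq0 // divr_gt0.
have xh : nm (x + h) <= r / 4 by apply: le_trans (nmD _ _) _; lra.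
have yl : nm (y + l) <= r / 4 by apply: le_trans (nmD _ _) _; lra.
pose T i j := a i j * ((x + h) ^+ i * (y + l) ^+ j - x ^+ i * y ^+ j
      - (i%:R * x ^+ i.-1 * h * y ^+ j + x ^+ i * (j%:R * y ^+ j.-1 * l))).
have TM : dominated T (M * 6 * (8 / r) ^+ 2 * d ^+ 2).
  move=> i j; rewrite nmM.
  have sg0 : 0 <= r / 8 by lra.
  have := nm_taylor_term i j sg0 (q := q); rewrite qd q0 q1.
  move=> /(_ _ _ _ _ isT xs ys hd ld) /(ler_wpM2l (nm_ge0 (a i j))) tt.
  apply: le_trans tt _.
  have -> : 4 * (r / 8) = r * 2^-1 by field.
  rewrite [(r * 2^-1) ^+ _]exprMn.
  have -> : nm (a i j) * (6 * q ^+ 2 * (r ^+ (i + j) * 2^-1 ^+ (i + j))) =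
    nm (a i j) * r ^+ (i + j) * (6 * q ^+ 2 * 2^-1 ^+ (i + j)) by ring.
  have -> : M * 6 * (8 / r) ^+ 2 * d ^+ 2 * 2^-1 ^+ (i + j) =
     M * (6 * q ^+ 2 * 2^-1 ^+ (i + j)).
    have -> : q = 8 / r * d by rewrite /q; field; rewrite lt0r_neq0.
    by rewrite exprMn; ring.
  apply: ler_wpM2r (aM i j).
  by apply: mulr_ge0; [apply: mulr_ge0; rewrite ?exprn_ge0|rewrite exprn_ge0 ?invr_ge0].
have cv : (fun N => dsum T N.+1 N.+1) @ \oo -->
    f (x + h, y + l) - f (x, y) - (h * fx (x, y) + l * fy (x, y)).
  have -> : (fun N => dsum T N.+1 N.+1) = (fun N =>
    dsum (mono2 a (x + h) (y + l)) N.+1 N.+1 - dsum (mono2 a x y) N.+1 N.+1 -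
    (h * dsum (mono2 (dcoefx a) x y) N N.+1 + l * dsum (mono2 (dcoefy a) x y) N.+1 N)).
    apply/funext => N.
    have -> : h * dsum (mono2 (dcoefx a) x y) N N.+1 =
        dsum (fun i j => a i j * (i%:R * x ^+ i.-1 * h * y ^+ j)) N.+1 N.+1.
      rewrite /dsum big_ord_recl [X in X + _]big1 ?add0r => [|j _]; last first.
        by rewrite !mul0r mulr0.
      rewrite mulr_sumr; apply: eq_bigr => i _; rewrite mulr_sumr.
      by apply: eq_bigr => j _; rewrite /mono2 /dcoefx lift0 /=; ring.
    have -> : l * dsum (mono2 (dcoefy a) x y) N.+1 N =
        dsum (fun i j => a i j * (x ^+ i * (j%:R * y ^+ j.-1 * l))) N.+1 N.+1.
      rewrite /dsum mulr_sumr; apply: eq_bigr => i _; rewrite big_ord_recl.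
      rewrite [X in X + _](_ : _ = 0) ?add0r; last by rewrite /= !(mul0r, mulr0).
      rewrite mulr_sumr.
      by apply: eq_bigr => j _; rewrite /mono2 /dcoefy lift0 /=; ring.
    rewrite /dsum -!sumrB -big_split -sumrB; apply: eq_bigr => i _ /=.
    rewrite -!sumrB -big_split -sumrB; apply: eq_bigr => j _ /=.
    by rewrite /T /mono2; ring.
  have cs z w : nm z <= r / 4 -> nm w <= r / 4 ->
      (fun N => dsum (mono2 a z w) N.+1 N.+1) @ \oo --> f (z, w).
    by move=> zr wr; apply: (cvg_succ (u := fun N => _ N N)); apply: af; lra.
  apply: cvgB; first by apply: cvgB; apply: cs; lra.
  have [xr4 yr4] : nm x <= r / 4 /\ nm y <= r / 4 by lra.
  rewrite -r24 in xr4 yr4.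
  apply: cvgD; apply: cvgMr.
    apply: dsum_rectr (mono2_dominated r20 bx xr4 yr4) _.
    by case: hx => _ _; apply; lra.
  apply: dsum_rectl (mono2_dominated r20 by_ xr4 yr4) _.
  by case: hy => _ _; apply; lra.
rewrite -mulrA; apply: (cvg_nm_le (N0 := 0) cv) => N _; exact: dsum_bound.
Qed.

End Taylor2.

(** * Partial derivatives, the chain rule, and functions dominating their gradient *)

Section Derivatives.
Variable R : realType.
Local Notation C := (Cplx R).
Implicit Types (s t x y h l z w : C) (r M : R) (a : nat -> nat -> C) (b : nat -> C)
  (f g fx fy : C * C -> C) (u v : C -> C).

Lemma derive_taylor (f : C * C -> C) (p v : C * C) (L : C) (d K : R) : 0 < d ->
  (forall h, nm h <= d -> nm (f (p + h *: v) - f p - h * L) <= K * nm h ^+ 2) ->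
  'D_v f p = L.
Proof.
move=> d0 fK; apply: (@cvg_lim C^o); first exact: norm_hausdorff.
apply/cvgrPdist_lt => _ /gt0_rc [e e0 ->].
have K1 : 0 < `|K| + 1 by rewrite ltr_wpDl.
have : \forall h \near (0 : C), nm h < Num.min d (e / (`|K| + 1)).
  by apply/near0P; exists (Num.min d (e / (`|K| + 1))); rewrite // lt_min d0 divr_gt0.
move=> H; rewrite near_withinE; apply: filterS H => h; rewrite lt_min => /andP[hd he] h0.
rewrite normE ltc_rc /= [h *: v + p]addrC.
have -> : L - h^-1 *: (f (p + h *: v) - f p) =
    - (h^-1 * (f (p + h *: v) - f p - h * L)).
  by rewrite /GRing.scale /=; field.
have nh : 0 < nm h by rewrite nm_gt0.
rewrite nmN nmM nmV mulrC ltr_pdivrMr //.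
apply: le_lt_trans (fK _ (ltW hd)) _; rewrite expr2 mulrA ltr_pM2r //.
move: he; rewrite ltr_pdivlMr // => he; have := ler_norm K; nra.
Qed.

Lemma taylor2_fx f fx fy (sg K : R) x y : 0 < sg -> taylor2 f fx fy sg K ->
  nm x <= sg -> nm y <= sg -> f_x f (x, y) = fx (x, y).
Proof.
move=> sg0 tf xs ys; apply: (derive_taylor sg0 (K := K)) => h hs.
have := tf x y h 0 _ xs ys (lexx _) _ hs; rewrite nm0 mul0r !addr0 => /(_ (nm_ge0 _)).
by congr (nm (f _ - _ - _) <= _); congr pair; rewrite /= ?scaler0 /GRing.scale /= ?mulr1 ?mulr0 ?addr0.
Qed.

Lemma taylor2_fy f fx fy (sg K : R) x y : 0 < sg -> taylor2 f fx fy sg K ->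
  nm x <= sg -> nm y <= sg -> f_y f (x, y) = fy (x, y).
Proof.
move=> sg0 tf xs ys; apply: (derive_taylor sg0 (K := K)) => h hs.
have := tf x y 0 h _ xs ys _ (lexx _) hs; rewrite nm0 mul0r add0r addr0 => /(_ (nm_ge0 _)).
by congr (nm (f _ - _ - _) <= _); congr pair; rewrite /= ?scaler0 /GRing.scale /= ?mulr1 ?mulr0 ?addr0.
Qed.

Lemma is_psum2_0 a r f : is_psum2 a r f -> f (0, 0) = a 0%N 0%N.
Proof.
case=> r0 _ cf; apply: (cvg_uniq (cf 0 0 _ _)); rewrite ?nm0 //.
apply: (@cvg_ext _ (fun _ => a 0%N 0%N) _ _ 1); first exact: cvg_cst.
move=> [//|N] _; rewrite /dsum big_ord_recl big_ord_recl /mono2 !expr0 !mulr1.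
rewrite !big1 ?addr0 // => i _; last by rewrite lift0 exprS mul0r mulr0.
by rewrite big1 // => j _; rewrite lift0 exprS mul0r mulr0 mul0r.
Qed.

(** A series in one variable is read as one constant in the second variable, so that the
    one-variable Taylor formula is a special case of the one in two variables. *)
Lemma is_psum1_2 b r u : is_psum1 b r u ->
  is_psum2 (fun i j => if j == 0%N then b i else 0) r (fun p => u p.1).
Proof.
case=> [[r0 [M bM]] cu]; split=> //.
  exists (Num.max M 0) => i [|j] /=; last by rewrite nm0 mul0r le_max lexx orbT.
  by rewrite addn0 le_max bM.
move=> x y xr _; apply: (cvg_ext (N0 := 1) (cu x xr)) => [[//|N]] _.
apply: eq_bigr => i _; rewrite big_ord_recl /mono2 /= mulr1 big1 ?addr0 // => j _.
by rewrite !mul0r.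
Qed.

Definition taylor1 u v (sg K : R) : Prop := forall t h,
  nm t <= sg -> nm h <= sg -> nm (u (t + h) - u t - h * v t) <= K * nm h ^+ 2.

Definition dcoef b i : C := i.+1%:R * b i.+1.

Lemma psum1_taylor b r u : is_psum1 b r u -> exists v,
  is_psum1 (dcoef b) (r / 4) v /\
  exists2 K, 0 <= K & taylor1 u v (r / 8) K.
Proof.
move=> /is_psum1_2 /psum2_taylor [fx [fy [[r0 [M dM] cfx] _ [K K0 tK]]]].
exists (fun t => fx (t, 0)); split; last first.
  exists K => // t h ts hs.
  have z1 : nm (0 : C) <= r / 8 by rewrite nm0 (le_trans (nm_ge0 _) ts).
  have z2 : nm (0 : C) <= nm h by rewrite nm0 nm_ge0.
  by have := tK t 0 h 0 _ ts z1 (lexx _) z2 hs; rewrite mul0r addr0 addr0.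
split.
  by split=> //; exists M => i; have := dM i 0%N; rewrite addn0.
move=> t tr; apply: (cvg_ext (N0 := 1) (cfx t 0 tr _)); first by rewrite nm0.
move=> [//|N] _; apply: eq_bigr => i _; rewrite big_ord_recl /mono2 /= mulr1 big1 ?addr0 // => j _.
by rewrite /dcoefx /= mulr0 !mul0r.
Qed.

Lemma psum1_near0 b r u : is_psum1 b r u -> exists2 sg, 0 < sg &
  exists2 K, 0 < K & forall t, nm t <= sg -> nm (u t - u 0) <= K * nm t.
Proof.
move=> /psum1_lipschitz [sg sg0 /(_ 0%N) [K K0 uK]]; exists sg => //.
exists (K + 1) => [|t ts]; first by rewrite ltr_wpDl.
have := uK sg t 0 ts _ (lexx _); rewrite nm0 => /(_ (ltW sg0)).
rewrite /psum1 !big_ord1 !expr0 !mulr1 subrr !subr0 => H.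
by apply: le_trans H _; rewrite ler_wpM2r ?nm_ge0 // lerDl.
Qed.

Lemma psum1_bounded b r u : is_psum1 b r u -> exists2 sg, 0 < sg &
  exists2 K, 0 < K & forall t, nm t <= sg -> nm (u t) <= K.
Proof.
move=> /psum1_near0 [sg sg0 [K K0 uK]]; exists sg => //.
exists (K * sg + nm (u 0)).
  by rewrite ltr_pwDl ?nm_ge0 // mulr_gt0.
move=> t ts; have := nmD (u t - u 0) (u 0); rewrite subrK => H.
apply: le_trans H _; rewrite lerD2r; apply: le_trans (uK _ ts) _.
by rewrite ler_wpM2l // ltW.
Qed.

(** For a small real increment [q] the expansions of [X], [Y] and [f] combine to
    [|q E| <= B q ^+ 2], where [E] is the expression to be shown zero; the values of [f] drop out
    because [f] vanishes at both ends. Dividing by [q] leaves [|E| <= B q]. *)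
Lemma chain_rule0 f fx fy (sg K : R) bx by_ rx ry X Y :
  0 < sg -> 0 <= K -> taylor2 f fx fy sg K ->
  is_psum1 bx rx X -> is_psum1 by_ ry Y -> X 0 = 0 -> Y 0 = 0 ->
  (exists2 d : R, 0 < d & forall t, nm t < d -> f (X t, Y t) = 0) ->
  exists X' Y', [/\ is_psum1 (dcoef bx) (rx / 4) X', is_psum1 (dcoef by_) (ry / 4) Y' &
   exists2 d : R, 0 < d & forall t, nm t < d ->
    X' t * fx (X t, Y t) + Y' t * fy (X t, Y t) = 0].
Proof.
move=> sg0 K0 tf hX hY X0 Y0 [d d0 fd].
have [sx sx0 [Kx Kx0 nX]] := psum1_near0 hX.
have [sy sy0 [Ky Ky0 nY]] := psum1_near0 hY.
have rx0 : 0 < rx by case: hX => [[]].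
have ry0 : 0 < ry by case: hY => [[]].
have [X' [hX' [KX KX0 tX]]] := psum1_taylor hX.
have [Y' [hY' [KY KY0 tY]]] := psum1_taylor hY.
have [sx' sx'0 [LX LX0 bX]] := psum1_bounded hX'.
have [sy' sy'0 [LY LY0 bY]] := psum1_bounded hY'.
exists X', Y'; split=> //.
pose S0 := Num.min (Num.min (rx / 8) (ry / 8)) (Num.min sx' sy').
pose S1 := Num.min (Num.min sx sy) (Num.min (sg / Kx) (sg / Ky)).
have [S00 S10] : 0 < S0 /\ 0 < S1 by rewrite !lt_min sx'0 sy'0 sx0 sy0 !divr_gt0.
have [L L0 hL] : exists2 L : R, 0 < L & [/\ LX + KX * S0 <= L & LY + KY * S0 <= L].
  exists (LX + KX * S0 + (LY + KY * S0)); first nra.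
  split; nra.
pose D := Num.min (Num.min S0 S1) (Num.min (d / 2) (sg / L)).
have D0 : 0 < D by rewrite /D lt_min [0 < Num.min S0 _]lt_min S00 S10 /= lt_min !divr_gt0.
exists D => // t.
rewrite !lt_min => /andP[/andP[/andP[/andP[t1 t2] /andP[t3 t4]] /andP[/andP[t5 t6] /andP[t7 t8]]] /andP[t9 t10]].
move: t7 t8; rewrite !ltr_pdivlMr // => t7 t8.
have xs : nm (X t) <= sg.
  by have := nX _ (ltW t5); rewrite X0 subr0 mulrC; lra.
have ys : nm (Y t) <= sg.
  by have := nY _ (ltW t6); rewrite Y0 subr0 mulrC; lra.
set fX := fx _; set fY := fy _; set E := _ + _.
apply/eqP; rewrite -nm_eq0; apply/eqP; apply: eps_eq0 (nm_ge0 _) _.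
pose B := K * L ^+ 2 + KX * nm fX + KY * nm fY.
have B0 : 0 <= B by rewrite !addr_ge0 ?mulr_ge0 ?nm_ge0 ?exprn_ge0 // ltW.
have main (q : R) : 0 < q -> q < D -> nm E <= B * q.
  move=> q0 qD; have nq : nm (rc q) = q by rewrite nm_rc // ltW.
  move: qD; rewrite !lt_min => /andP[/andP[/andP[/andP[q1 q2] /andP[q3 q4]] _] /andP[q9 q10]].
  move: q10; rewrite ltr_pdivlMr // => q10.
  have {}tX := tX t (rc q) (ltW t1); rewrite nq in tX; have {}tX := tX (ltW q1).
  have {}tY := tY t (rc q) (ltW t2); rewrite nq in tY; have {}tY := tY (ltW q2).
  have qS0 : q <= S0 by rewrite !le_min !ltW.
  pose h := X (t + rc q) - X t; pose l := Y (t + rc q) - Y t.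
  have hh : nm h <= L * q.
    have := nmD (h - rc q * X' t) (rc q * X' t); rewrite subrK nmM nq.
    case: hL => hL _.
    have e1 := ler_wpM2l (ltW q0) (bX _ (ltW t3)).
    have e2 : KX * q ^+ 2 <= KX * S0 * q.
      by rewrite expr2 -mulrA ler_wpM2l // ler_wpM2r // ltW.
    have e3 := ler_wpM2r (ltW q0) hL; rewrite /h; lra.
  have hl : nm l <= L * q.
    have := nmD (l - rc q * Y' t) (rc q * Y' t); rewrite subrK nmM nq.
    case: hL => _ hL.
    have e1 := ler_wpM2l (ltW q0) (bY _ (ltW t4)).
    have e2 : KY * q ^+ 2 <= KY * S0 * q.
      by rewrite expr2 -mulrA ler_wpM2l // ler_wpM2r // ltW.
    have e3 := ler_wpM2r (ltW q0) hL; rewrite /l; lra.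
  have Lq : L * q <= sg by rewrite mulrC ltW.
  have := tf _ _ h l _ xs ys hh hl Lq; rewrite /h /l !(addrC _ (_ - X t)) subrK.
  rewrite !(addrC _ (_ - Y t)) subrK -/h -/l -/fX -/fY.
  have tq : nm (t + rc q) < d by apply: le_lt_trans (nmD _ _) _; rewrite nq; lra.
  have td : nm t < d by lra.
  rewrite (fd _ tq) (fd _ td) subrr sub0r nmN => H1.
  have : nm (rc q * E) <= B * q * q.
    have -> : rc q * E = (h * fX + l * fY) - (h - rc q * X' t) * fX -
       (l - rc q * Y' t) * fY by rewrite /E; ring.
    apply: le_trans (nmB _ _) _; apply: (@le_trans _ _ (K * (L * q) ^+ 2 + KX * q ^+ 2 * nm fX + KY * q ^+ 2 * nm fY)).
      apply: lerD; last by rewrite nmM ler_wpM2r ?nm_ge0.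
      apply: le_trans (nmB _ _) _; apply: lerD => //.
      by rewrite nmM ler_wpM2r ?nm_ge0.
    by rewrite le_eqVlt; apply/orP; left; apply/eqP; rewrite /B; ring.
  by rewrite nmM nq mulrC ler_pM2r.
move=> e e0; pose q := Num.min (D / 2) (e / (B + 1)).
have B1 : 0 < B + 1 by rewrite ltr_wpDl.
have q0 : 0 < q by rewrite lt_min !divr_gt0.
have qD : q < D by rewrite gt_min; apply/orP; left; lra.
apply: le_trans (main _ q0 qD) _.
have : q <= e / (B + 1) by rewrite ge_min lexx orbT.
rewrite ler_pdivlMr //; nra.
Qed.

(** A discrete Gronwall argument. Along [N + 1] equal steps from the origin to (x, y), the gradient
    bound improves a bound [T] on [|f|] to [T / 2], up to a second order error that vanishes as [N]
    grows. Iterating the halving gives 0. *)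
Lemma log_derivative_eq0 f fx fy (sg K L : R) : 0 < sg -> 0 <= K -> 0 < L ->
  taylor2 f fx fy sg K -> f (0, 0) = 0 ->
  (exists S : R, forall x y, nm x <= sg -> nm y <= sg -> nm (f (x, y)) <= S) ->
  (forall x y, nm x <= sg -> nm y <= sg ->
    nm (fx (x, y)) <= L * nm (f (x, y)) /\ nm (fy (x, y)) <= L * nm (f (x, y))) ->
  \forall p \near (0 : C * C), f p = 0.
Proof.
move=> sg0 K0 L0 tf f0 [S hS] hL.
(* Over the whole segment each partial derivative contributes at most [rho * L * T]; with
   [rho <= 1 / (4 L)] the two together give at most [T / 2]. *)
pose rho := Num.min sg (4 * L)^-1.
have L40 : 0 < 4 * L by rewrite mulr_gt0.
have rho0 : 0 < rho by rewrite lt_min sg0 invr_gt0.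
have rsg : rho <= sg by rewrite ge_min lexx.
have rL : rho * (4 * L) <= 1.
  by rewrite -ler_pdivlMr // div1r ge_min lexx orbT.
have half (T : R) : (forall x y, nm x <= rho -> nm y <= rho -> nm (f (x, y)) <= T) ->
    forall x y, nm x <= rho -> nm y <= rho -> nm (f (x, y)) <= T / 2.
  move=> hT x y xr yr.
  have T0 : 0 <= T by apply: le_trans (hT x y xr yr); exact: nm_ge0.
  have step (N i : nat) : (i <= N.+1)%N ->
      nm (f (rc (i%:R / N.+1%:R) * x, rc (i%:R / N.+1%:R) * y)) <=
      i%:R / N.+1%:R * (T / 2 + K * rho ^+ 2 / N.+1%:R).
    elim: i => [|i IH] iN.
      by rewrite !mul0r f0 nm0.
    have {IH} := IH (ltnW iN).
    have N0 : 0 < N.+1%:R :> R by [].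
    set s := i%:R / _; have s01 : 0 <= s <= 1.
      by rewrite divr_ge0 //= ler_pdivrMr // mul1r ler_nat ltnW.
    have -> : i.+1%:R / N.+1%:R = s + N.+1%:R^-1 by rewrite -natr1 mulrDl mul1r.
    set q := N.+1%:R^-1; have q0 : 0 < q by rewrite invr_gt0.
    have q1 : q <= 1 by rewrite invf_le1 // ler1n.
    have nsz z : nm z <= rho -> nm (rc s * z) <= rho.
      by move=> zr; rewrite nmM nm_rc; [nra|lra].
    have nqz z : nm z <= rho -> nm (rc q * z) <= rho * q.
      by move=> zr; rewrite nmM nm_rc; [nra|lra].
    have qsg : rho * q <= sg by nra.
    have nsx := nsz _ xr; have nsy := nsz _ yr.
    have := tf _ _ _ _ _ (le_trans nsx rsg) (le_trans nsy rsg) (nqz _ xr) (nqz _ yr) qsg.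
    have rcD z : rc s * z + rc q * z = rc (s + q) * z.
      by rewrite -mulrDl /rc rmorphD.
    rewrite !rcD => H1 H2.
    have [H3 H4] := hL _ _ (le_trans nsx rsg) (le_trans nsy rsg).
    have H5 := hT _ _ nsx nsy.
    move: H1 H2 H3 H4 H5; set P := f (rc s * x, _); set Q := f _; set A := fx _; set B := fy _.
    move=> H1 H2 H3 H4 H5.
    have H6 : nm (rc q * x * A + rc q * y * B) <= q * (T / 2).
      apply: le_trans (nmD _ _) _; rewrite !(nmM (_ * _)).
      have A1 : nm (rc q * x) * nm A <= rho * q * (L * T).
        by apply: ler_pM; rewrite ?nm_ge0 ?nqz // (le_trans H3) // ler_wpM2l // ltW.
      have A2 : nm (rc q * y) * nm B <= rho * q * (L * T).
        by apply: ler_pM; rewrite ?nm_ge0 ?nqz // (le_trans H4) // ler_wpM2l // ltW.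
      have := ler_wpM2l (mulr_ge0 (ltW q0) T0) rL; lra.
    set W := rc q * x * A + _ in H1 H6.
    have := nmD (Q - P - W) (P + W); have := nmD P W.
    have -> : Q - P - W + (P + W) = Q by ring.
    rewrite mulrDl; move: H1; rewrite exprMn (_ : q * (_ + _) = q * (T / 2) + K * (rho ^+ 2 * q ^+ 2)); last by ring.
    lra.
  have B0 : 0 <= K * rho ^+ 2 by rewrite mulr_ge0 // exprn_ge0 // ltW.
  apply/ler_addgt0Pr => e e0.
  have [N] : exists N, K * rho ^+ 2 / N.+1%:R <= e.
    have := truncnS_gt (K * rho ^+ 2 / e); move: (Num.truncn _) => N HN.
    by exists N; rewrite ler_pdivrMr ?ltr0n // [e * _]mulrC -ler_pdivrMr // ltW.
  move=> He; have := step N _ (leqnn _); rewrite divff ?pnatr_eq0 //.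
  have rc1 z : rc 1 * z = z by exact: mul1r.
  by rewrite (rc1 x) (rc1 y) => H; apply: le_trans H _; rewrite mul1r lerD2l.
apply/near0P2; exists rho => // x y xr yr.
apply/eqP; rewrite -nm_eq0; apply/eqP; apply: eps_eq0 (nm_ge0 _) _ => e e0.
have H N : forall x y, nm x <= rho -> nm y <= rho -> nm (f (x, y)) <= S * 2^-1 ^+ N.
  elim: N => [|N IH] {}x {}y {}xr {}yr; first by rewrite mulr1 hS ?(le_trans xr) ?(le_trans yr).
  by rewrite exprSr mulrA; exact: half.
have : (fun N => S * 2^-1 ^+ N) @ \oo --> (S * 0 : R).
  by apply: cvgMr; apply: cvg_expr; rewrite ger0_norm //; lra.
rewrite mulr0 => /cvgrPdist_lt /(_ _ e0) [N _ /(_ N (leqnn _))] /=.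
rewrite sub0r normrN => hN; apply: le_trans (H N _ _ (ltW xr) (ltW yr)) _.
by apply: le_trans (ler_norm _) (ltW hN).
Qed.

End Derivatives.

(** * Composition of power series *)

Section Composition.
Variable R : realType.
Local Notation C := (Cplx R).
Implicit Types (s t x y z w : C) (r M rho : R) (a : nat -> nat -> C) (b c : nat -> C)
  (h : C * C -> C) (u : C -> C) (p q : {poly C}).

Lemma cvgn_mul (v w : nat -> C) y z : v @ \oo --> y -> w @ \oo --> z ->
  (fun P => v P * w P) @ \oo --> y * z.
Proof. by move=> vy wz; exact: cvgM vy wz. Qed.

Lemma cvgn_expr (v : nat -> C) z k : v @ \oo --> z -> (fun P => v P ^+ k) @ \oo --> z ^+ k.
Proof.
move=> vz; elim: k => [|k IH].
  by under eq_fun do rewrite expr0; exact: cvg_cst.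
have H := cvgM vz IH.
rewrite exprS; under eq_fun do rewrite exprS.
exact: H.
Qed.

Lemma cvgn_sum (F : nat -> nat -> C) (G : nat -> C) K : (forall i, (F ^~ i) @ \oo --> G i) ->
  (fun P => \sum_(i < K) F P i) @ \oo --> \sum_(i < K) G i.
Proof.
move=> FG; elim: K => [|K IH].
  by under eq_fun do rewrite big_ord0; rewrite big_ord0; exact: cvg_cst.
have H := cvgD IH (FG K).
rewrite big_ord_recr /=; under eq_fun do rewrite big_ord_recr /=.
exact: H.
Qed.

(** The weighted l1 norm of the coefficients. It is submultiplicative and bounds values and tails on
    the disc of radius [rho]. *)
Definition pnorm rho p : R := \sum_(i < size p) nm p`_i * rho ^+ i.

Lemma pnormE rho p N : (size p <= N)%N -> pnorm rho p = \sum_(i < N) nm p`_i * rho ^+ i.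
Proof.
move=> pN; rewrite /pnorm (big_ord_widen N (fun i => nm p`_i * rho ^+ i)) //.
rewrite big_mkcond; apply: eq_bigr => i _; case: ltnP => // ip.
by rewrite nth_default // nm0 mul0r.
Qed.

Lemma pnorm_ge0 rho p : 0 <= rho -> 0 <= pnorm rho p.
Proof. by move=> r0; apply: sumr_ge0 => i _; rewrite mulr_ge0 ?nm_ge0 ?exprn_ge0. Qed.

Lemma pnormD rho p q : 0 <= rho -> pnorm rho (p + q) <= pnorm rho p + pnorm rho q.
Proof.
move=> r0; pose N := maxn (size p) (size q).
rewrite (pnormE _ (size_polyD p q)) (@pnormE _ p N) ?leq_maxl // (@pnormE _ q N) ?leq_maxr //.
rewrite -big_split; apply: ler_sum => i _ /=.
by rewrite coefD -mulrDl ler_wpM2r ?exprn_ge0 ?nmD.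
Qed.

Lemma pnormC rho z : pnorm rho z%:P = nm z.
Proof. by rewrite (@pnormE _ _ 1) ?size_polyC_leq1 // big_ord1 coefC mulr1. Qed.

Lemma pnormZ rho z p : pnorm rho (z *: p) = nm z * pnorm rho p.
Proof.
rewrite (pnormE _ (size_scale_leq z p)) /pnorm mulr_sumr.
by apply: eq_bigr => i _; rewrite coefZ nmM mulrA.
Qed.

Lemma pnorm_mulX rho p z : pnorm rho (p * 'X + z%:P) = rho * pnorm rho p + nm z.
Proof.
rewrite (@pnormE _ _ (size p).+1); last first.
  by rewrite size_MXaddC; case: ifP.
rewrite big_ord_recl addrC coefD coefMX coefC /= add0r mulr1; congr (_ + _).
rewrite /pnorm mulr_sumr; apply: eq_bigr => i _.
by rewrite /bump add1n coefD coefMX coefC /= addr0 exprS; ring.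
Qed.

Lemma pnormM rho p q : 0 <= rho -> pnorm rho (p * q) <= pnorm rho p * pnorm rho q.
Proof.
move=> r0; elim/poly_ind: p => [|p z IH].
  by rewrite mul0r /pnorm size_poly0 big_ord0 mul0r.
rewrite pnorm_mulX mulrDl mulrAC mul_polyC.
apply: le_trans (pnormD _ _ r0) _; rewrite pnormZ mulrDl lerD2r.
by have := pnorm_mulX rho (p * q) 0; rewrite polyC0 nm0 !addr0 => ->; rewrite -mulrA ler_wpM2l.
Qed.

Lemma pnormX rho p k : 0 <= rho -> pnorm rho (p ^+ k) <= pnorm rho p ^+ k.
Proof.
move=> r0; elim: k => [|k IH]; first by rewrite !expr0 -polyC1 pnormC nm1.
rewrite !exprS; apply: le_trans (pnormM _ _ r0) _.
by rewrite ler_wpM2l ?pnorm_ge0.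
Qed.

Lemma pnorm_sum rho I (s : seq I) (F : I -> {poly C}) : 0 <= rho ->
  pnorm rho (\sum_(i <- s) F i) <= \sum_(i <- s) pnorm rho (F i).
Proof.
move=> r0; elim: s => [|i s IH]; first by rewrite !big_nil -polyC0 pnormC nm0.
by rewrite !big_cons; apply: le_trans (pnormD _ _ r0) _; rewrite lerD2l.
Qed.

Lemma horner_tail rho p t L : 0 < rho -> nm t <= rho ->
  nm (p.[t] - \sum_(k < L) p`_k * t ^+ k) <= pnorm rho p * (nm t / rho) ^+ L.
Proof.
move=> r0 tr; pose N := (L + size p)%N.
have q0 : 0 <= nm t / rho by rewrite divr_ge0 ?nm_ge0 // ltW.
have q1 : nm t / rho <= 1 by rewrite ler_pdivrMr // mul1r.
rewrite (horner_coef_wide t (leq_addl L (size p))) -/N.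
rewrite (@pnormE _ p N) ?leq_addl // /N !big_split_ord /= [X in nm (X - _)]addrC addrK.
apply: (@le_trans _ _ (\sum_(i < size p) nm p`_(L + i) * rho ^+ (L + i) * (nm t / rho) ^+ L)).
  apply: nm_sum_le => i _; rewrite nmM nmX -mulrA ler_wpM2l ?nm_ge0 //.
  have -> : nm t ^+ (L + i) = rho ^+ (L + i) * ((nm t / rho) ^+ L * (nm t / rho) ^+ i).
    by rewrite -exprD -exprMn mulrC divfK // lt0r_neq0.
  rewrite ler_wpM2l ?exprn_ge0 ?(ltW r0) // -[leRHS]mulr1.
  by rewrite ler_wpM2l ?exprn_ge0 // exprn_ile1.
rewrite -mulr_suml ler_wpM2r ?exprn_ge0 // lerDr; apply: sumr_ge0 => i _.
by rewrite mulr_ge0 ?nm_ge0 // exprn_ge0 // ltW.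
Qed.

Lemma dvdXn_coef p L k : 'X^L %| p -> (k < L)%N -> p`_k = 0.
Proof. by move=> /dvdpP [q ->] kL; rewrite coefMXn kL. Qed.

Lemma coef_dvdXn p L : (forall k, (k < L)%N -> p`_k = 0) -> 'X^L %| p.
Proof.
move=> p0; rewrite -(poly_take_drop L p).
suff -> : take_poly L p = 0 by rewrite add0r dvdp_mulIr.
by apply/polyP => k; rewrite coef_take_poly coef0; case: ltnP => // /p0.
Qed.

Definition trunc_poly b N : {poly C} := \poly_(i < N) b i.

Lemma horner_trunc_poly b N t : (trunc_poly b N).[t] = psum1 b N t.
Proof. by rewrite horner_poly. Qed.

Lemma trunc_poly_dvd b N L : (L <= N)%N -> 'X^L %| trunc_poly b N - trunc_poly b L.
Proof.
move=> LN; apply: coef_dvdXn => k kL.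
by rewrite coefB !coef_poly kL (leq_trans kL) // subrr.
Qed.

Lemma trunc_poly_dvdX b N : b 0%N = 0 -> 'X %| trunc_poly b N.
Proof.
by move=> b0; rewrite -['X]expr1; apply: coef_dvdXn => -[|//] _; rewrite coef_poly b0 if_same.
Qed.

(** The bound is uniform in the truncation order [N], so that all truncations stay inside the
    polydisc of the outer series. *)
Lemma pnorm_small b r (e : R) : coef_bound1 b r -> b 0%N = 0 -> 0 < e ->
  exists2 rho0, 0 < rho0 & forall rho N, 0 < rho -> rho <= rho0 ->
    pnorm rho (trunc_poly b N) <= e.
Proof.
move=> [r0 [M bM]] b0 e0.
have M0 : 0 <= M by apply: le_trans (bM 0%N); rewrite b0 nm0 mul0r.
have M1 : 0 < M + 1 by rewrite ltr_wpDl.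
pose th := Num.min 2^-1 (e / (2 * (M + 1))).
have th0 : 0 < th by rewrite lt_min invr_gt0 ltr0n divr_gt0 // mulr_gt0.
have th1 : th <= 2^-1 by rewrite ge_min lexx.
have th2 : th * (2 * (M + 1)) <= e.
  by rewrite -ler_pdivlMr ?mulr_gt0 // ge_min lexx orbT.
exists (r * th) => [|rho N rho0 rhor]; first by rewrite mulr_gt0.
rewrite (pnormE _ (size_poly _ _)).
case: N => [|N]; first by rewrite big_ord0 ltW.
rewrite big_ord_recl coef_poly /= b0 nm0 mul0r add0r.
apply: (@le_trans _ _ (\sum_(i < N) M * th * 2^-1 ^+ i)); last first.
  rewrite -mulr_sumr; apply: le_trans (ler_wpM2l _ (geo_half R N)) _.
    by rewrite mulr_ge0 // ltW.
  by apply: le_trans th2; nra.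
apply: ler_sum => i _; rewrite /bump add1n coef_poly ltnS ltn_ord.
have e1 : rho ^+ i.+1 <= (r * th) ^+ i.+1.
  by apply: lerXn2r; rewrite ?nnegrE // ltW // mulr_gt0.
apply: le_trans (ler_wpM2l (nm_ge0 _) e1) _.
rewrite exprMn mulrA; apply: (@le_trans _ _ (M * th ^+ i.+1)).
  by rewrite ler_wpM2r ?exprn_ge0 // ltW.
rewrite exprS -!mulrA ler_wpM2l // ler_wpM2l ?(ltW th0) //.
by apply: lerXn2r; rewrite ?nnegrE // ltW.
Qed.

Definition comp_poly2 a p q N : {poly C} :=
  \sum_(i < N) \sum_(j < N) a i j *: (p ^+ i * q ^+ j).

(** As [p] and [q] have no constant term, their products of total degree [L] or more are divisible
    by ['X^L]. So the coefficients of a composite below [L] depend only on truncations at [L]. *)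
Lemma comp_poly2_dvd a p q p' q' N L : (L <= N)%N -> 'X %| p -> 'X %| q ->
  'X^L %| p - p' -> 'X^L %| q - q' -> 'X^L %| comp_poly2 a p q N - comp_poly2 a p' q' L.
Proof.
move=> LN Xp Xq pp' qq'.
have -> : comp_poly2 a p q N - comp_poly2 a p' q' L =
    (comp_poly2 a p q N - comp_poly2 a p q L) + (comp_poly2 a p q L - comp_poly2 a p' q' L).
  by rewrite addrA subrK.
have dZ z (s : {poly C}) : 'X^L %| s -> 'X^L %| z *: s by rewrite -mul_polyC; exact: dvdp_mull.
have dS I (s : seq I) (F : I -> {poly C}) :
    (forall i, 'X^L %| F i) -> 'X^L %| \sum_(i <- s) F i.
  by move=> dF; elim/big_ind: _ => //; exact: dvdp_add.
have small i j : (L <= i + j)%N -> 'X^L %| a i j *: (p ^+ i * q ^+ j).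
  move=> Lij; apply/dZ/(dvdp_trans (dvdp_exp2l 'X Lij)).
  by rewrite exprD dvdp_mul // dvdp_exp2r.
apply: dvdp_add.
  rewrite -(subnKC LN); elim: (N - L)%N => [|k IH]; first by rewrite addn0 subrr.
  rewrite addnS; set n := (L + k)%N in IH *.
  have Ln : (L <= n)%N by exact: leq_addr.
  rewrite {1}/comp_poly2 big_ord_recr /=.
  under eq_bigr do rewrite big_ord_recr /=.
  rewrite big_split /= -/(comp_poly2 a p q n).
  have assoc (A B D E : {poly C}) : A + B + D - E = (A - E) + (B + D) by ring.
  rewrite assoc {assoc}.
  apply: dvdp_add => //; apply: dvdp_add; apply: (@dS) => i; apply: small => /=.
    exact: leq_trans Ln (leq_addl _ _).
  exact: leq_trans Ln (leq_addr _ _).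
rewrite /comp_poly2 -sumrB; apply: (@dS) => i; rewrite -sumrB; apply: (@dS) => j.
rewrite -scalerBr; apply: (@dZ).
have -> : p ^+ i * q ^+ j - p' ^+ i * q' ^+ j =
    (p ^+ i - p' ^+ i) * q ^+ j + p' ^+ i * (q ^+ j - q' ^+ j) by ring.
by apply: dvdp_add; [apply: dvdp_mulr|apply: dvdp_mull]; rewrite subrXX dvdp_mulr.
Qed.

Lemma horner_comp_poly2 a p q N t :
  (comp_poly2 a p q N).[t] = dsum (mono2 a p.[t] q.[t]) N N.
Proof.
rewrite /comp_poly2 horner_sum; apply: eq_bigr => i _; rewrite horner_sum.
by apply: eq_bigr => j _; rewrite hornerZ hornerM !horner_exp /mono2 mulrA.
Qed.

Lemma pnorm_comp_poly2 a r M rho p q N : 0 < r -> bounded2 a r M -> 0 <= rho ->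
  pnorm rho p <= r / 2 -> pnorm rho q <= r / 2 -> pnorm rho (comp_poly2 a p q N) <= 4 * M.
Proof.
move=> r0 aM rho0 pr qr.
have r2 : 0 <= r / 2 by rewrite divr_ge0 // ltW.
have M0 : 0 <= M by apply: le_trans (aM 0 0)%N; rewrite mulr1 nm_ge0.
apply: le_trans (pnorm_sum _ _ rho0) _.
apply: (@le_trans _ _ (\sum_(i < N) 2 * M * 2^-1 ^+ i)); last first.
  rewrite -mulr_sumr (_ : 4 * M = 2 * M * 2); last by ring.
  by apply: ler_wpM2l (geo_half _ _); rewrite mulr_ge0.
apply: ler_sum => i _; apply: le_trans (pnorm_sum _ _ rho0) _.
apply: (@le_trans _ _ (\sum_(j < N) M * 2^-1 ^+ i * 2^-1 ^+ j)); last first.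
  rewrite -mulr_sumr (_ : 2 * M * _ = M * 2^-1 ^+ i * 2); last by ring.
  by apply: ler_wpM2l (geo_half _ _); rewrite mulr_ge0 ?exprn_ge0.
apply: ler_sum => j _; rewrite pnormZ.
apply: (@le_trans _ _ (nm (a i j) * (r / 2) ^+ (i + j))).
  apply: ler_wpM2l; first exact: nm_ge0.
  apply: le_trans (pnormM _ _ rho0) _; rewrite exprD; apply: ler_pM; rewrite ?pnorm_ge0 //.
    by apply: le_trans (pnormX _ _ rho0) _; rewrite lerXn2r ?nnegrE ?pnorm_ge0.
  by apply: le_trans (pnormX _ _ rho0) _; rewrite lerXn2r ?nnegrE ?pnorm_ge0.
rewrite exprMn mulrA -[M * _ * _]mulrA -exprD.
by apply: ler_wpM2r (aM i j); rewrite exprn_ge0.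
Qed.

(** No triple series is rearranged: the tail estimate holds for polynomials with a uniform bound on
    [pnorm], and passes to the limit, first in the truncation [P] of the inner series, then in the
    truncation [N] of the outer one. *)
Lemma comp_expansion a r h bx rx X by_ ry Y :
  is_psum2 a r h -> is_psum1 bx rx X -> is_psum1 by_ ry Y ->
  bx 0%N = 0 -> by_ 0%N = 0 -> exists (c : nat -> C) (rho K : R),
  0 < rho /\ forall L t, nm t <= rho ->
    nm (h (X t, Y t) - psum1 c L t) <= K * (nm t / rho) ^+ L.
Proof.
case=> r0 [M aM] ah [cbx cX] [cby cY] bx0 by0.
have r20 : 0 < r / 2 by rewrite divr_gt0.
have [rho1 rho10 H1] := pnorm_small cbx bx0 r20.
have [rho2 rho20 H2] := pnorm_small cby by0 r20.
have [rx0 ry0] : 0 < rx /\ 0 < ry by case: cbx cby => ? _ [].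
pose XL L := trunc_poly bx L; pose YL L := trunc_poly by_ L.
pose c k := (comp_poly2 a (XL k.+1) (YL k.+1) k.+1)`_k.
have cE k N P : (k < N)%N -> (N <= P)%N -> (comp_poly2 a (XL P) (YL P) N)`_k = c k.
  move=> kN NP; apply/eqP; rewrite -subr_eq0 -coefB; apply/eqP.
  apply: (@dvdXn_coef _ k.+1) => //; apply: comp_poly2_dvd => //.
  - exact: trunc_poly_dvdX.
  - exact: trunc_poly_dvdX.
  - by apply: trunc_poly_dvd; exact: leq_trans NP.
  - by apply: trunc_poly_dvd; exact: leq_trans NP.
pose rho := Num.min (Num.min rho1 rho2) (Num.min (rx / 2) (ry / 2)).
have rho0 : 0 < rho by rewrite !lt_min rho10 rho20 !divr_gt0.
have : rho <= rho by []; rewrite {2}/rho !le_min => /andP[/andP[l1 l2] /andP[l3 l4]].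
have Xsmall t : nm t <= rho -> nm (X t) <= r / 2.
  move=> tr; apply: (cvg_nm_le (N0 := 0) (cX t _)); first lra.
  move=> N _; rewrite -horner_trunc_poly; apply: le_trans (H1 rho N rho0 l1).
  have := @horner_tail rho (trunc_poly bx N) t 0 rho0 tr.
  by rewrite big_ord0 subr0 expr0 mulr1.
have Ysmall t : nm t <= rho -> nm (Y t) <= r / 2.
  move=> tr; apply: (cvg_nm_le (N0 := 0) (cY t _)); first lra.
  move=> N _; rewrite -horner_trunc_poly; apply: le_trans (H2 rho N rho0 l2).
  have := @horner_tail rho (trunc_poly by_ N) t 0 rho0 tr.
  by rewrite big_ord0 subr0 expr0 mulr1.
exists c, rho, (4 * M); split=> // L t tr.
have cvh := ah (X t) (Y t).
have {}cvh : (fun N => dsum (mono2 a (X t) (Y t)) N N - psum1 c L t) @ \oo -->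
    h (X t, Y t) - psum1 c L t.
  apply: cvgB; last exact: cvg_cst.
  by apply: cvh; [have := Xsmall _ tr|have := Ysmall _ tr]; lra.
apply: (cvg_nm_le (N0 := L) cvh) => N LN.
have cvN : (fun P => (comp_poly2 a (XL P) (YL P) N).[t] - psum1 c L t) @ \oo -->
    dsum (mono2 a (X t) (Y t)) N N - psum1 c L t.
  apply: cvgB; last exact: cvg_cst.
  under eq_fun do rewrite horner_comp_poly2 /dsum.
  have cvX : (fun P => (XL P).[t]) @ \oo --> X t.
    by under eq_fun do rewrite horner_trunc_poly; apply: cX; lra.
  have cvY : (fun P => (YL P).[t]) @ \oo --> Y t.
    by under eq_fun do rewrite horner_trunc_poly; apply: cY; lra.
  apply: (cvgn_sum (F := fun P i => \sum_(j < N) mono2 a (XL P).[t] (YL P).[t] i j)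
    (G := fun i => \sum_(j < N) mono2 a (X t) (Y t) i j)) => i.
  apply: (cvgn_sum (F := fun P j => mono2 a (XL P).[t] (YL P).[t] i j)
    (G := fun j => mono2 a (X t) (Y t) i j)) => j.
  have cX1 := cvgn_expr (k := i) cvX; have cY1 := cvgn_expr (k := j) cvY.
  have cc : (fun _ : nat => a i j) @ \oo --> a i j by exact: cvg_cst.
  exact: cvgn_mul (cvgn_mul cc cX1) cY1.
apply: (cvg_nm_le (N0 := N) cvN) => P NP.
have -> : psum1 c L t = \sum_(k < L) (comp_poly2 a (XL P) (YL P) N)`_k * t ^+ k.
  by apply: eq_bigr => k _; rewrite cE // (leq_trans (ltn_ord k)).
apply: le_trans (horner_tail _ _ rho0 tr) _; apply: ler_wpM2r.
  by rewrite exprn_ge0 // divr_ge0 ?nm_ge0 // ltW.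
by apply: (pnorm_comp_poly2 _ r0 aM (ltW rho0)); [exact: H1|exact: H2].
Qed.

(** If every coefficient of the composite is 0, the error of order [L] tends to 0 on the disc of
    radius [rho / 2]; otherwise the first nonzero term dominates the remainder. *)
Lemma comp_isolated_zeros a r h bx rx X by_ ry Y :
  is_psum2 a r h -> is_psum1 bx rx X -> is_psum1 by_ ry Y ->
  bx 0%N = 0 -> by_ 0%N = 0 ->
  (exists2 d : R, 0 < d & forall t, nm t < d -> h (X t, Y t) = 0) \/
  (exists2 d : R, 0 < d & forall t, t != 0 -> nm t < d -> h (X t, Y t) != 0).
Proof.
move=> ah cX cY bx0 by0.
have [c [rho [K [rho0 hK]]]] := comp_expansion ah cX cY bx0 by0.
have [c0|/existsNP [k0 ck0]] := pselect (forall k, c k = 0).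
  left; exists (rho / 2) => [|t tr]; first by rewrite divr_gt0.
  apply: (cvg_uniq (u := fun=> h (X t, Y t))); first exact: cvg_cst.
  apply: (cvg_geo0 (K := `|K|)) => L.
  have tr1 : nm t <= rho by lra.
  have := hK L t tr1; rewrite /psum1 big1 => [|k _]; last by rewrite c0 mul0r.
  rewrite subr0 => H; apply: le_trans H _.
  have q0 : 0 <= nm t / rho by rewrite divr_ge0 ?nm_ge0 // ltW.
  have q1 : nm t / rho <= 2^-1 by rewrite ler_pdivrMr //; lra.
  apply: (@le_trans _ _ (`|K| * (nm t / rho) ^+ L)).
    by rewrite ler_wpM2r ?exprn_ge0 ?ler_norm.
  by rewrite ler_wpM2l // lerXn2r ?nnegrE ?invr_ge0.
right.
have [k /eqP ck kmin] : exists2 k, c k != 0 & forall j, (j < k)%N -> c j = 0.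
  have ex : exists k, c k != 0 by exists k0; apply/eqP.
  exists (ex_minn ex); case: ex_minnP => // m _ mmin j jm.
  by apply/eqP; apply: contraTT jm => /mmin; rewrite -leqNgt.
have nck : 0 < nm (c k) by rewrite nm_gt0; apply/eqP.
have K1 : 0 < `|K| + 1 by rewrite ltr_wpDl.
pose d := Num.min rho (nm (c k) * rho ^+ k.+1 / (`|K| + 1)).
exists d => [|t t0]; first by rewrite lt_min rho0 divr_gt0 // mulr_gt0 // exprn_gt0.
rewrite lt_min => /andP[tr]; rewrite ltr_pdivlMr // => tk.
apply/eqP => h0; have := hK k.+1 t (ltW tr); rewrite h0 sub0r nmN.
rewrite /psum1 big_ord_recr /= big1 ?add0r => [|j _]; last by rewrite kmin ?mul0r.
apply/negP; rewrite -ltNge nmM nmX exprMn exprVn.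
have tk0 : 0 < nm t ^+ k by rewrite exprn_gt0 // nm_gt0.
rewrite mulrA ltr_pdivrMr ?exprn_gt0 //.
have -> : K * nm t ^+ k.+1 = nm t ^+ k * (nm t * K) by rewrite exprS; ring.
have -> : nm (c k) * nm t ^+ k * rho ^+ k.+1 = nm t ^+ k * (nm (c k) * rho ^+ k.+1) by ring.
rewrite ltr_pM2l //; apply: le_lt_trans tk; apply: ler_wpM2l; first exact: nm_ge0.
by apply: le_trans (ler_norm _) _; rewrite lerDl.
Qed.

End Composition.

(** * The branch of the curve: partial derivatives along eta and the slope psi *)

Section CurveData.
Variable R : realType.
Local Notation C := (Cplx R).
Implicit Types (s t x y z w : C) (r M rho : R) (a : nat -> nat -> C) (b c : nat -> C)
  (f h : C * C -> C) (u v : C -> C) (eta : C -> C * C).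

Lemma psum1_uniq b c r r' u v : is_psum1 b r u -> is_psum1 c r' v -> b =1 c ->
  forall t, nm t < r -> nm t < r' -> u t = v t.
Proof.
move=> [_ bu] [_ cv] bc t tr tr'; apply: cvg_uniq (bu t tr) _.
by apply: (cvg_ext (N0 := 0) (cv t tr')) => N _; apply: eq_bigr => i _; rewrite bc.
Qed.

Lemma psum1_scale b r u z : is_psum1 b r u ->
  is_psum1 (fun i => z * b i) r (fun t => z * u t).
Proof.
move=> [[r0 [M bM]] bu]; split.
  by split=> //; exists (nm z * M) => i; rewrite nmM -mulrA ler_wpM2l ?nm_ge0.
move=> t tr.
have cz : (fun _ : nat => z) @ \oo --> z by exact: cvg_cst.
apply: (cvg_ext (N0 := 0) (cvgn_mul cz (bu t tr))) => N _.
by rewrite /psum1 mulr_sumr; apply: eq_bigr => i _; rewrite mulrA.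
Qed.

Lemma psum1_Xn n : is_psum1 (fun k => (k == n)%:R : C) 1 (fun t => t ^+ n).
Proof.
split; first by split=> //; exists 1 => i; rewrite expr1n mulr1 nm_nat lern1 leq_b1.
move=> t _; apply: (@cvg_ext _ (fun=> t ^+ n) _ _ n.+1); first exact: cvg_cst.
move=> N nN; rewrite /psum1 (bigD1 (Ordinal nN)) //= eqxx mul1r big1 ?addr0 // => i.
by rewrite -val_eqE /= => /negbTE ->; rewrite mul0r.
Qed.

Lemma psum1_divXn b r u p : is_psum1 b r u -> (forall i, (i < p)%N -> b i = 0) ->
  exists v, is_psum1 (fun j => b (p + j)%N) r v /\
    forall t, nm t < r -> u t = t ^+ p * v t.
Proof.
move=> bu b0; have [[r0 [M bM]] cu] := bu.
(* At 0 the quotient is replaced by its limit, the coefficient [b p]. *)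
exists (fun t => if t == 0 then b p else t ^- p * u t).
have shift N t : psum1 b (p + N) t = t ^+ p * psum1 (fun j => b (p + j)%N) N t.
  rewrite /psum1 big_split_ord /= big1 => [|i _]; last by rewrite b0 ?mul0r.
  rewrite add0r mulr_sumr; apply: eq_bigr => i _; rewrite exprD; ring.
split; last first.
  move=> t tr; case: eqP => [->|/eqP t0]; last by rewrite mulVKf // expf_neq0.
  rewrite (is_psum1_0 bu); case: p b0 {shift} => [|p] b0; first by rewrite mul1r.
  by rewrite b0 // expr0n mul0r.
split.
  split=> //; exists (M / r ^+ p) => i.
  rewrite ler_pdivlMr ?exprn_gt0 //; apply: le_trans (bM (p + i)%N).
  by rewrite exprD -mulrA [r ^+ i * _]mulrC.
move=> t tr; case: eqP => [->|/eqP t0].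
  apply: (@cvg_ext _ (fun=> b p) _ _ 1); first exact: cvg_cst.
  move=> [//|N] _; rewrite /psum1 big_ord_recl addn0 mulr1 big1 ?addr0 // => i _.
  by rewrite lift0 exprS mul0r mulr0.
have cz : (fun _ : nat => t ^- p) @ \oo --> t ^- p by exact: cvg_cst.
have cs : (fun N => psum1 b (p + N) t) @ \oo --> u t.
  apply/cvgnP => e e0; have /cvgnP /(_ e e0) [N hN] := cu t tr.
  by exists N => k Nk; apply: hN; exact: leq_trans Nk (leq_addl _ _).
apply: (cvg_ext (N0 := 0) (cvgn_mul cz cs)) => N _.
by rewrite shift mulKf // expf_neq0.
Qed.

Lemma analytic2_bounded h : analytic2 h -> exists2 r : R, 0 < r &
  exists2 K, 0 < K & forall x y, nm x <= r -> nm y <= r -> nm (h (x, y)) <= K.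
Proof.
case=> a /power_series2P [r hr]; have [K hK] := psum2_bounded hr.
exists (r / 2); first by case: hr => r0 _ _; rewrite divr_gt0.
exists (`|K| + 1) => [|x y xr yr]; first by rewrite ltr_wpDl.
by apply: le_trans (hK x y xr yr) _; rewrite (le_trans (ler_norm K)) // lerDl.
Qed.

Lemma psum2_analytic a r h : is_psum2 a r h -> analytic2 h.
Proof. by move=> hr; exists a; apply/power_series2P; exists r. Qed.

Lemma analytic2_1 : analytic2 (fun _ : C * C => 1 : C).
Proof.
exists (fun i j => if (i == 0)%N && (j == 0)%N then 1 else 0).
exists 1, 1; split=> // [i j|x y _ _].
  by rewrite expr1n mulr1; case: ifP; rewrite ?normr1 ?normr0.
apply: (@cvg_ext _ (fun=> 1 : C) _ _ 1); first exact: cvg_cst.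
move=> [//|N] _; rewrite big_ord_recl big_ord_recl /= !mulr1 !big1 ?addr0 // => i _.
  by rewrite big1 // => j _; rewrite !mul0r.
by rewrite !mul0r.
Qed.

Lemma analytic1_id : analytic1 (fun t : C => t).
Proof. exists (fun k => (k == 1)%:R); exact: psum1_power_series (psum1_Xn 1). Qed.

Section Multiplicity.
Variables (f : C * C -> C) (mult : nat).
Hypotheses (irr : irreducible2 f) (mul : multiplicity f mult) (mult1 : (1 < mult)%N).

Lemma partials : exists fx fy, [/\ analytic2 fx, analytic2 fy, fx (0, 0) = 0, fy (0, 0) = 0 &
  exists sg K, [/\ 0 < sg, 0 <= K & taylor2 f fx fy sg K]].
Proof.
have [a [/power_series2P [r fr] a0 _]] := mul.
have [fx [fy [hx hy [K K0 tf]]]] := psum2_taylor fr.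
exists fx, fy; split.
- exact: psum2_analytic hx.
- exact: psum2_analytic hy.
- by rewrite (is_psum2_0 hx) /dcoefx a0 ?mulr0.
- by rewrite (is_psum2_0 hy) /dcoefy a0 ?mulr0.
by exists (r / 8), K; split=> //; case: fr => r0 _ _; rewrite divr_gt0.
Qed.

Lemma f_eq0_at0 : f (0, 0) = 0.
Proof.
have [a [/power_series2P [r fr] a0 _]] := mul.
by rewrite (is_psum2_0 fr) a0 // ltnW.
Qed.

(** Otherwise both partials are bounded by [(L1 + L2) * |f|] near the origin, which forces [f] to
    vanish there identically. *)
Lemma partials_not_in_ideal fx fy (sg K : R) k1 k2 : 0 < sg -> 0 <= K ->
  taylor2 f fx fy sg K -> analytic2 k1 -> analytic2 k2 ->
  (\forall p \near (0 : C * C), fx p = k1 p * f p) ->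
  (\forall p \near (0 : C * C), fy p = k2 p * f p) -> False.
Proof.
move=> sg0 K0 tf /analytic2_bounded [r1 r10 [L1 L10 b1]].
move=> /analytic2_bounded [r2 r20 [L2 L20 b2]] /near0P2 [d1 d10 h1] /near0P2 [d2 d20 h2].
have [_ fn0 _ _] := irr; apply: fn0.
have [_ [a /power_series2P [r fr]]] : True /\ analytic2 f by case: irr.
have r0 : 0 < r by case: fr.
have [S hS] := psum2_bounded fr.
pose s := Num.min (Num.min sg (r / 2)) (Num.min (Num.min r1 r2) (Num.min (d1 / 2) (d2 / 2))).
have s0 : 0 < s by rewrite !lt_min sg0 r10 r20 !divr_gt0.
have : s <= s by []; rewrite {2}/s !le_min.
move=> /andP[/andP[s1 s2] /andP[/andP[s3 s4] /andP[s5 s6]]].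
apply: (@log_derivative_eq0 _ f fx fy s K (L1 + L2)) => //.
- by rewrite addr_gt0.
- by move=> x y h l d xs ys hd ld ds; apply: tf => //; lra.
- exact: f_eq0_at0.
- by exists S => x y xs ys; apply: hS; lra.
move=> x y xs ys; rewrite h1 ?h2; [|lra..].
rewrite !nmM; split; apply: ler_wpM2r; rewrite ?nm_ge0 //.
  by apply: le_trans (b1 x y _ _) _; lra.
by apply: le_trans (b2 x y _ _) _; lra.
Qed.

Variables (eta : C -> C * C) (n B1 : nat) (B2 : option nat).
Hypothesis std : standard_normalization f eta n B1 B2.

(** If [z ^+ k = 1] for every exponent [k] of the second coordinate, then [eta (z * t) = eta t]. The
    parameter [t] is a quotient [g / h] on the curve, so comparing at [t] and [z * t] gives
    [(z - 1) * t * h (eta t) = 0], and the denominator would vanish along eta. *)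
Lemma root_of_unity_separates b z : power_series1 b (fun t => (eta t).2) ->
  z ^+ n = 1 -> z != 1 -> exists k, b k != 0 /\ z ^+ k != 1.
Proof.
move=> /power_series1_psum [r hb] zn z1.
have [//|nex] := pselect (exists k, b k != 0 /\ z ^+ k != 1).
have [[[eta0 _ _] _ frac _] [n0 _ _ etaX _]] := std.
have nz : nm z = 1.
  have : nm z ^+ n = 1 by rewrite -nmX zn nm1.
  by move/eqP; rewrite pexpr_eq1 ?nm_ge0 // => /eqP.
have zk k : b k * z ^+ k = b k.
  have [->|bk] := eqVneq (b k) 0; first by rewrite mul0r.
  have [->|zk] := eqVneq (z ^+ k) 1; first by rewrite mulr1.
  by case: nex; exists k.
move/near0P: etaX => [d d0 hd].
have r0 : 0 < r by case: hb => [[]].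
have etaz t : nm t < Num.min r d -> eta (z * t) = eta t.
  rewrite lt_min => /andP[tr td]; rewrite [LHS]surjective_pairing [RHS]surjective_pairing.
  have zt : nm (z * t) = nm t by rewrite nmM nz mul1r.
  rewrite !hd ?zt // exprMn zn mul1r; congr pair.
  have [_ cu] := hb; have ztr : nm (z * t) < r by rewrite zt.
  apply: cvg_uniq (cu _ ztr) _; apply: (cvg_ext (N0 := 0) (cu _ tr)) => N _.
  by apply: eq_bigr => i _; rewrite exprMn mulrA zk.
have [g [h [ag ah hn0 /near0P [d' d'0 hd']]]] := frac _ analytic1_id.
exfalso; apply: hn0.
have h0 t : t != 0 -> nm t < Num.min (Num.min r d) d' -> h (eta t) = 0.
  rewrite lt_min => t0 /andP[td td'].
  have e1 := hd' t td'; have := hd' (z * t); rewrite nmM nz mul1r etaz // => /(_ td') e2.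
  have : (z - 1) * t * h (eta t) = 0 by rewrite mulrBl mul1r mulrBl e1 e2 subrr.
  by move/eqP; rewrite !mulf_eq0 subr_eq0 (negbTE z1) (negbTE t0) => /eqP.
have [he0|h00] := eqVneq (h (eta 0)) 0.
  apply/near0P; exists (Num.min (Num.min r d) d') => [|t td].
    by rewrite !lt_min r0 d0.
  by have [->|t0] := eqVneq t 0; [|exact: h0].
(* By isolation of zeros, [h o eta] cannot vanish near [0] except at [0]. *)
exfalso; case: ah => a /power_series2P [rh hh].
have b0 : b 0%N = 0.
  have : (eta 0).2 = 0 by rewrite eta0.
  by have := is_psum1_0 hb => /= ->.
have n00 : ((0 == n)%:R : C) = 0 by case: (n) n0.
have [] := comp_isolated_zeros hh (psum1_Xn n) hb n00 b0.
  move=> [d1 d10 /(_ 0)]; rewrite nm0 => /(_ d10) H; move: h00; rewrite [eta 0]surjective_pairing.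
  by rewrite hd ?nm0 // H eqxx.
move=> [d1 d10 H].
pose t := rc (Num.min (Num.min (Num.min r d) d') d1 / 2).
have m0 : 0 < Num.min (Num.min (Num.min r d) d') d1 by rewrite !lt_min r0 d0 d'0.
have nt : nm t = Num.min (Num.min (Num.min r d) d') d1 / 2.
  by rewrite nm_rc // divr_ge0 // ltW.
have t0 : t != 0 by rewrite -nm_gt0 nt divr_gt0.
have : nm t < Num.min (Num.min (Num.min r d) d') d1 by rewrite nt; lra.
rewrite lt_min => /andP[t1 t2].
have := H t t0 t2; have := h0 t t0 t1; rewrite [eta t]surjective_pairing hd.
  by move=> ->; rewrite eqxx.
by move: t1; rewrite !lt_min => /andP[/andP[]].
Qed.

Lemma curve_data : exists b c psi rb rp (d : R),
  [/\ is_psum1 b rb (fun t => (eta t).2), forall k, (k < B1)%N -> b k = 0, b B1 = 1,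
      power_series1 b (fun t => (eta t).2) &
  [/\ is_psum1 c rp psi, forall j, c j = n%:R^-1 * (n + j)%:R * b (n + j)%N, 0 < d,
      forall t, nm t < d -> (eta t).1 = t ^+ n /\
        f_x f (eta t) = - psi t * f_y f (eta t) &
      f_y f (eta 0) = 0 /\ forall t, t != 0 -> nm t < d -> f_y f (eta t) != 0]].
Proof.
have [[[eta0 _ _] ker _ _] [n0 nB1 _ /near0P [d0 d00 hX] [b [psb b0 bB1 _]]]] := std.
have [rb hb] := power_series1_psum psb.
have [fx [fy [ax ay fx0 fy0 [sg [K [sg0 K0 tf]]]]]] := partials.
have af : analytic2 f by case: irr.
have n00 : ((0 == n)%:R : C) = 0 by case: (n) n0.
have b00 : b 0%N = 0 by apply: b0; exact: leq_trans nB1.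
have Y0 : (eta 0).2 = 0 by rewrite eta0.
have X0 : (0 : C) ^+ n = 0 by rewrite expr0n; case: (n) n0.
have f0 : exists2 e : R, 0 < e & forall t, nm t < e -> f (t ^+ n, (eta t).2) = 0.
  have /near0P [e e0 he] : \forall t \near (0 : C), f (eta t) = 0.
    apply/ker => //; exists (fun=> 1); first exact: analytic2_1.
    by apply/near0P2; exists 1 => // x y _ _; rewrite mul1r.
  exists (Num.min e d0) => [|t]; first by rewrite lt_min e0.
  by rewrite lt_min => /andP[te td]; rewrite -hX // -surjective_pairing he.
have [X' [Y' [hX' hY' [e1 e10 rel]]]] := chain_rule0 sg0 K0 tf (psum1_Xn n) hb X0 Y0 f0.
have X'E t : nm t < 1 / 4 -> X' t = n%:R * t ^+ n.-1.
  move=> t4; apply: (psum1_uniq hX' (psum1_scale n%:R (psum1_Xn n.-1))) => //; last lra.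
  move=> i; rewrite /dcoef; case: (n) n0 => // m _ /=; rewrite eqSS.
  by case: eqP => [->|]; rewrite ?mulr0.
have db0 i : (i < n.-1)%N -> dcoef b i = 0.
  by move=> ip; rewrite /dcoef b0 ?mulr0 //; lia.
(* The derivative of phi has order [B1 - 1], at least [n], so [t ^+ n.-1] divides it; the quotient
   divided by [n] is psi. *)
have [v [hv Y'E]] := psum1_divXn hY' db0.
have hpsi := psum1_scale n%:R^-1 hv.
have rb0 : 0 < rb by case: hb => [[]].
have nn0 : n%:R != 0 :> C by rewrite pnatr_eq0 -lt0n.
have [sX sX0 [KX KX0 nX]] := psum1_near0 (psum1_Xn n).
have [sY sY0 [KY KY0 nY]] := psum1_near0 hb.
pose d1 := Num.min (Num.min (Num.min d0 e1) (Num.min (1 / 4) (rb / 4)))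
   (Num.min (Num.min sX sY) (Num.min (sg / KX) (sg / KY))).
have d10 : 0 < d1 by rewrite !lt_min d00 e10 sX0 sY0 !divr_gt0.
have small t : nm t < d1 ->
    [/\ eta t = (t ^+ n, (eta t).2), nm (t ^+ n) <= sg, nm (eta t).2 <= sg &
        fx (eta t) = - (n%:R^-1 * v t) * fy (eta t)].
  rewrite !lt_min => /andP[/andP[/andP[t1 t2] /andP[t3 t4]] /andP[/andP[t5 t6] /andP[t7 t8]]].
  move: t7 t8; rewrite !ltr_pdivlMr // => t7 t8.
  have e : eta t = (t ^+ n, (eta t).2) by rewrite -hX // -surjective_pairing.
  split=> //.
  - by have := nX _ (ltW t5); rewrite X0 subr0 mulrC; lra.
  - by have := nY _ (ltW t6); rewrite Y0 subr0 mulrC; lra.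
  (* The factor [t ^+ n.-1] may be 0 at the origin, but there both partials vanish because the
     multiplicity exceeds 1. *)
  have [->|t0] := eqVneq t 0; first by rewrite eta0 fx0 fy0 mulr0.
  have := rel t t2; rewrite X'E // Y'E // -e.
  have tn : t ^+ n.-1 != 0 by rewrite expf_neq0.
  set A := fx _; set B := fy _ => H.
  apply: (mulfI (mulf_neq0 nn0 tn)); apply/eqP; rewrite -subr_eq0; apply/eqP.
  by rewrite -H; field.
have fxE t : nm t < d1 -> f_x f (eta t) = fx (eta t).
  by move=> /small [e x y _]; rewrite e; apply: (taylor2_fx sg0 tf).
have fyE t : nm t < d1 -> f_y f (eta t) = fy (eta t).
  by move=> /small [e x y _]; rewrite e; apply: (taylor2_fy sg0 tf).
(* Unless its zeros along eta are isolated, [fy] vanishes identically there; the relation between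
   the partials gives the same for [fx], and the kernel of composition with eta would contain
   both. *)
have [d2 d20 hd2] : exists2 d : R, 0 < d & forall t, t != 0 -> nm t < d -> fy (t ^+ n, (eta t).2) != 0.
  have [a /power_series2P [r hr]] := ay.
  have [[d d'0 Z]|//] := comp_isolated_zeros hr (psum1_Xn n) hb n00 b00.
  have Zy t : nm t < Num.min d d1 -> fy (eta t) = 0.
    by rewrite lt_min => /andP[td /small [-> _ _ _]]; exact: Z.
  have Zx t : nm t < Num.min d d1 -> fx (eta t) = 0.
    move=> td; have : nm t < d1 by move: td; rewrite lt_min => /andP[].
    by move=> /small [_ _ _ ->]; rewrite Zy // mulr0.
  have dd1 : 0 < Num.min d d1 by rewrite lt_min d'0.
  have [k1 ak1 hk1] : exists2 k, analytic2 k & \forall p \near (0 : C * C), fx p = k p * f p.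
    by apply/ker => //; apply/near0P; exists (Num.min d d1).
  have [k2 ak2 hk2] : exists2 k, analytic2 k & \forall p \near (0 : C * C), fy p = k p * f p.
    by apply/ker => //; apply/near0P; exists (Num.min d d1).
  by case: (partials_not_in_ideal sg0 K0 tf ak1 ak2 hk1 hk2).
exists b, (fun j => n%:R^-1 * dcoef b (n.-1 + j)%N), (fun t => n%:R^-1 * v t), rb, (rb / 4).
exists (Num.min d1 d2); split=> //; split=> //.
- by move=> j; rewrite /dcoef mulrA -addSn prednK.
- by rewrite lt_min d10.
- move=> t; rewrite lt_min => /andP[t1 _]; rewrite fxE // fyE //.
  by have [e _ _ E] := small t t1; split; [rewrite e|].
split; first by rewrite fyE ?nm0 // eta0.
move=> t t0; rewrite lt_min => /andP[t1 t2]; rewrite fyE //.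
by have [-> _ _ _] := small t t1; exact: hd2.
Qed.

End Multiplicity.
End CurveData.

(** * Location of roots *)

Section RootLocation.
Variable R : realType.
Local Notation C := (Cplx R).
Implicit Types (s t x y z w : C) (p q : {poly C}).

Lemma seq_min_nm (rs : seq C) z : rs != [::] ->
  exists2 r, r \in rs & forall r', r' \in rs -> nm (z - r) <= nm (z - r').
Proof.
elim: rs => // r rs IH _; have [->|/IH [r1 r1in r1min]] := eqVneq rs [::].
  by exists r; rewrite ?mem_head // => r'; rewrite inE => /eqP ->.
have [le|lt] := leP (nm (z - r)) (nm (z - r1)).
  exists r; rewrite ?mem_head // => r'; rewrite inE => /orP[/eqP -> //|/r1min].
  exact: le_trans.
exists r1; rewrite ?inE ?r1in ?orbT // => r'; rewrite inE => /orP[/eqP ->|/r1min //].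
exact: ltW.
Qed.

(** The logarithmic derivative cleared of denominators, by the product rule; in this form [z] may
    itself be a root. *)
Lemma deriv_prod_XsubC_bound (rs : seq C) z (d : R) :
  (forall r, r \in rs -> d <= nm (z - r)) -> 0 <= d ->
  let p := \prod_(r <- rs) ('X - r%:P) in
  d * nm (p^`()).[z] <= (size rs)%:R * nm p.[z].
Proof.
move=> /= + d0; elim: rs => [|r rs IH] hd.
  by rewrite big_nil derivC hornerC nm0 mulr0 mul0r.
have {}IH := IH (fun r' h => hd r' (mem_behead (s := r :: rs) h)).
rewrite big_cons derivM derivXsubC mul1r hornerD !hornerM !hornerXsubC.
set P := \prod_(_ <- _) _ in IH *.
apply: le_trans (ler_wpM2l d0 (nmD _ _)) _; rewrite !nmM /= mulrDr -natr1 mulrDl mul1r addrC.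
apply: lerD; last by apply: ler_wpM2r; [exact: nm_ge0|apply: hd; rewrite mem_head].
by rewrite mulrCA [leRHS]mulrCA; apply: ler_wpM2l; first exact: nm_ge0.
Qed.

(* Taking absolute values in [q'/q = sum_rho 1 / (z - rho)]. *)
Lemma root_near q z : q^`().[z] != 0 -> exists2 rho, root q rho &
  nm (z - rho) * nm q^`().[z] <= (size q).-1%:R * nm q.[z].
Proof.
move=> q'0; have [rs qE] := closed_field_poly_normal q.
have q0 : q != 0 by apply: contraNneq q'0 => ->; rewrite derivC hornerC.
have lq0 : lead_coef q != 0 by rewrite lead_coef_eq0.
have sq : (size q).-1 = size rs.
  by rewrite qE size_scale // size_prod_XsubC.
have rs0 : rs != [::].
  by apply: contraNneq q'0 => rs0; rewrite qE rs0 big_nil alg_polyC derivC hornerC.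
have [rho rhoin rhomin] := seq_min_nm z rs0.
exists rho; first by rewrite qE rootZ // root_prod_XsubC.
rewrite sq [in leLHS]qE [in leRHS]qE derivZ !hornerZ !nmM mulrCA [leRHS]mulrCA.
apply: ler_wpM2l; first exact: nm_ge0.
by apply: (deriv_prod_XsubC_bound rhomin); exact: nm_ge0.
Qed.

(** The polynomial ['X^n - (t ^+ n)%:P] has derivative [n * s ^+ n.-1] at [s], and its degree [n] in
    the general bound cancels this factor [n]. At [s = 0] the derivative vanishes, but so does the
    left-hand side, as [n > 1]. *)
Lemma nearest_nth_root n s t : (1 < n)%N -> exists2 rho, rho ^+ n = t ^+ n &
  nm (s - rho) * nm s ^+ n.-1 <= nm (s ^+ n - t ^+ n).
Proof.
move=> n1; have n0 : (0 < n)%N by exact: ltnW.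
have [->|s0] := eqVneq s 0.
  exists t => //; rewrite nm0 expr0n; case: n n1 {n0} => [//|[//|n]] _ /=.
  by rewrite mulr0 nm_ge0.
have nn0 : n%:R != 0 :> C by rewrite pnatr_eq0 -lt0n.
pose q : {poly C} := 'X^n - (t ^+ n)%:P.
have dq : q^`().[s] = n%:R * s ^+ n.-1.
  by rewrite derivB derivXn derivC subr0 hornerMn hornerXn mulr_natl.
have dq0 : q^`().[s] != 0 by rewrite dq mulf_neq0 // expf_neq0.
have [rho rq b] := root_near dq0; exists rho.
  by move: rq; rewrite /root hornerD hornerN hornerXn hornerC subr_eq0 => /eqP.
have -> : nm (s ^+ n - t ^+ n) = nm q.[s] by rewrite hornerD hornerN hornerXn hornerC.
rewrite -(ler_pM2l (ltr0Sn R n.-1)) prednK //.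
by move: b => /=; rewrite size_XnsubC // dq nmM nm_nat nmX /= mulrCA.
Qed.

Lemma nontrivial_unity_root e : (1 < e)%N -> exists z : C, [/\ z ^+ e = 1, z != 1 & nm z = 1].
Proof.
move=> e1; pose p : {poly C} := \poly_(i < e) 1.
have /closed_rootP [z rz] : size p != 1%N.
  by rewrite size_poly_eq ?oner_neq0 // neq_ltn e1 orbT.
have sz : \sum_(i < e) z ^+ i = 0.
  move/rootP: rz; rewrite horner_poly => rz; rewrite -[RHS]rz.
  by apply: eq_bigr => i _; rewrite mul1r.
have ze : z ^+ e = 1 by apply/eqP; rewrite -subr_eq0 subrX1 sz mulr0.
exists z; split=> //.
  apply/eqP => z1; move: sz; rewrite z1.
  under eq_bigr do rewrite expr1n.
  by rewrite sumr_const card_ord => /eqP; rewrite pnatr_eq0; case: (e) e1.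
have : nm z ^+ e = 1 by rewrite -nmX ze nm1.
by move/eqP; rewrite pexpr_eq1 ?nm_ge0 // 1?ltnW // => /eqP.
Qed.

Lemma unity_roots_seq n : (0 < n)%N -> exists rs : seq C, forall z, z ^+ n = 1 -> z \in rs.
Proof.
move=> n0; have [rs E] := closed_field_poly_normal ('X^n - 1 : {poly C}).
exists rs => z zn; rewrite -root_prod_XsubC.
have lc : lead_coef ('X^n - 1 : {poly C}) != 0.
  by rewrite lead_coef_eq0 -size_poly_eq0 size_XnsubC.
rewrite -(rootZ _ _ lc) -E.
by rewrite /root hornerD hornerN hornerXn hornerC zn subrr.
Qed.

Lemma nm_unity_root n z : (0 < n)%N -> z ^+ n = 1 -> nm z = 1.
Proof.
move=> n0 zn; have : nm z ^+ n = 1 by rewrite -nmX zn nm1.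
by move/eqP; rewrite pexpr_eq1 ?nm_ge0 // => /eqP.
Qed.

End RootLocation.

(** * Leading terms of differences *)

Section Leading.
Variable R : realType.
Local Notation C := (Cplx R).
Implicit Types (s t x y z w : C) (r M rho : R) (b c : nat -> C) (u : C -> C).

Lemma psum1_add b r u c r' v : is_psum1 b r u -> is_psum1 c r' v ->
  is_psum1 (fun i => b i + c i) (Num.min r r') (fun t => u t + v t).
Proof.
move=> [[r0 [M bM]] bu] [[r'0 [M' cM]] cv]; split.
  split; first by rewrite lt_min r0.
  exists (M + M') => i.
  have m0 : 0 <= Num.min r r' by rewrite le_min !ltW.
  have e1 : Num.min r r' ^+ i <= r ^+ i.
    by apply: lerXn2r; rewrite ?nnegrE ?(ltW r0) // ge_min lexx.
  have e2 : Num.min r r' ^+ i <= r' ^+ i.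
    by apply: lerXn2r; rewrite ?nnegrE ?(ltW r'0) // ge_min lexx orbT.
  apply: le_trans (ler_wpM2r (exprn_ge0 _ m0) (nmD _ _)) _; rewrite mulrDl.
  apply: lerD.
    by apply: le_trans (bM i); rewrite ler_wpM2l ?nm_ge0.
  by apply: le_trans (cM i); rewrite ler_wpM2l ?nm_ge0.
move=> t; rewrite lt_min => /andP[tr tr'].
have H : (fun N => psum1 b N t + psum1 c N t) @ \oo --> u t + v t.
  exact: cvgD (bu t tr) (cv t tr').
apply: (cvg_ext (N0 := 0) H) => N _; rewrite /psum1 -big_split.
by apply: eq_bigr => i _; rewrite mulrDl.
Qed.

Lemma psum1_lead_lip b r u k : is_psum1 b r u -> (forall i, (i <= k)%N -> b i = 0) ->
  exists2 sg, 0 < sg & exists2 K, 0 <= K & forall mu s t, nm s <= mu -> nm t <= mu -> mu <= sg ->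
    nm (u s - u t) <= K * mu ^+ k * nm (s - t).
Proof.
move=> /psum1_lipschitz [sg sg0 /(_ k) [K K0 H]] b0; exists sg => //; exists K => // mu s t ms mt mg.
have := H _ _ _ ms mt mg.
have z w : psum1 b k.+1 w = 0 by rewrite /psum1 big1 // => i _; rewrite b0 ?mul0r // -ltnS.
by rewrite !z !subr0.
Qed.

(** Terms with [b i = 0] or [w ^+ i = 1] are unchanged by the rotation, and the tail is of order
    [k + 1] because [w * t - t] has modulus at most [2 |t|]. *)
Lemma psum1_rotate b r u w k : is_psum1 b r u -> nm w = 1 ->
  (forall i, (i < k)%N -> b i * (w ^+ i - 1) = 0) ->
  exists2 sg, 0 < sg & exists2 K, 0 <= K & forall t, nm t <= sg ->
    nm (u (w * t) - u t - b k * (w ^+ k - 1) * t ^+ k) <= K * nm t ^+ k.+1.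
Proof.
move=> /psum1_lipschitz [sg sg0 /(_ k) [K K0 H]] w1 b0; exists sg => //.
exists (K * 2) => [|t tg]; first by rewrite mulr_ge0.
have wt : nm (w * t) <= nm t by rewrite nmM w1 mul1r.
have := H _ _ _ wt (lexx _) tg.
have -> : psum1 b k.+1 (w * t) - psum1 b k.+1 t = b k * (w ^+ k - 1) * t ^+ k.
  rewrite /psum1 -sumrB big_ord_recr /= big1 ?add0r => [|i _]; rewrite exprMn.
    by ring.
  by rewrite [RHS](_ : 0 = b i * (w ^+ i - 1) * t ^+ i); [ring|rewrite b0 ?mul0r].
move=> {}H; apply: le_trans H _.
have e : nm (w * t - t) <= 2 * nm t by apply: le_trans (nmB _ _) _; lra.
have e' : 0 <= K * nm t ^+ k by rewrite mulr_ge0 ?exprn_ge0 ?nm_ge0.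
apply: le_trans (ler_wpM2l e' e) _.
by rewrite le_eqVlt; apply/orP; left; apply/eqP; rewrite exprS; ring.
Qed.

End Leading.

(** * Comparison of the differences of phi, psi and x *)

Section Estimates.
Variable R : realType.
Local Notation C := (Cplx R).
Implicit Types (s t x y z w : C) (M rho : R) (p q : {poly C}).

Variables (n B1 : nat) (b c : nat -> C) (phi psi : C -> C) (rb rp : R).
Hypotheses (n1 : (1 < n)%N) (nB1 : (n < B1)%N).
Hypotheses (hphi : is_psum1 b rb phi) (hpsi : is_psum1 c rp psi).
Hypotheses (b0 : forall k, (k < B1)%N -> b k = 0) (bB1 : b B1 = 1).
Hypothesis (cE : forall j, c j = n%:R^-1 * (n + j)%:R * b (n + j)%N).
Hypothesis (sep : forall z, z ^+ n = 1 -> z != 1 -> exists k, b k != 0 /\ z ^+ k != 1).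

Let n0 : (0 < n)%N. Proof. exact: ltnW. Qed.

Let B1E : B1.-1 = ((B1 - n.+1) + n.-1).+1.
Proof. by move: n1 nB1; clear; lia. Qed.

Let c0 j : (j < B1 - n)%N -> c j = 0.
Proof. by move=> jm; rewrite cE b0 ?mulr0 //; lia. Qed.

Let cm : c (B1 - n)%N != 0.
Proof.
rewrite cE subnKC ?(ltnW nB1) // bB1 mulr1 mulf_neq0 ?invr_eq0 ?pnatr_eq0 -?lt0n //.
exact: leq_trans nB1.
Qed.

(** One number [N] serves as exponent, as constant and as inverse radius. The property weakens as
    [N] grows, so a maximum makes it uniform over the finitely many roots of unity. *)
Definition rotation_bound N w := forall t, nm t < N.+1%:R^-1 ->
  nm t ^+ N <= nm (psi (w * t) - psi t) /\
  nm (phi (w * t) - phi t) <= N%:R * nm t ^+ n * nm (psi (w * t) - psi t).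

Lemma rotation_bound_mono N N' w : (N <= N')%N -> rotation_bound N w -> rotation_bound N' w.
Proof.
move=> NN' rN t tN'.
have tN : nm t < N.+1%:R^-1.
  by apply: lt_le_trans tN' _; rewrite lef_pV2 ?posrE // ler_nat.
have t1 : nm t <= 1.
  by apply: le_trans (ltW tN) _; rewrite invf_le1 // ler1n.
have [h1 h2] := rN t tN; split.
  by apply: le_trans h1; rewrite ler_wiXn2l ?nm_ge0.
apply: le_trans h2 _; rewrite -!mulrA; apply: ler_wpM2r.
  by rewrite mulr_ge0 ?exprn_ge0 ?nm_ge0.
by rewrite ler_nat.
Qed.

(** Let [k] be the least exponent of phi with [w ^+ k != 1]. As [w ^+ n = 1] and [c j] is a nonzero
    multiple of [b (n + j)] for the relevant [j], the first term of psi moved by [w] has degree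
    [k - n]. The two differences are then governed by [t ^+ k] and [t ^+ (k - n)]. *)
Lemma rotation_bound_exists w : w ^+ n = 1 -> w != 1 -> exists N, rotation_bound N w.
Proof.
move=> wn w1; have nw := nm_unity_root n0 wn.
have wD j : w ^+ (n + j) = w ^+ j by rewrite exprD wn mul1r.
have ex : exists k, (b k != 0) && (w ^+ k != 1).
  by have [k [bk wk]] := sep wn w1; exists k; rewrite bk.
pose k := ex_minn ex.
have /andP[bk wk] : (b k != 0) && (w ^+ k != 1) by rewrite /k; case: ex_minnP.
have kmin i : (i < k)%N -> b i * (w ^+ i - 1) = 0.
  rewrite /k; case: ex_minnP => m _ mmin im.
  have : ~~ ((b i != 0) && (w ^+ i != 1)) by apply: contraL im => /mmin; rewrite -leqNgt.
  by rewrite negb_and !negbK => /orP[/eqP ->|/eqP ->]; rewrite ?mul0r // subrr mulr0.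
have nk : (n < k)%N.
  by rewrite ltnNge; apply: contra bk => kn; rewrite b0 // (leq_ltn_trans kn).
have [s1 s10 [K1 K10 H1]] := psum1_rotate hphi nw kmin.
have cmin i : (i < k - n)%N -> c i * (w ^+ i - 1) = 0.
  move=> ik; rewrite cE -!mulrA -(wD i) kmin ?mulr0 //; lia.
have [s2 s20 [K2 K20 H2]] := psum1_rotate hpsi nw cmin.
set A := b k * _ in H1; set A' := c _ * _ in H2.
have A'0 : 0 < nm A'.
  rewrite nm_gt0 /A' mulf_neq0 //; last first.
    by rewrite -(wD (k - n)%N) subnKC ?(ltnW nk) // subr_eq0.
  rewrite cE subnKC ?(ltnW nk) // !mulf_neq0 ?invr_eq0 ?pnatr_eq0 // -lt0n //.
  exact: leq_trans nk.
(* [X] adds up every lower bound that [N] must satisfy; the summands are nonnegative, so [N >= X]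
   yields all of them. *)
pose X := s1^-1 + s2^-1 + (K2 + 1) * 2 / nm A' + k.+1%:R + (nm A + K1) * 2 / nm A' + 2 / nm A'.
have X0 : 0 <= X by rewrite !addr_ge0 ?mulr_ge0 ?invr_ge0 ?addr_ge0 ?nm_ge0 // ltW.
have [N] : exists N, X <= N%:R.
  by exists (Num.truncn X).+1; rewrite ltW // truncnS_gt.
rewrite /X => XN {X X0}; exists N => t tN.
have p1 : 0 < s1^-1 by rewrite invr_gt0.
have p2 : 0 < s2^-1 by rewrite invr_gt0.
have p3 : 0 <= (K2 + 1) * 2 / nm A' by rewrite divr_ge0 ?mulr_ge0 ?addr_ge0 ?nm_ge0.
have p4 : 0 <= (nm A + K1) * 2 / nm A' by rewrite divr_ge0 ?mulr_ge0 ?addr_ge0 ?nm_ge0.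
have p5 : 0 <= 2 / nm A' by rewrite divr_ge0 ?nm_ge0.
have p6 : (0 : R) <= k.+1%:R by [].
have t0 := nm_ge0 t.
have NN : N%:R < N.+1%:R :> R by rewrite ltr_nat.
have sml (y : R) : 0 < y -> y <= N%:R -> nm t <= y^-1.
  move=> y0 yN; apply: le_trans (ltW tN) _; rewrite lef_pV2 ?posrE //; lra.
have t1 : nm t <= s1 by have := sml s1^-1 p1; rewrite invrK; apply; lra.
have t2 : nm t <= s2 by have := sml s2^-1 p2; rewrite invrK; apply; lra.
have kN : (k < N)%N by rewrite -(ler_nat R); lra.
have tone : nm t <= 1.
  by rewrite -invr1; apply: sml => //; rewrite ler1n; exact: leq_trans kN.
have t3 : K2 * nm t <= nm A' / 2.
  have K21 : 0 < K2 + 1 by lra.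
  have y0 : 0 < (K2 + 1) * 2 / nm A' by rewrite divr_gt0 ?mulr_gt0.
  have yN : (K2 + 1) * 2 / nm A' <= N%:R by lra.
  by have := sml _ y0 yN; rewrite invf_div ler_pdivlMr ?mulr_gt0 //; lra.
set m := (k - n)%N in H2 cmin *.
have km : k = (m + n)%N by rewrite subnK // ltnW.
have Tm : 0 <= nm t ^+ m by rewrite exprn_ge0.
have low : nm A' / 2 * nm t ^+ m <= nm (psi (w * t) - psi t).
  have h := H2 t t2; have := nmB (psi (w * t) - psi t) (psi (w * t) - psi t - A' * t ^+ m).
  rewrite subKr nmM nmX; move: h; rewrite exprS.
  have := ler_wpM2r Tm t3; lra.
have Dp0 := nm_ge0 (psi (w * t) - psi t).
have HA : nm t <= nm A' / 2.
  have [|A'2] := leP 2 (nm A'); first by lra.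
  have := sml (2 / nm A'); rewrite invf_div; apply; [by rewrite divr_gt0|lra].
split.
  apply: le_trans low; apply: (@le_trans _ _ (nm t ^+ m.+1)).
    by rewrite ler_wiXn2l // (leq_ltn_trans _ kN) // leq_subr.
  by rewrite exprS ler_wpM2r.
have up : nm (phi (w * t) - phi t) <= (nm A + K1) * nm t ^+ k.
  have h := H1 t t1; have := nmD (phi (w * t) - phi t - A * t ^+ k) (A * t ^+ k).
  rewrite subrK nmM nmX; move: h; rewrite exprS.
  have : nm t * nm t ^+ k <= 1 * nm t ^+ k by rewrite ler_wpM2r ?exprn_ge0.
  move=> e1 e2 e3; have := ler_wpM2l K10 e1; lra.
apply: le_trans up _; rewrite km exprD.
have Tn : 0 <= nm t ^+ n by rewrite exprn_ge0.
have -> : (nm A + K1) * (nm t ^+ m * nm t ^+ n) =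
   ((nm A + K1) * 2 / nm A' * nm t ^+ n) * (nm A' / 2 * nm t ^+ m).
  by field; rewrite lt0r_neq0.
apply: le_trans (ler_wpM2l _ low) _; first by rewrite mulr_ge0.
by apply: ler_wpM2r => //; apply: ler_wpM2r => //; lra.
Qed.

Lemma rotation_bound_uniform : exists N, forall w, w ^+ n = 1 -> w != 1 -> rotation_bound N w.
Proof.
have [rs rsP] := unity_roots_seq R n0.
suff [N HN] : exists N, forall w, w \in rs -> w ^+ n = 1 -> w != 1 -> rotation_bound N w.
  by exists N => w wn; exact: HN (rsP _ wn) wn.
elim: rs {rsP} => [|w rs [N HN]]; first by exists 0%N.
have [[wn w1]|nw] := pselect (w ^+ n = 1 /\ w != 1); last first.
  by exists N => z; rewrite inE => /orP[/eqP -> wn w1|/HN //]; case: nw.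
have [N' HN'] := rotation_bound_exists wn w1.
exists (maxn N N') => z; rewrite inE => /orP[/eqP -> _ _|zrs zn z1].
  exact: rotation_bound_mono (leq_maxr _ _) HN'.
by apply: rotation_bound_mono (leq_maxl _ _) _; exact: HN.
Qed.

(** The difference of psi from [s] to [rho] is bounded only after multiplication by [|t| ^ n], since
    psi may have too low an order; this is the very factor with which psi enters the bound for phi
    from [rho] to [t]. The alternative [rho = t] also takes in [t = 0], where no rotation is
    defined. *)
Lemma branch_decomposition : exists (N : nat) (d K : R), [/\ 0 < d, d <= 1, 0 <= K &
  forall s t, nm t <= nm s -> nm s < d -> exists rho : C,
  [/\ nm (phi s - phi rho) <= K * nm s * nm (s ^+ n - t ^+ n),
      nm t ^+ n * nm (psi s - psi rho) <= K * nm s * nm (s ^+ n - t ^+ n),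
      nm (s - rho) * nm s ^+ n.-1 <= nm (s ^+ n - t ^+ n) &
      rho = t \/ (nm t ^+ N <= nm (psi rho - psi t) /\
       nm (phi rho - phi t) <= N%:R * nm t ^+ n * nm (psi rho - psi t))]].
Proof.
have [N HN] := rotation_bound_uniform.
have [s1 s10 [K1 K10 L1]] : exists2 sg, 0 < sg & exists2 K, 0 <= K &
    forall mu s t, nm s <= mu -> nm t <= mu -> mu <= sg ->
    nm (phi s - phi t) <= K * mu ^+ B1.-1 * nm (s - t).
  by apply: psum1_lead_lip hphi _ => i iB; apply: b0; lia.
have [s2 s20 [K2 K20 L2]] : exists2 sg, 0 < sg & exists2 K, 0 <= K &
    forall mu s t, nm s <= mu -> nm t <= mu -> mu <= sg ->
    nm (psi s - psi t) <= K * mu ^+ (B1 - n).-1 * nm (s - t).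
  by apply: psum1_lead_lip hpsi _ => i iB; apply: c0; lia.
pose d := Num.min (Num.min s1 s2) (Num.min 1 N.+1%:R^-1).
exists N, d, (K1 + K2); split.
- by rewrite !lt_min s10 s20 ltr01 invr_gt0 ltr0n.
- by rewrite /d ge_min [Num.min 1 _ <= 1]ge_min lexx !orbT.
- exact: addr_ge0.
move=> s t ts; rewrite !lt_min => /andP[/andP[d1 d2] /andP[d3 d4]].
have [rho rn near] := nearest_nth_root s t n1; exists rho.
have nr : nm rho = nm t.
  have : nm rho ^+ n = nm t ^+ n by rewrite -!nmX rn.
  by move/eqP; rewrite eqrXn2 ?nm_ge0 // => /eqP.
have ns : nm rho <= nm s by rewrite nr.
set Dx := nm (s ^+ n - _) in near *.
have Dx0 : 0 <= Dx by exact: nm_ge0.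
have s0 := nm_ge0 s.
(* The power [n - 1] of [|s|] turns [s - rho] into the difference of x, one more makes the bound
   small, and the remaining [k] are at most 1. *)
have pw k : nm s ^+ (k + n.-1).+1 * nm (s - rho) <= nm s * Dx.
  rewrite exprS exprD -!mulrA ler_wpM2l //.
  apply: (@le_trans _ _ (1 * Dx)); last by rewrite mul1r.
  apply: ler_pM; rewrite ?exprn_ge0 ?mulr_ge0 ?exprn_ge0 ?nm_ge0 //.
    by rewrite exprn_ile1 // ltW.
  by rewrite mulrC.
have sD : 0 <= nm s * Dx by rewrite mulr_ge0.
split=> //.
- apply: le_trans (L1 _ _ _ (lexx _) ns (ltW d1)) _.
  rewrite B1E.
  have := ler_wpM2l K10 (pw (B1 - n.+1)%N); rewrite -!mulrA mulrDl => e.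
  by apply: le_trans e _; rewrite lerDl mulr_ge0.
- have e1 : nm t ^+ n <= nm s ^+ n by rewrite lerXn2r ?nnegrE ?nm_ge0.
  apply: le_trans (ler_pM (exprn_ge0 _ (nm_ge0 _)) (nm_ge0 _) e1 (L2 _ _ _ (lexx _) ns (ltW d2))) _.
  have -> : nm s ^+ n * (K2 * nm s ^+ (B1 - n).-1 * nm (s - rho)) =
     K2 * (nm s ^+ ((B1 - n).-1 + n.-1).+1 * nm (s - rho)).
    by rewrite -addnS prednK // exprD; ring.
  apply: le_trans (ler_wpM2l K20 (pw _)) _; rewrite -!mulrA mulrDl.
  by rewrite lerDr mulr_ge0.
have [t0|t0] := eqVneq t 0.
  left; rewrite t0; apply/eqP; rewrite -nm_eq0 nr t0 nm0 //.
have [|ne] := eqVneq (rho / t) 1.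
  by move=> e; left; rewrite -(divfK t0 rho) e mul1r.
right; have wn : (rho / t) ^+ n = 1 by rewrite expr_div_n rn divff // expf_neq0.
have := HN _ wn ne t (le_lt_trans ts d4); rewrite divfK //.
Qed.

(** By symmetry [|t| <= |s|]. Both legs, from [s] to [rho] and from [rho] to [t], carry a factor
    [|s|] once [psi rho] is replaced by [psi s] in the second one. *)
Lemma phi_small e : 0 < e -> exists2 d : R, 0 < d & forall s t, nm s < d -> nm t < d ->
  nm (phi s - phi t) <= e * (nm (psi s - psi t) + nm (s ^+ n - t ^+ n)).
Proof.
move=> e0; have [N [d [K [d0 d1 K0 H]]]] := branch_decomposition.
pose M := K + N%:R * K + N%:R + 1.
have NK : 0 <= N%:R * K by rewrite mulr_ge0.
have N0 : (0 : R) <= N%:R by [].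
have M0 : 0 < M by rewrite /M; lra.
have main s t : nm t <= nm s -> nm s < Num.min d (e / M) ->
    nm (phi s - phi t) <= e * (nm (psi s - psi t) + nm (s ^+ n - t ^+ n)).
  move=> ts; rewrite lt_min => /andP[sd]; rewrite ltr_pdivlMr // => sM.
  have [rho [h1 h2 _ h3]] := H s t ts sd.
  set Dx := nm (s ^+ n - _) in h1 h2 *; set P := nm (psi s - psi t).
  have [P0 Dx0 s0] : [/\ 0 <= P, 0 <= Dx & 0 <= nm s] by rewrite !nm_ge0.
  have tn : nm t ^+ n <= nm s.
    have t1 : nm t <= 1 by lra.
    apply: le_trans ts; rewrite -[leRHS]expr1.
    by rewrite ler_wiXn2l ?nm_ge0.
  have h4 : nm (phi rho - phi t) <= N%:R * (nm s * P) + N%:R * (K * nm s * Dx).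
    case: h3 => [->|[_ h3]].
      by rewrite subrr nm0 addr_ge0 // !mulr_ge0.
    apply: le_trans h3 _; rewrite -mulrA -mulrDr ler_wpM2l //.
    have := nm_tri (psi rho) (psi s) (psi t); rewrite (nmC (psi rho) (psi s)) -/P => h5.
    apply: le_trans (ler_wpM2l (exprn_ge0 n (nm_ge0 t)) h5) _.
    rewrite mulrDr addrC; apply: lerD => //.
    by rewrite ler_wpM2r.
  have := nm_tri (phi s) (phi rho) (phi t).
  have k1 : K * nm s * Dx + N%:R * (K * nm s * Dx) + N%:R * (nm s * P) <= nm s * M * (P + Dx).
    have : 0 <= nm s * (K * P + N%:R * K * P + N%:R * Dx + P + Dx).
      by rewrite mulr_ge0 // !addr_ge0 ?mulr_ge0.
    rewrite /M; lra.
  have k2 : nm s * M * (P + Dx) <= e * (P + Dx) by rewrite ler_wpM2r ?addr_ge0 // ltW.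
  lra.
exists (Num.min d (e / M)) => [|s t sd td]; first by rewrite lt_min d0 divr_gt0.
have [ts|/ltW st] := leP (nm t) (nm s); first exact: main.
by rewrite (nmC (phi s)) (nmC (psi s)) (nmC (s ^+ n)); exact: main.
Qed.

(** If [rho = t], the separation itself bounds the difference of x below by [k * |t| ^ n]. Otherwise
    [psi rho - psi t] is at least [|t| ^ N], and passing from [rho] to [s] costs a factor
    [|t| ^ n]. *)
Lemma separation_lower_bound : exists (L : nat) (d : R), 0 < d /\ forall k : R, 0 < k ->
  exists2 c : R, 0 < c & forall s t, nm t <= nm s -> nm s < d -> k * nm t <= nm (s - t) ->
  c * nm t ^+ L <= nm (psi s - psi t) + nm (s ^+ n - t ^+ n).
Proof.
have [N [d [K [d0 d1 K0 H]]]] := branch_decomposition.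
exists (N + n)%N, d; split=> // k k0; exists (Num.min k (1 + K)^-1).
  by rewrite lt_min k0 invr_gt0 ltr_wpDr.
move=> s t ts sd kt; have [rho [_ h2 h3 h4]] := H s t ts sd.
set Dx := nm (s ^+ n - _) in h2 h3 *; set P := nm (psi s - psi t).
have [P0 Dx0 s0 t0] : [/\ 0 <= P, 0 <= Dx, 0 <= nm s & 0 <= nm t] by rewrite !nm_ge0.
have t1 : nm t <= 1 by lra.
have TL : 0 <= nm t ^+ (N + n) by rewrite exprn_ge0.
have [e|[h4' _]] := h4.
  apply: (@le_trans _ _ (k * nm t ^+ n)).
    apply: ler_pM => //; first by rewrite le_min ltW //= invr_ge0 addr_ge0.
      by rewrite ge_min lexx.
    by rewrite ler_wiXn2l // leq_addl.
  rewrite -(prednK n0) exprS mulrA.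
  apply: (@le_trans _ _ Dx); last by rewrite lerDr.
  apply: le_trans h3; rewrite e; apply: ler_pM; rewrite ?exprn_ge0 // ?mulr_ge0 ?(ltW k0) //.
  by rewrite lerXn2r ?nnegrE.
have K1 : 0 < 1 + K by rewrite ltr_wpDr.
apply: (@le_trans _ _ ((1 + K)^-1 * nm t ^+ (N + n))).
  by rewrite ler_wpM2r // ge_min lexx orbT.
rewrite mulrC ler_pdivrMr // exprD mulrC.
apply: le_trans (ler_wpM2l (exprn_ge0 n t0) h4') _.
have := nm_tri (psi rho) (psi s) (psi t); rewrite (nmC (psi rho) (psi s)) -/P => h5.
apply: le_trans (ler_wpM2l (exprn_ge0 n t0) h5) _; rewrite mulrDr.
have e1 : nm t ^+ n * P <= P by rewrite -[leRHS]mul1r ler_wpM2r // exprn_ile1.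
have e2 : K * nm s * Dx <= K * Dx.
  by rewrite -mulrA ler_wpM2l // -[leRHS]mul1r ler_wpM2r //; lra.
have e3 : 0 <= K * P by rewrite mulr_ge0.
lra.
Qed.

End Estimates.

(** * Realizing every direction (D psi : D x) when B1 > n + 1 *)

Section LimitDirections.
Variable R : realType.
Local Notation C := (Cplx R).
Implicit Types (s t x y z w : C) (M rho : R) (p q : {poly C}).

Lemma horner_bounded p : exists2 K : R, 0 <= K & forall t, nm t <= 1 -> nm p.[t] <= K.
Proof.
exists (pnorm 1 p) => [|t t1]; first exact: pnorm_ge0.
by have := @horner_tail _ 1 p t 0 ltr01 t1; rewrite big_ord0 subr0 expr0 mulr1.
Qed.

(* A polynomial vanishing to order [e] at [0] has a level set through [t] with a
   branch tangent to the line spanned by [z * t], for every [z] with [z ^+ e = 1]. *)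
Lemma level_set_branch p e z : (0 < e)%N -> (forall i, (i < e)%N -> p`_i = 0) -> p`_e != 0 ->
  z ^+ e = 1 -> nm z = 1 ->
  exists2 d : R, 0 < d & exists2 K : R, 0 <= K & forall t, t != 0 -> nm t < d ->
    exists2 s, p.[s] = p.[t] & nm (z * t - s) <= K * nm t ^+ 2.
Proof.
move=> e0 p0 pe ze nz.
pose p2 := drop_poly e.+1 p; pose de := p`_e.
have pE : p = de *: 'X^e + 'X^(e.+1) * p2.
  rewrite -[LHS](poly_take_drop e.+1) [p2 in RHS]lock mulrC -lock; congr (_ + _).
  apply/polyP => i; rewrite coef_take_poly coefZ coefXn ltnS leq_eqVlt.
  have [->|ie] := eqVneq i e; first by rewrite mulr1.
  by rewrite mulr0 /=; case: ltnP => // /p0.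
pose p3 := e.+1%:R *: p2 + 'X * p2^`().
have p'E t : p^`().[t] = t ^+ e.-1 * (e%:R * de + t * p3.[t]).
  rewrite pE derivD derivZ derivXn derivM derivXn /=.
  rewrite !(hornerD, hornerM, hornerZ, hornerX, hornerMn, hornerXn) -[_ *+ e]mulr_natl -[_ *+ e.+1]mulr_natl.
  have -> : t ^+ e.+1 = t ^+ e.-1 * t * t by rewrite -!exprSr prednK.
  have -> : t ^+ e = t ^+ e.-1 * t by rewrite -exprSr prednK.
  by ring.
have [K2 K20 b2] := horner_bounded p2; have [K3 K30 b3] := horner_bounded p3.
have de0 : 0 < nm de by rewrite nm_gt0.
have en0 : 0 < e%:R :> R by rewrite ltr0n.
have eR : 1 <= e%:R :> R by rewrite ler1n.
pose d := Num.min 1 (nm de / (2 * (K3 + 1))).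
have K31 : 0 < 2 * (K3 + 1) by lra.
exists d; first by rewrite lt_min ltr01 divr_gt0.
exists ((size p)%:R * (2 * K2) * 2 / nm de) => [|t t0].
  by rewrite !mulr_ge0 ?invr_ge0 ?nm_ge0.
rewrite lt_min => /andP[t1]; rewrite ltr_pdivlMr // => tK.
have nt0 : 0 < nm t by rewrite nm_gt0.
have zt : nm (z * t) = nm t by rewrite nmM nz mul1r.
have zt1 : nm (z * t) <= 1 by rewrite zt ltW.
(* The term of degree [e] dominates, so at [z * t] the derivative is at least of order [e - 1]. *)
have low : nm t ^+ e.-1 * (nm de / 2) <= nm p^`().[z * t].
  rewrite p'E nmM nmX zt; apply: ler_wpM2l; first by rewrite exprn_ge0 // ltW.
  have := nm_lb (e%:R * de) (z * t * p3.[z * t]); rewrite !nmM nm_nat nz mul1r.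
  have := ler_wpM2l (ltW nt0) (b3 _ zt1); have : nm de <= e%:R * nm de by nra.
  lra.
have tp : 0 < nm t ^+ e.-1 by rewrite exprn_gt0.
pose q := p - (p.[t])%:P.
have q'E : q^`() = p^`() by rewrite derivB derivC subr0.
have q'0 : q^`().[z * t] != 0.
  by rewrite q'E -nm_gt0; apply: lt_le_trans low; rewrite mulr_gt0 // divr_gt0.
have [s rs sz] := root_near q'0; exists s.
  by move: rs; rewrite /root hornerD hornerN hornerC subr_eq0 => /eqP.
have sq : (size q).-1%:R <= (size p)%:R :> R.
  have p0' : p != 0 by apply: contraNneq pe => ->; rewrite coef0.
  rewrite ler_nat; apply: leq_trans (leq_pred _) _.
  apply: leq_trans (size_polyD _ _) _; rewrite size_polyN geq_max leqnn /=.
  by apply: leq_trans (size_polyC_leq1 _) _; rewrite lt0n size_poly_eq0.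
(* Because [z ^+ e = 1], the terms of degree [e] cancel and [q] has order [e + 1] at [z * t].
   Divided by a derivative of order [e - 1], this puts a root within [O(t^2)]. *)
have qv : nm q.[z * t] <= 2 * K2 * nm t ^+ e.+1.
  rewrite /q hornerD hornerN hornerC pE !(hornerD, hornerM, hornerZ, hornerXn) !exprMn ze mul1r.
  have -> : de * t ^+ e + z ^+ e.+1 * t ^+ e.+1 * p2.[z * t] - (de * t ^+ e + t ^+ e.+1 * p2.[t])
     = t ^+ e.+1 * (z ^+ e.+1 * p2.[z * t] - p2.[t]) by ring.
  rewrite nmM nmX mulrC; apply: ler_wpM2r; first by rewrite exprn_ge0 // ltW.
  apply: le_trans (nmB _ _) _; rewrite nmM nmX nz expr1n mul1r.
  have := b2 _ zt1; have := b2 t (ltW t1); lra.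
rewrite q'E in sz.
have : nm (z * t - s) * (nm t ^+ e.-1 * (nm de / 2)) <=
    (size p)%:R * (2 * K2 * nm t ^+ e.+1).
  apply: le_trans (ler_wpM2l (nm_ge0 _) low) _; apply: le_trans sz _.
  by apply: ler_pM; rewrite ?nm_ge0.
have -> : nm t ^+ e.+1 = nm t ^+ e.-1 * nm t ^+ 2.
  by rewrite -exprD; congr (_ ^+ _); rewrite addn2 prednK.
move=> H; rewrite -(ler_pM2l tp) -(ler_pM2l (divr_gt0 de0 (ltr0n _ 2))).
have -> : nm de / 2 * (nm t ^+ e.-1 * ((size p)%:R * (2 * K2) * 2 / nm de * nm t ^+ 2)) =
   (size p)%:R * (2 * K2 * (nm t ^+ e.-1 * nm t ^+ 2)) by field; rewrite lt0r_neq0.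
by apply: le_trans H; rewrite le_eqVlt; apply/orP; left; apply/eqP; ring.
Qed.

Variables (n B1 : nat) (b c : nat -> C) (phi psi : C -> C) (rb rp : R).
Hypotheses (n1 : (1 < n)%N) (nB1 : (n.+1 < B1)%N) (nB : ~~ (n %| B1)%N).
Hypotheses (hphi : is_psum1 b rb phi) (hpsi : is_psum1 c rp psi).
Hypotheses (b0 : forall k, (k < B1)%N -> b k = 0) (bB1 : b B1 = 1).
Hypothesis (cE : forall j, c j = n%:R^-1 * (n + j)%:R * b (n + j)%N).
Hypothesis (sep : forall z, z ^+ n = 1 -> z != 1 -> exists k, b k != 0 /\ z ^+ k != 1).

(** The orders [n] of x and [B1 - n] of psi are both at least 2, and they differ because [n] does
    not divide [B1]. So a nontrivial combination cannot vanish identically. *)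
Lemma combination_order (al be : C) : (al != 0) || (be != 0) ->
  exists e, [/\ (1 < e)%N, al * (e == n)%:R + be * c e != 0 &
    forall i, (i < e)%N -> al * (i == n)%:R + be * c i = 0].
Proof.
move=> ab; have ex : exists e, al * (e == n)%:R + be * c e != 0.
  have [be0|be0] := eqVneq be 0.
    by exists n; rewrite be0 eqxx mulr1 mul0r addr0; move: ab; rewrite be0 eqxx orbF.
  exists (B1 - n)%N; have -> : (B1 - n == n)%N = false.
    apply/negP => /eqP e; move: nB; rewrite -(subnK (leq_trans (leqnSn n) (ltnW nB1))) e.
    by rewrite dvdn_add.
  rewrite mulr0 add0r mulf_neq0 // cE subnKC ?(leq_trans (leqnSn n) (ltnW nB1)) //.
  rewrite bB1 mulr1 mulf_neq0 ?invr_eq0 ?pnatr_eq0 -?lt0n //; first exact: ltnW.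
  exact: leq_ltn_trans nB1.
exists (ex_minn ex); case: ex_minnP => e He emin.
have emin' i : (i < e)%N -> al * (i == n)%:R + be * c i = 0.
  by move=> ie; apply/eqP; apply: contraTT ie => /emin; rewrite -leqNgt.
split=> //; rewrite ltnNge; apply: contra He => e1.
have -> : (e == n) = false by apply/negP => /eqP E; move: n1; rewrite -E ltnNge e1.
rewrite mulr0 add0r cE b0 ?mulr0 //.
by apply: leq_ltn_trans nB1; rewrite -addn1 leq_add2l.
Qed.

Lemma limit_directions (al be : C) (e : R) : (al != 0) || (be != 0) -> 0 < e ->
  exists s t, [/\ s != 0, t != 0, nm s < e, nm t < e &
   [/\ 0 < nm (psi s - psi t) + nm (s ^+ n - t ^+ n) &
    nm (al * (s ^+ n - t ^+ n) + be * (psi s - psi t)) <=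
      e * (nm (psi s - psi t) + nm (s ^+ n - t ^+ n))]].
Proof.
move=> ab e0.
have [ ord [ h1 dn0 dlt ] ] := combination_order ab.
pose dc i := al * (i == n)%:R + be * c i.
have hu := psum1_add (psum1_scale al (psum1_Xn R n)) (psum1_scale be hpsi).
set u := (fun t => _) in hu.
have [L [d1 [d10 sepL]]] := separation_lower_bound n1 (ltnW nB1) hphi hpsi b0 bB1 cE sep.
have [z [zo z1 nz]] := nontrivial_unity_root R h1.
have [sg sg0 lip] := psum1_lipschitz hu.
have [K K0 {}lip] := lip (maxn L ord).
(* As [k >= L], the tail has order at least [k + 1], smaller than the lower bound [|t| ^ L]; as
   [k >= ord], the truncation keeps the leading term. *)
set k := maxn L ord in lip.
have [Lk oK] : (L <= k)%N /\ (ord <= k)%N by rewrite leq_maxl leq_maxr.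
pose p := trunc_poly dc k.+1.
have pc i : (i <= k)%N -> p`_i = dc i by move=> ik; rewrite coef_poly ltnS ik.
have pz i : (i < ord)%N -> p`_i = 0.
  by move=> io; rewrite pc; [exact: dlt|exact: leq_trans (ltnW io) oK].
have po : p`_ord != 0 by rewrite pc.
have [d2 d20 [K2 K20 branch]] := level_set_branch (ltnW h1) pz po zo nz.
have z10 : 0 < nm (z - 1) by rewrite nm_gt0 subr_eq0.
have [c0 c00 {}sepL] := sepL _ (divr_gt0 z10 (ltr0n R 2)).
have P2 j : 0 < (2 : R) ^+ j by rewrite exprn_gt0.
(* The first two summands keep [s] close to [z * t], hence away from 0 and from [t]; the third makes
   the tail at most [e] times the lower bound. *)
pose X := K2 + K2 * 2 / nm (z - 1) + K * 2 ^+ k * 3 * 2 ^+ L / c0 / e.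
have X0 : 0 <= X.
  rewrite /X !addr_ge0 //; first by rewrite divr_ge0 ?mulr_ge0 ?nm_ge0.
  by rewrite !divr_ge0 ?(ltW e0) ?(ltW c00) // !mulr_ge0 // ltW.
pose T := Num.min (Num.min (Num.min 2^-1 (e / 2)) (Num.min (d1 / 2) d2)) (Num.min (sg / 2) (2 * (X + 1))^-1).
have T0 : 0 < T.
  have X1 : 0 < 2 * (X + 1) by lra.
  by rewrite !lt_min !divr_gt0 // !invr_gt0 // ltr0n d20 X1.
pose t := rc (T / 2).
have ntE : nm t = T / 2 by rewrite nm_rc // divr_ge0 // ltW.
have nt0 : 0 < nm t by rewrite ntE divr_gt0.
have t0 : t != 0 by rewrite -nm_gt0.
have : nm t < T by rewrite ntE; lra.
rewrite !lt_min => /andP[/andP[/andP[t1 t2] /andP[t3 t4]] /andP[t5 t6]].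
have tX : nm t * (2 * (X + 1)) < 1.
  by rewrite -ltr_pdivlMr; [rewrite div1r|lra].
have [s ps sz] := branch t t0 t4; exists s, t.
have {T0 ntE branch} szt : nm (z * t - s) <= nm t * (K2 * nm t) by rewrite expr2 in sz; lra.
have q1 : 0 <= K2 * 2 / nm (z - 1) by rewrite divr_ge0 ?mulr_ge0 ?nm_ge0.
have q2 : 0 <= K * 2 ^+ k * 3 * 2 ^+ L / c0 / e.
  by rewrite !divr_ge0 ?(ltW e0) ?(ltW c00) // !mulr_ge0 // ltW.
have b1 : K2 * nm t <= 2^-1.
  have : nm t * K2 <= nm t * (X + 1) by rewrite ler_wpM2l ?(ltW nt0) // /X; lra.
  lra.
have b2 : K2 * nm t <= nm (z - 1) / 2.
  have : nm t * (K2 * 2 / nm (z - 1)) <= nm t * (X + 1).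
    by rewrite ler_wpM2l ?(ltW nt0) // /X; lra.
  rewrite mulrA => h; have : nm t * (K2 * 2) / nm (z - 1) <= 1 by lra.
  rewrite ler_pdivrMr // ; lra.
have zt : nm (z * t) = nm t by rewrite nmM nz mul1r.
have szt1 : nm (z * t - s) <= nm t / 2.
  by apply: le_trans szt _; rewrite ler_wpM2l // ltW.
have szt2 : nm (z * t - s) <= nm t * (nm (z - 1) / 2).
  by apply: le_trans szt _; rewrite ler_wpM2l // ltW.
have slo : nm t / 2 <= nm s.
  have := nmD (z * t - s) s; rewrite subrK zt; lra.
have shi : nm s <= nm t * (3 / 2).
  have := nmB (z * t) (z * t - s); rewrite subKr zt; lra.
have st : nm (z - 1) / 2 * nm t <= nm (s - t).
  have e1 : nm (z * t - t) = nm (z - 1) * nm t by rewrite -nmM mulrBl mul1r.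
  by have := nm_tri (z * t) s t; rewrite e1; lra.
set S := nm (psi s - psi t) + _.
(* The separation bound is in terms of the smaller modulus, which may be that of [s]; since
   [|s| >= |t| / 2], this costs only [2 ^+ L]. *)
have low : c0 * (nm t ^+ L / 2 ^+ L) <= S.
  have H : nm t ^+ L / 2 ^+ L <= Num.min (nm s) (nm t) ^+ L.
    rewrite -exprVn -exprMn; apply: lerXn2r; rewrite ?nnegrE ?le_min ?nm_ge0 //.
      by rewrite divr_ge0 // ltW.
    by rewrite slo /=; lra.
  apply: le_trans (ler_wpM2l (ltW c00) H) _.
  have [ts|/ltW sst] := leP (nm t) (nm s).
    by apply: sepL => //; lra.
  rewrite /S (nmC (psi s)) (nmC (s ^+ n)); apply: sepL => //; first by lra.
  rewrite (nmC t); apply: le_trans st; apply: ler_wpM2l => //.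
  by rewrite divr_ge0 // nm_ge0.
have S0 : 0 < S.
  by apply: lt_le_trans low; rewrite mulr_gt0 // divr_gt0 // exprn_gt0.
have s0 : s != 0 by rewrite -nm_gt0; lra.
split=> //; [lra|lra|split=> //].
(* As the truncation [p] takes the same value at [s] and [t], only the difference of the tails
   remains. *)
have -> : al * (s ^+ n - t ^+ n) + be * (psi s - psi t) =
    u s - u t - (psum1 dc k.+1 s - psum1 dc k.+1 t).
  by rewrite -!horner_trunc_poly -/p ps subrr subr0 /u; ring.
have t2g : nm t <= 2 * nm t by lra.
have s2g : nm s <= 2 * nm t by lra.
have g2 : 2 * nm t <= sg by lra.
apply: le_trans (lip _ _ _ s2g t2g g2) _.
have stb : nm (s - t) <= 3 * nm t by apply: le_trans (nmB _ _) _; lra.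
have tk : nm t ^+ k <= nm t ^+ L by rewrite ler_wiXn2l ?nm_ge0 //; lra.
apply: (@le_trans _ _ (K * (2 ^+ k * nm t ^+ L) * (3 * nm t))).
  rewrite exprMn; apply: ler_pM; rewrite ?nm_ge0 ?mulr_ge0 ?exprn_ge0 ?nm_ge0 //.
  by rewrite ler_wpM2l // ler_wpM2l // ltW.
have fin : nm t * (K * 2 ^+ k * 3 * 2 ^+ L / c0 / e) <= 1.
  have : nm t * (K * 2 ^+ k * 3 * 2 ^+ L / c0 / e) <= nm t * (X + 1).
    by rewrite ler_wpM2l ?(ltW nt0) // /X; lra.
  have : 0 <= nm t * (X + 1) by rewrite mulr_ge0 ?nm_ge0 // addr_ge0.
  lra.
have -> : K * (2 ^+ k * nm t ^+ L) * (3 * nm t) =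
   (nm t * (K * 2 ^+ k * 3 * 2 ^+ L / c0 / e)) * (e * (c0 * (nm t ^+ L / 2 ^+ L))).
  by field; rewrite ?lt0r_neq0.
apply: (@le_trans _ _ (1 * (e * (c0 * (nm t ^+ L / 2 ^+ L))))).
  apply: ler_wpM2r => //.
  by rewrite mulr_ge0 ?(ltW e0) // mulr_ge0 ?(ltW c00) // divr_ge0 ?exprn_ge0 ?nm_ge0.
by rewrite mul1r ler_wpM2l // ltW.
Qed.

End LimitDirections.

(** * Projective space and fibers of Projan *)

Section ProjectiveTopology.
Variable R : realType.
Local Notation C := (Cplx R).
Variable m : nat.
Implicit Types (v w : 'rV[C]_m) (z : projective C m).
Local Open Scope quotient_scope.

Definition vnear (e : R) v w := forall j, nm (w 0 j - v 0 j) < e.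

Lemma nbhs_rowP v (A : set 'rV[C]_m) : nbhs v A <-> exists2 e : R, 0 < e & forall w, vnear e v w -> A w.
Proof.
split=> [/nbhs_ballP [_ /= /gt0_rc [e e0 ->] sA]|[e e0 sA]].
  exists e => // w vw; apply: sA; split=> [|i j]; first by rewrite -[0]/(rc 0) ltc_rc.
  by rewrite ord1 /ball /= normE ltc_rc nmC; exact: vw.
apply/nbhs_ballP; exists (rc e); first by rewrite /= -[0]/(rc 0) ltc_rc.
move=> w [_ vw]; apply: sA => j.
by have := vw 0 j; rewrite /ball /= normE ltc_rc nmC.
Qed.

Lemma projective_eqP (x y : nonzero_vec C m) :
  \pi_(projective C m) x = \pi_(projective C m) y <-> collinear x y.
Proof. by split; [move/(@eqmodP _ (collinear_equiv C m) x y)|move=> h; exact/(@eqmodP _ (collinear_equiv C m) x y)]. Qed.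

Lemma homog_class v (v0 : v != 0) : exists2 k : C, k != 0 & homog (projective_class v0) = k *: v.
Proof.
rewrite /homog /projective_class; set x := exist _ _ _.
by have /projective_eqP/asboolP := reprK (\pi_(projective C m) x).
Qed.

Lemma class_homog z v (v0 : v != 0) (k : C) : k != 0 -> v = k *: homog z ->
  projective_class v0 = z.
Proof.
move=> k0 vE; rewrite -[RHS]reprK /projective_class; set x := exist _ _ _.
by apply/projective_eqP/asboolP; exists k.
Qed.

Lemma class_near z (V : set (projective C m)) : nbhs z V ->
  exists2 e : R, 0 < e & forall v (v0 : v != 0), vnear e (homog z) v -> V (projective_class v0).
Proof.
rewrite -{1}[z]reprK => /(@pi_continuous _ _ (repr z)) /=.
rewrite nbhsE => -[U [[B oB BU] Uz] UV].
have : nbhs (homog z) B.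
  by apply: open_nbhs_nbhs; split=> //; move: Uz; rewrite -BU.
move/nbhs_rowP => [e e0 eB]; exists e => // v v0 vz.
by apply: UV; rewrite -BU; exact: eB.
Qed.

(** Scale invariance makes the chosen representative harmless: the preimage of the set under the
    projection is [P] itself, so it is open for the quotient topology. *)
Lemma homog_open_nbhs (P : set 'rV[C]_m) z :
  (forall v, P v -> exists2 e : R, 0 < e & forall w, vnear e v w -> P w) ->
  (forall (k : C) v, k != 0 -> P v -> P (k *: v)) ->
  P (homog z) -> nbhs z [set z' | P (homog z')].
Proof.
move=> oP sP Pz; apply: open_nbhs_nbhs; split=> //.
exists P; last first.
  have H v (v0 : v \in [set v | v != 0]) : P v <-> P (homog (\pi_(projective C m) (exist _ v v0))).
    have [k k0] := homog_class (set_mem v0).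
    have -> : projective_class (set_mem v0) = \pi_(projective C m) (exist _ v v0).
      by apply/projective_eqP/asboolP; exists 1; rewrite ?oner_neq0 ?scale1r.
    move=> ->; split; first exact: sP.
    by move=> /(sP k^-1); rewrite invr_eq0 scalerA mulVf // scale1r; exact.
  apply/seteqP; split=> -[v v0] h; [exact: (H v v0).1 h|exact: (H v v0).2 h].
rewrite openE => v /oP Pv; exact/nbhs_rowP.
Qed.

Lemma fiber_witness (Y : topologicalType) q (y0 : Y) (N : Y -> 'M[C]_(q, m)) z
    (U : set Y) (V : set (projective C m)) :
  Projan_fiber y0 N z -> nbhs y0 U -> nbhs z V ->
  exists y z', [/\ U y, V z' & (homog z' <= N y)%MS].
Proof.
move=> fz nU nV.
have [] := fz (U `*` V); first by exists (U, V).
by move=> [y z'] /= [[_ sub] [Uy Vz']]; exists y, z'.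
Qed.

Lemma fiber_intro (Y : topologicalType) q (y0 : Y) (N : Y -> 'M[C]_(q, m)) z :
  (forall (U : set Y) (e : R), nbhs y0 U -> 0 < e ->
     exists y v, [/\ U y, generic_rank y0 N (\rank (N y)), v != 0, vnear e (homog z) v & (v <= N y)%MS]) ->
  Projan_fiber y0 N z.
Proof.
move=> H B [[U V] /= [nU nV] UVB].
have [e e0 eV] := class_near nV.
have [y [v [Uy gr v0 vz vN]]] := H U e nU e0.
exists (y, projective_class v0); split.
  split=> //=; have [k _ ->] := homog_class v0; exact: scalemx_sub.
by apply: UVB; split=> //=; exact: eV.
Qed.

End ProjectiveTopology.

(** * From a small determinant to nearby directions *)

Section DirectionLemmas.
Variable R : realType.
Local Notation C := (Cplx R).

(** A small determinant keeps [w1] from being negligible against [w2]. The factor [k = a / w1] then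
    matches the first coordinate exactly, and the error in the second is the determinant divided by
    [w1]. *)
Lemma rescale_direction1 (a b : C) (e : R) : a != 0 -> 0 < e ->
  exists2 h : R, 0 < h & forall w1 w2 : C, 0 < nm w1 + nm w2 ->
    nm (a * w2 - b * w1) <= h * (nm w1 + nm w2) ->
    exists k : C, nm (k * w1 - a) < e /\ nm (k * w2 - b) < e.
Proof.
move=> a0 e0; have na : 0 < nm a by rewrite nm_gt0.
have nb := nm_ge0 b.
(* The first bound gives [|a| (|w1| + |w2|) <= 2 (|a| + |b|) |w1|]; with it, the second makes the
   error at most [e / 2]. *)
pose h := Num.min (nm a / 2) (e * nm a / (4 * (nm a + nm b))).
have ab : 0 < nm a + nm b by rewrite ltr_wpDr.
exists h; first by rewrite lt_min !divr_gt0 // ?mulr_gt0.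
move=> w1 w2 S0 hw.
have h1 : h <= nm a / 2 by rewrite ge_min lexx.
have h2 : h * (4 * (nm a + nm b)) <= e * nm a.
  by rewrite -ler_pdivlMr ?mulr_gt0 // ge_min lexx orbT.
have aw : nm a * nm w2 <= nm b * nm w1 + h * (nm w1 + nm w2).
  have := nmD (a * w2 - b * w1) (b * w1); rewrite subrK !nmM; lra.
have SB : nm a * (nm w1 + nm w2) <= 2 * (nm a + nm b) * nm w1.
  have := ler_wpM2r (ltW S0) h1; lra.
have n1 : 0 < nm w1.
  by rewrite -(pmulr_rgt0 _ (mulr_gt0 (ltr0n R 2) ab)); apply: lt_le_trans SB; rewrite mulr_gt0.
have w10 : w1 != 0 by rewrite -nm_gt0.
exists (a / w1); rewrite divfK // subrr nm0; split=> //.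
have -> : a / w1 * w2 - b = (a * w2 - b * w1) / w1 by field.
rewrite nmM nmV ltr_pdivrMr //; apply: le_lt_trans hw _.
have h0 : 0 <= h by rewrite le_min !divr_ge0 ?mulr_ge0 ?nm_ge0 ?addr_ge0 // ltW.
rewrite -(ltr_pM2l na).
apply: (@le_lt_trans _ _ (h * (2 * (nm a + nm b) * nm w1))).
  by rewrite mulrCA ler_wpM2l.
have := ler_wpM2r (ltW n1) h2; have : 0 < e * nm a * nm w1 by rewrite !mulr_gt0.
lra.
Qed.

Lemma rescale_direction (a b : C) (e : R) : (a != 0) || (b != 0) -> 0 < e ->
  exists2 h : R, 0 < h & forall w1 w2 : C, 0 < nm w1 + nm w2 ->
    nm (a * w2 - b * w1) <= h * (nm w1 + nm w2) ->
    exists k : C, nm (k * w1 - a) < e /\ nm (k * w2 - b) < e.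
Proof.
move=> /orP[a0|b0] e0; first exact: rescale_direction1.
have [h h0 H] := rescale_direction1 a b0 e0; exists h => // w1 w2 S0 hw.
have [||k [k1 k2]] := H w2 w1; last by exists k.
  by rewrite addrC.
by rewrite nmC [nm w2 + _]addrC.
Qed.

End DirectionLemmas.

(** * Row space of the matrix and points of the fiber *)

Section Fibers.
Variable R : realType.
Local Notation C := (Cplx R).
Implicit Types (s t x y : C) (z : projective C 4).

(** The nesting of [row_mx] mirrors that of [JD_matrix], so that products with that matrix have this
    form block by block. *)
Definition vec4 (x y z w : C) : 'rV[C]_4 :=
  row_mx (row_mx x%:M y%:M : 'rV_(1 + 1)) (row_mx z%:M w%:M : 'rV_(1 + 1)).

Lemma row_mx4El (A B : 'rV[C]_(1 + 1)) (j : 'I_(1 + 1)) :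
  (row_mx A B : 'rV_4) 0 (lshift (1 + 1) j) = A 0 j.
Proof. exact: row_mxEl. Qed.

Lemma row_mx4Er (A B : 'rV[C]_(1 + 1)) (j : 'I_(1 + 1)) :
  (row_mx A B : 'rV_4) 0 (rshift (1 + 1) j) = B 0 j.
Proof. exact: row_mxEr. Qed.

Lemma vec4_congr (x y z w x' y' z' w' : C) : x = x' -> y = y' -> z = z' -> w = w' ->
  vec4 x y z w = vec4 x' y' z' w'.
Proof. by move=> -> -> -> ->. Qed.

Lemma vec4E (x y z w : C) : [/\ vec4 x y z w 0 (inord 0) = x, vec4 x y z w 0 (inord 1) = y,
  vec4 x y z w 0 (inord 2) = z & vec4 x y z w 0 (inord 3) = w].
Proof.
have i0 : inord 0 = lshift 2 (lshift 1 (0 : 'I_1)) by apply: val_inj; rewrite /= inordK.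
have i1 : inord 1 = lshift 2 (rshift 1 (0 : 'I_1)) by apply: val_inj; rewrite /= inordK.
have i2 : inord 2 = rshift 2 (lshift 1 (0 : 'I_1)) by apply: val_inj; rewrite /= inordK.
have i3 : inord 3 = rshift 2 (rshift 1 (0 : 'I_1)) by apply: val_inj; rewrite /= inordK.
rewrite /vec4 i0 i1 i2 i3; split.
- apply: etrans (row_mx4El (row_mx x%:M y%:M) (row_mx z%:M w%:M) (lshift 1 0)) _.
  by rewrite row_mxEl mxE eqxx mulr1n.
- apply: etrans (row_mx4El (row_mx x%:M y%:M) (row_mx z%:M w%:M) (rshift 1 0)) _.
  by rewrite row_mxEr mxE eqxx mulr1n.
- apply: etrans (row_mx4Er (row_mx x%:M y%:M) (row_mx z%:M w%:M) (lshift 1 0)) _.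
  by rewrite row_mxEl mxE eqxx mulr1n.
- apply: etrans (row_mx4Er (row_mx x%:M y%:M) (row_mx z%:M w%:M) (rshift 1 0)) _.
  by rewrite row_mxEr mxE eqxx mulr1n.
Qed.

Lemma ord4_cases (P : 'I_4 -> Prop) :
  P (inord 0) -> P (inord 1) -> P (inord 2) -> P (inord 3) -> forall j, P j.
Proof.
move=> p0 p1 p2 p3 j; rewrite -[j]inord_val.
by case: j => [[|[|[|[|//]]]] lt].
Qed.

Lemma vec4_eta (v : 'rV[C]_4) :
  v = vec4 (v 0 (inord 0)) (v 0 (inord 1)) (v 0 (inord 2)) (v 0 (inord 3)).
Proof.
apply/rowP; apply: ord4_cases; have [e0 e1 e2 e3] := vec4E (v 0 (inord 0))
  (v 0 (inord 1)) (v 0 (inord 2)) (v 0 (inord 3)); by rewrite ?e0 ?e1 ?e2 ?e3.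
Qed.

Lemma mul_col2 (D : 'rV[C]_2) x y : D *m col2 x y = (D 0 0 * x + D 0 1 * y)%:M.
Proof.
apply/matrixP => i j; rewrite !ord1 !mxE !big_ord_recl big_ord0 addr0 !mxE /= mulr1n.
by congr (_ * _ + _ * _); congr (D _ _); apply: val_inj.
Qed.

Lemma mul_JD_minus (D : 'rV[C]_2) f (pq : (C * C) * (C * C)) :
  D *m JD_minus_matrix f pq = row_mx (D 0 0 * f_x f pq.1 + D 0 1 * f_x f pq.2)%:M
    (D 0 0 * f_y f pq.1 + D 0 1 * f_y f pq.2)%:M.
Proof.
apply: etrans (mul_mx_row D (Defs.double (f_x f) pq) (Defs.double (f_y f) pq)) _.
by congr row_mx; exact: mul_col2.
Qed.

Lemma mul_JD (D : 'rV[C]_2) f (pq : (C * C) * (C * C)) :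
  D *m JD_matrix f pq = vec4 (D 0 0 * f_x f pq.1 + D 0 1 * f_x f pq.2)
    (D 0 0 * f_y f pq.1 + D 0 1 * f_y f pq.2)
    (D 0 1 * ((pq.1.1 - pq.2.1) * f_y f pq.2))
    (D 0 1 * ((pq.1.2 - pq.2.2) * f_y f pq.2)).
Proof.
rewrite /JD_matrix mul_mx_row mul_JD_minus mul_mx_row.
by congr (row_mx _ (row_mx _ _)); rewrite mul_col2 mulr0 add0r.
Qed.

Lemma generic_rank2 (Y : topologicalType) m (y0 : Y) (N : Y -> 'M[C]_(2, m)) :
  (forall U : set Y, nbhs y0 U -> exists2 y, U y & \rank (N y) = 2%N) ->
  generic_rank y0 N 2.
Proof. by move=> H; split=> //; near=> y; exact: rank_leq_row. Unshelve. all: by end_near. Qed.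

Variables (f : C * C -> C) (eta : C -> C * C) (n : nat) (psi : C -> C) (d : R).
Local Notation phi t := (eta t).2.
Local Notation g t := (f_y f (eta t)).
Hypothesis d0 : 0 < d.
Hypothesis psi_cont : forall e : R, 0 < e -> exists2 d' : R, 0 < d' & forall t, nm t < d' -> nm (psi t) < e.
Hypothesis near_eta : forall t, nm t < d -> (eta t).1 = t ^+ n /\ f_x f (eta t) = - psi t * g t.
Hypothesis g_neq0 : forall t, t != 0 -> nm t < d -> g t != 0.
Hypothesis small : forall e : R, 0 < e -> exists2 d' : R, 0 < d' & forall s t, nm s < d' -> nm t < d' ->
  nm (phi s - phi t) <= e * (nm (psi s - psi t) + nm (s ^+ n - t ^+ n)).

(** The parameters [A] and [B] absorb the values of [f_y]; where these are nonzero, [A] and [B] are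
    arbitrary. *)
Lemma row_space_JD (D : 'rV[C]_2) s t : nm s < d -> nm t < d ->
  D *m (JD_matrix f \o eta_eta eta) (s, t) =
  let A := D 0 0 * g s in let B := D 0 1 * g t in
  vec4 (- (A * psi s + B * psi t)) (A + B) (B * (s ^+ n - t ^+ n)) (B * (phi s - phi t)).
Proof.
move=> /near_eta [sx sf] /near_eta [tx tf]; rewrite /= mul_JD /eta_eta /= sx tx sf tf.
move: (f_y f (eta s)) (f_y f (eta t)) (D 0 0) (D 0 1) (psi s) (psi t) => gs gt a b p q.
rewrite !mulNr !mulrN -opprD !mulrA (mulrAC a) (mulrAC b q).
by rewrite !(mulrAC b _ gt).
Qed.

Lemma rank2_JD s t : s != 0 -> t != 0 -> nm s < d -> nm t < d ->
  0 < nm (psi s - psi t) + nm (s ^+ n - t ^+ n) -> \rank ((JD_matrix f \o eta_eta eta) (s, t)) = 2%N.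
Proof.
move=> s0 t0 sd td S0; apply/eqP; apply: inj_row_free => D.
rewrite row_space_JD // => DN.
have gs := g_neq0 s0 sd; have gt := g_neq0 t0 td.
move: DN; set A := D 0 0 * g s; set B := D 0 1 * g t => /= DN.
have [e0 e1 e2 _] := vec4E (- (A * psi s + B * psi t)) (A + B)
   (B * (s ^+ n - t ^+ n)) (B * (phi s - phi t)).
rewrite DN !mxE in e0 e1 e2.
have AB : A = - B by apply/eqP; rewrite -addr_eq0 -e1.
have Bp : B * (psi s - psi t) = 0 by rewrite [RHS]e0 AB; ring.
have B0 : B = 0.
  apply/eqP; apply: contraLR S0 => B0; rewrite -leNgt.
  move/eqP: Bp; rewrite mulf_eq0 (negbTE B0) /= => /eqP ->.
  by move/esym/eqP: e2; rewrite mulf_eq0 (negbTE B0) /= => /eqP ->; rewrite !nm0 addr0.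
have A0 : A = 0 by rewrite AB B0 oppr0.
have D1 : D 0 1 = 0 by move/eqP: B0; rewrite mulf_eq0 (negbTE gt) orbF => /eqP.
have D0 : D 0 0 = 0 by move/eqP: A0; rewrite mulf_eq0 (negbTE gs) orbF => /eqP.
apply/rowP => j; rewrite mxE; case: j => [[|[|//]] lt].
  by rewrite -[RHS]D0; congr (D _ _); apply: val_inj.
by rewrite -[RHS]D1; congr (D _ _); apply: val_inj.
Qed.

Definition nm_total (v : 'rV[C]_4) : R :=
  nm (v 0 (inord 0)) + nm (v 0 (inord 1)) + nm (v 0 (inord 2)) + nm (v 0 (inord 3)).

(** The strict inequality [e * nm_total v < nm (v 0 k)] is open and invariant under scaling. If
    coordinate [k] of [z] were nonzero, it would hold near [z] for a small [e], yet it fails on the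
    nearby rows of which [z] is a limit. *)
Lemma fiber_coord_eq0 (k : 'I_4) :
  (forall e : R, 0 < e -> exists2 d' : R, 0 < d' & forall s t (v : 'rV[C]_4), nm s < d' -> nm t < d' ->
    (v <= (JD_matrix f \o eta_eta eta) (s, t))%MS -> nm (v 0 k) <= e * nm_total v) ->
  forall z, JD_fiber f eta z -> homog z 0 k = 0.
Proof.
move=> H z fz; have [//|zk] := eqVneq (homog z 0 k) 0.
have T0 : 0 <= nm_total (homog z) by rewrite !addr_ge0 ?nm_ge0.
have zk0 : 0 < nm (homog z 0 k) by rewrite nm_gt0.
pose e := nm (homog z 0 k) / (2 * (nm_total (homog z) + 1)).
have T1 : 0 < 2 * (nm_total (homog z) + 1) by lra.
have e0 : 0 < e by rewrite divr_gt0.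
pose P (v : 'rV[C]_4) := e * nm_total v < nm (v 0 k).
have Pz : P (homog z).
  rewrite /P /e mulrAC ltr_pdivrMr //; nra.
have oP v : P v -> exists2 h : R, 0 < h & forall w, vnear h v w -> P w.
  (* Moving each entry by less than [h] lowers the right side by at most [h] and raises the left by
     at most [4 * e * h]. *)
  move=> Pv; pose h := (nm (v 0 k) - e * nm_total v) / (4 * e + 1).
  have h0 : 0 < h by rewrite divr_gt0 ?subr_gt0 //; lra.
  have hE : h * (4 * e + 1) = nm (v 0 k) - e * nm_total v by rewrite divfK // lt0r_neq0 //; lra.
  exists h => // w vw; rewrite /P.
  have up j : nm (w 0 j) <= nm (v 0 j) + h.
    by have := nmD (w 0 j - v 0 j) (v 0 j); rewrite subrK; have := vw j; lra.
  have lo : nm (v 0 k) - h < nm (w 0 k).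
    by have := nmB (w 0 k) (w 0 k - v 0 k); rewrite subKr; have := vw k; lra.
  have : nm_total w <= nm_total v + 4 * h.
    by rewrite /nm_total; have := (up (inord 0), up (inord 1), up (inord 2), up (inord 3)) => -[[[]]]; lra.
  move=> /(ler_wpM2l (ltW e0)); lra.
have sP (c : C) v : c != 0 -> P v -> P (c *: v).
  rewrite /P -nm_gt0 => c0 Pv; rewrite /nm_total !mxE !nmM -!mulrDr mulrCA ltr_pM2l //.
have nV := homog_open_nbhs oP sP Pz.
have [d' d'0 hd'] := H e e0.
have nU : nbhs (0 : C * C) [set st | nm st.1 < d' /\ nm st.2 < d'].
  by apply/near0P2; exists d'.
have [[s t] [z' [/= [sd td] Pz' sub]]] := fiber_witness fz nU nV.
exfalso; have := hd' s t _ sd td sub; move: Pz'; rewrite /P; lra.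
Qed.

Lemma normal_coord_eq0 z : JD_fiber f eta z -> homog z 0 (inord 3) = 0.
Proof.
move: z; apply: fiber_coord_eq0 => e e0.
have [d1 d10 h1] := small e0; have [d2 d20 h2] := psi_cont ltr01.
exists (Num.min d (Num.min d1 d2)) => [|s t v]; first by rewrite !lt_min d0 d10.
rewrite !lt_min => /andP[sd /andP[sd1 sd2]] /andP[td /andP[td1 td2]] /submxP [D ->].
rewrite row_space_JD //; set A := D 0 0 * _; set B := D 0 1 * _ => /=; clearbody A B.
rewrite /nm_total; have [-> -> -> ->] := vec4E (- (A * psi s + B * psi t)) (A + B)
   (B * (s ^+ n - t ^+ n)) (B * (phi s - phi t)).
have := ler_wpM2l (nm_ge0 B) (h1 s t sd1 td1).
(* The first two coordinates recover [B] times the difference of psi, as [|psi s| < 1]; the third is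
   [B] times the difference of x. *)
have e1 : nm (B * (psi s - psi t)) <= nm (- (A * psi s + B * psi t)) + nm (A + B).
  have -> : B * (psi s - psi t) = - (A * psi s + B * psi t) + (A + B) * psi s by ring.
  apply: le_trans (nmD _ _) _; rewrite lerD2l nmM -[leRHS]mulr1.
  by rewrite ler_wpM2l ?nm_ge0 // ltW // h2.
move: e1; rewrite !(nmM B) => e1 e2.
have e3 := ler_wpM2l (ltW e0) e1.
have e4 : 0 <= e * (nm B * nm (phi s - phi t)) by rewrite mulr_ge0 ?mulr_ge0 ?nm_ge0 // ltW.
lra.
Qed.

(** The limits of scaled pairs (D psi, D x) whose scaled D phi tends to 0. The pair (0, 0) is
    allowed: it accounts for the point (0 : 1 : 0 : 0). *)
Definition approachable (a b : C) := forall e : R, 0 < e -> exists s t k : C,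
  [/\ s != 0, t != 0, nm s < e, nm t < e &
   [/\ 0 < nm (psi s - psi t) + nm (s ^+ n - t ^+ n), nm (k * (psi s - psi t) - a) < e,
      nm (k * (s ^+ n - t ^+ n) - b) < e & nm (k * (phi s - phi t)) < e]].

Lemma approachable_scale a b k : approachable a b -> approachable (k * a) (k * b).
Proof.
move=> ab e e0; have k1 : 0 < nm k + 1 by rewrite ltr_wpDl ?nm_ge0.
have e'0 : 0 < Num.min e (e / (nm k + 1)) by rewrite lt_min e0 divr_gt0.
have [s [t [l [s0 t0 se te [S0 h1 h2 h3]]]]] := ab _ e'0.
have sm x : nm x < Num.min e (e / (nm k + 1)) -> nm (k * x) < e.
  rewrite lt_min => /andP[_]; rewrite ltr_pdivlMr // nmM.
  by have := nm_ge0 x; lra.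
have se' x : nm x < Num.min e (e / (nm k + 1)) -> nm x < e by rewrite lt_min => /andP[].
exists s, t, (k * l); split; [exact: s0|exact: t0|exact: se'|exact: se'|split].
- exact: S0.
- by rewrite -mulrA -mulrBr; exact: sm.
- by rewrite -mulrA -mulrBr; exact: sm.
- by rewrite -mulrA; exact: sm.
Qed.

Lemma generic_rank_JD a b : approachable a b -> generic_rank (0 : C * C) (JD_matrix f \o eta_eta eta) 2.
Proof.
move=> ab; apply: generic_rank2 => U /near0P2 [r r0 rU].
have e0 : 0 < Num.min r d by rewrite lt_min r0.
have [s [t [k [s0 t0 + + [S0 _ _ _]]]]] := ab _ e0.
rewrite !lt_min => /andP[sr sd] /andP[tr td].
by exists (s, t); [exact: rU|exact: rank2_JD].
Qed.

Lemma approachable_fiber z : homog z 0 (inord 3) = 0 ->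
  approachable (homog z 0 (inord 0)) (homog z 0 (inord 2)) -> JD_fiber f eta z.
Proof.
move=> z3 ab; apply: fiber_intro => U e /near0P2 [r r0 rU] e0.
set a := homog z 0 (inord 0) in ab; set b := homog z 0 (inord 2) in ab.
pose c := homog z 0 (inord 1).
have [j zj] : exists j, homog z 0 j != 0.
  apply/not_existsP => H; have /eqP := homog_neq0 z; apply; apply/rowP => j.
  by rewrite mxE; apply/eqP; apply/negPn/negP => hj; exact: (H j).
pose e' := Num.min (e / 2) (nm (homog z 0 j) / 2).
have e'0 : 0 < e' by rewrite lt_min !divr_gt0 // nm_gt0.
have c1 : 0 < nm c + 1 by rewrite ltr_wpDl ?nm_ge0.
have [d2 d20 h2] := psi_cont (divr_gt0 e'0 c1).
have m0 : 0 < Num.min (Num.min r d) (Num.min d2 e').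
  rewrite lt_min [0 < Num.min r d]lt_min r0 d0 /= lt_min d20; exact: e'0.
have [s [t [k [s0 t0 + + [S0 + + +]]]]] := ab _ m0.
have sub x : nm x < Num.min (Num.min r d) (Num.min d2 e') ->
   [/\ nm x < r, nm x < d, nm x < d2 & nm x < e'].
  by rewrite lt_min [nm x < Num.min r d]lt_min [nm x < Num.min d2 e']lt_min => /andP[/andP[? ?] /andP[? ?]].
move=> /sub [sr sd sd2 _] /sub [tr td _ _] /sub [_ _ _ k1] /sub [_ _ _ k2] /sub [_ _ _ k3].
(* The second coordinate [c] can be prescribed exactly: the multiple [c] of (- psi(s), 1, 0, 0)
   disturbs the first coordinate only by [c * psi s], which tends to 0. *)
pose v := vec4 (- c * psi s + k * (psi s - psi t)) c (k * (s ^+ n - t ^+ n)) (k * (phi s - phi t)).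
have vz j' : nm (v 0 j' - homog z 0 j') < 2 * e'.
  have [v0 v1 v2 v3] := vec4E (- c * psi s + k * (psi s - psi t)) c
    (k * (s ^+ n - t ^+ n)) (k * (phi s - phi t)).
  move: j'; apply: ord4_cases; rewrite /v ?v0 ?v1 ?v2 ?v3 -/a -/b -/c ?z3.
  - have -> : - c * psi s + k * (psi s - psi t) - a = - c * psi s + (k * (psi s - psi t) - a) by ring.
    apply: le_lt_trans (nmD _ _) _; rewrite nmM nmN.
    have := h2 s sd2; rewrite ltr_pdivlMr // => h3; have := nm_ge0 (psi s); lra.
  - rewrite subrr nm0; lra.
  - by lra.
  - rewrite subr0; lra.
have e'1 : 2 * e' <= e.
  have : e' <= e / 2 by rewrite ge_min lexx.
  lra.
have e'2 : 2 * e' <= nm (homog z 0 j).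
  have : e' <= nm (homog z 0 j) / 2 by rewrite ge_min lexx orbT.
  lra.
exists (s, t), v; split.
- exact: rU.
- by rewrite (rank2_JD s0 t0) //; exact: generic_rank_JD ab.
- apply: contraTneq (vz j) => ->; rewrite mxE sub0r nmN -leNgt; lra.
- by move=> j'; apply: lt_le_trans (vz j') e'1.
(* These weights solve [A + B = c] and [B = k]. *)
apply/submxP; exists (\row_i (if i == 0 then (c - k) / g s else k / g t)).
rewrite row_space_JD // !mxE /=.
have gs := g_neq0 s0 sd; have gt := g_neq0 t0 td.
have E1 (G H p q : C) : G != 0 -> H != 0 ->
    - ((c - k) / G * G * p + k / H * H * q) = - c * p + k * (p - q).
  by move=> G0 H0; rewrite !divfK //; ring.
have E2 (G H : C) : G != 0 -> H != 0 -> (c - k) / G * G + k / H * H = c.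
  by move=> G0 H0; rewrite !divfK // subrK.
have E3 (H p : C) : H != 0 -> k / H * H * p = k * p by move=> H0; rewrite divfK.
apply: vec4_congr; [exact: (esym (E1 _ _ _ _ gs gt))|exact: (esym (E2 _ _ gs gt))|exact: (esym (E3 _ _ gt))|exact: (esym (E3 _ _ gt))].
Qed.

End Fibers.

(** * The two cases of the fiber *)

Section Cases.
Variable R : realType.
Local Notation C := (Cplx R).
Implicit Types (s t x y : C).

Variables (f : C * C -> C) (eta : C -> C * C) (n : nat) (psi : C -> C) (d : R).
Local Notation phi t := (eta t).2.
Local Notation g t := (f_y f (eta t)).
Hypothesis d0 : 0 < d.
Hypothesis psi_cont : forall e : R, 0 < e -> exists2 d' : R, 0 < d' & forall t, nm t < d' -> nm (psi t) < e.
Hypothesis near_eta : forall t, nm t < d -> (eta t).1 = t ^+ n /\ f_x f (eta t) = - psi t * g t.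
Hypothesis g_neq0 : forall t, t != 0 -> nm t < d -> g t != 0.
Hypothesis small : forall e : R, 0 < e -> exists2 d' : R, 0 < d' & forall s t, nm s < d' -> nm t < d' ->
  nm (phi s - phi t) <= e * (nm (psi s - psi t) + nm (s ^+ n - t ^+ n)).

(** The condition on phi is automatic: [|k|] times the differences of psi and x totals at most
    [|a| + |b| + 2 e], and the difference of phi is a small multiple of theirs. *)
Lemma approachable_of_ratio (a b : C) :
  (forall e : R, 0 < e -> exists s t k : C, [/\ s != 0, t != 0, nm s < e, nm t < e &
    [/\ 0 < nm (psi s - psi t) + nm (s ^+ n - t ^+ n),
        nm (k * (psi s - psi t) - a) < e & nm (k * (s ^+ n - t ^+ n) - b) < e]]) ->
  approachable eta n psi a b.
Proof.
move=> H e e0; have na := nm_ge0 a; have nb := nm_ge0 b.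
have X0 : 0 < nm a + nm b + 2 * e + 1 by lra.
have [d' d'0 h] := small (divr_gt0 e0 X0).
have m0 : 0 < Num.min e d' by rewrite lt_min e0.
have [s [t [k [s0 t0 + + [S0 + +]]]]] := H _ m0.
rewrite !lt_min => /andP[se sd] /andP[te td] /andP[k1 _] /andP[k2 _].
exists s, t, k; split; [exact: s0|exact: t0|exact: se|exact: te|split].
- exact: S0.
- exact: k1.
- exact: k2.
rewrite nmM; apply: le_lt_trans (ler_wpM2l (nm_ge0 k) (h s t sd td)) _.
have e1 : nm k * nm (psi s - psi t) <= nm a + e.
  by have := nmD (k * (psi s - psi t) - a) a; rewrite subrK nmM; lra.
have e2 : nm k * nm (s ^+ n - t ^+ n) <= nm b + e.
  by have := nmD (k * (s ^+ n - t ^+ n) - b) b; rewrite subrK nmM; lra.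
set D := e / _; have DE : D * (nm a + nm b + 2 * e + 1) = e by rewrite divfK // lt0r_neq0.
have D0 : 0 < D by rewrite divr_gt0.
have := ler_wpM2l (ltW D0) e1; have := ler_wpM2l (ltW D0) e2; lra.
Qed.

Section Tangent.
Hypothesis dirs : forall (al be : C) (e : R), (al != 0) || (be != 0) -> 0 < e ->
  exists s t, [/\ s != 0, t != 0, nm s < e, nm t < e &
   [/\ 0 < nm (psi s - psi t) + nm (s ^+ n - t ^+ n) &
    nm (al * (s ^+ n - t ^+ n) + be * (psi s - psi t)) <=
      e * (nm (psi s - psi t) + nm (s ^+ n - t ^+ n))]].

Lemma approachable_all a b : approachable eta n psi a b.
Proof.
have main a' b' : (a' != 0) || (b' != 0) -> approachable eta n psi a' b'.
  move=> ab; apply: approachable_of_ratio => e e0.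
  have [h h0 H] := rescale_direction ab e0.
  (* With coefficients [a'] and [- b'] the combination is the determinant of (a', b') and (D psi, D
     x). *)
  have ab' : (a' != 0) || (- b' != 0) by rewrite oppr_eq0.
  have m0 : 0 < Num.min e h by rewrite lt_min e0.
  have [s [t [s0 t0 + + [S0 hS]]]] := dirs ab' m0.
  rewrite !lt_min => /andP[se _] /andP[te _].
  have [|k [k1 k2]] := H _ _ S0; last by exists s, t, k; split.
  move: hS; rewrite mulNr => hS; apply: le_trans hS _.
  by apply: ler_wpM2r; rewrite ?(ltW S0) // ge_min lexx orbT.
(* The pair (0, 0) has no direction; it is an approachable pair scaled by 0. *)
have [/andP[/eqP -> /eqP ->]|] := boolP ((a == 0) && (b == 0)).
  have := approachable_scale 0 (main 1 1 _); rewrite mul0r; apply.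
  by rewrite oner_neq0.
by rewrite negb_and; exact: main.
Qed.

Lemma JD_fiber_tangent : JD_fiber f eta = @tangent_component C.
Proof.
apply/seteqP; split=> z.
  exact: (normal_coord_eq0 d0 psi_cont near_eta small).
move=> z3; apply: (approachable_fiber d0 psi_cont near_eta g_neq0) => //.
exact: approachable_all.
Qed.

End Tangent.

Section Conormal.
Hypothesis x_small : forall e : R, 0 < e -> exists2 d' : R, 0 < d' & forall s t, nm s < d' -> nm t < d' ->
  nm (s ^+ n - t ^+ n) <= e * nm (psi s - psi t) /\ (s != t -> psi s != psi t).

Lemma two_points (e : R) : 0 < e -> exists s t, [/\ s != 0, t != 0, nm s < e, nm t < e & s != t].
Proof.
move=> e0; exists (rc (e / 2)), (rc (e / 3)).
have [h2 h3] : 0 < e / 2 /\ 0 < e / 3 by rewrite !divr_gt0.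
have n2 : nm (rc (e / 2)) = e / 2 by rewrite nm_rc // ltW.
have n3 : nm (rc (e / 3)) = e / 3 by rewrite nm_rc // ltW.
split; rewrite -?nm_gt0 ?n2 ?n3 //; [lra|lra|].
by apply: contraNneq (lt0r_neq0 e0) => /(congr1 (@nm R)); rewrite n2 n3 => E; apply/eqP; lra.
Qed.

Lemma approachable_conormal a : approachable eta n psi a 0.
Proof.
suff : approachable eta n psi 1 0.
  by move=> /(approachable_scale a); rewrite mulr1 mulr0.
apply: approachable_of_ratio => e e0.
have e20 : 0 < e / 2 by rewrite divr_gt0.
have [d' d'0 h] := x_small e20.
have m0 : 0 < Num.min e d' by rewrite lt_min e0.
have [s [t [s0 t0 + + st]]] := two_points m0.
rewrite !lt_min => /andP[se sd] /andP[te td]; have [h1 /(_ st) h2] := h s t sd td.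
have p0 : psi s - psi t != 0 by rewrite subr_eq0.
have np : 0 < nm (psi s - psi t) by rewrite nm_gt0.
exists s, t, (psi s - psi t)^-1; split; [exact: s0|exact: t0|exact: se|exact: te|split].
- by apply: lt_le_trans np _; rewrite lerDl nm_ge0.
- by rewrite mulVf // subrr nm0.
by rewrite subr0 nmM nmV mulrC ltr_pdivrMr //; apply: le_lt_trans h1 _; rewrite ltr_pM2r //; lra.
Qed.

Lemma tangent_coord_eq0 z : JD_fiber f eta z -> homog z 0 (inord 2) = 0.
Proof.
move: z; apply: (fiber_coord_eq0 (k := inord 2)) => e e0.
have [d1 d10 h1] := x_small e0; have [d2 d20 h2] := psi_cont ltr01.
exists (Num.min d (Num.min d1 d2)) => [|s t v]; first by rewrite !lt_min d0 d10.
rewrite !lt_min => /andP[sd /andP[sd1 sd2]] /andP[td /andP[td1 td2]] /submxP [D ->].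
rewrite (row_space_JD near_eta) //; set A := D 0 0 * _; set B := D 0 1 * _ => /=; clearbody A B.
rewrite /nm_total; have [-> -> -> ->] := vec4E (- (A * psi s + B * psi t)) (A + B)
   (B * (s ^+ n - t ^+ n)) (B * (phi s - phi t)).
have [h3 _] := h1 s t sd1 td1; have := ler_wpM2l (nm_ge0 B) h3.
have e1 : nm (B * (psi s - psi t)) <= nm (- (A * psi s + B * psi t)) + nm (A + B).
  have -> : B * (psi s - psi t) = - (A * psi s + B * psi t) + (A + B) * psi s by ring.
  apply: le_trans (nmD _ _) _; rewrite lerD2l nmM -[leRHS]mulr1.
  by rewrite ler_wpM2l ?nm_ge0 // ltW // h2.
move: e1; rewrite !(nmM B) => e1 e2.
have e3 := ler_wpM2l (ltW e0) e1.
have e4 : 0 <= e * (nm B * nm (phi s - phi t)) by rewrite mulr_ge0 ?mulr_ge0 ?nm_ge0 // ltW.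
have e5 : 0 <= e * (nm B * nm (s ^+ n - t ^+ n)) by rewrite mulr_ge0 ?mulr_ge0 ?nm_ge0 // ltW.
lra.
Qed.

Lemma JD_fiber_conormal : JD_fiber f eta = @P1_00 C.
Proof.
apply/seteqP; split=> z.
  move=> fz; split; first exact: tangent_coord_eq0.
  exact: (normal_coord_eq0 d0 psi_cont near_eta small).
move=> [z2 z3]; apply: (approachable_fiber d0 psi_cont near_eta g_neq0) => //.
by rewrite [homog z 0 (inord 2)]z2; exact: approachable_conormal.
Qed.

Lemma rank2_JD_minus s t : s != 0 -> t != 0 -> nm s < d -> nm t < d -> psi s != psi t ->
  \rank ((JD_minus_matrix f \o eta_eta eta) (s, t)) = 2%N.
Proof.
move=> s0 t0 sd td st; apply/eqP; apply: inj_row_free => D /= DN.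
have gs := g_neq0 s0 sd; have gt := g_neq0 t0 td.
have [_ fs] := near_eta sd; have [_ ft] := near_eta td.
move: DN; rewrite mul_JD_minus /= fs ft => DN.
have e0 : D 0 0 * (- psi s * g s) + D 0 1 * (- psi t * g t) = 0.
  have := congr1 (fun M : 'rV[C]_(1 + 1) => M 0 (lshift 1 0)) DN.
  by rewrite row_mxEl !mxE eqxx mulr1n.
have e1 : D 0 0 * g s + D 0 1 * g t = 0.
  have := congr1 (fun M : 'rV[C]_(1 + 1) => M 0 (rshift 1 0)) DN.
  by rewrite row_mxEr !mxE eqxx mulr1n.
have key (a b G H p q : C) : G != 0 -> H != 0 -> p != q ->
    a * (- p * G) + b * (- q * H) = 0 -> a * G + b * H = 0 -> a = 0 /\ b = 0.
  move=> G0 H0 pq E0 E1.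
  have aG : a * G = - (b * H) by apply/eqP; rewrite -addr_eq0 E1.
  have : b * H * (p - q) = 0.
    have e : a * (- p * G) = - (a * G) * p by ring.
    by rewrite -[RHS]E0 e aG; ring.
  move/eqP; rewrite !mulf_eq0 subr_eq0 (negbTE H0) (negbTE pq) !orbF => /eqP b0.
  by move/eqP: aG; rewrite b0 mul0r oppr0 mulf_eq0 (negbTE G0) orbF => /eqP.
have [D0 D1] := key _ _ _ _ _ _ gs gt st e0 e1.
apply/rowP => j; rewrite mxE; case: j => [[|[|//]] lt].
  by rewrite -[RHS]D0; congr (D _ _); apply: val_inj.
by rewrite -[RHS]D1; congr (D _ _); apply: val_inj.
Qed.

Lemma JD_minus_points (U : set (C * C)) : nbhs (0 : C * C) U ->
  exists2 y, U y & \rank ((JD_minus_matrix f \o eta_eta eta) y) = 2%N.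
Proof.
move=> /near0P2 [r r0 rU]; have [d1 d10 h1] := x_small ltr01.
have m0 : 0 < Num.min (Num.min r d) d1 by rewrite lt_min [0 < Num.min r d]lt_min r0 d0.
have [s [t [s0 t0 + + st]]] := two_points m0.
rewrite !lt_min => /andP[/andP[sr sd] sd1] /andP[/andP[tr td] td1].
exists (s, t); first exact: rU.
by apply: rank2_JD_minus => //; have [_] := h1 s t sd1 td1; exact.
Qed.

(** Arbitrarily close to the origin the two-by-two matrix is invertible; its row space is then
    everything, and [z] itself serves as the approximating point. *)
Lemma JD_minus_fiberT : JD_minus_fiber f eta = setT.
Proof.
apply/seteqP; split=> z // _; apply: fiber_intro => U e nU e0.
have [y Uy ry] := JD_minus_points nU; exists y, (homog z); split=> //.
- by rewrite ry; apply: generic_rank2; exact: JD_minus_points.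
- exact: homog_neq0.
- by move=> j; rewrite subrr nm0.
by apply: submx_full; rewrite /row_full ry.
Qed.

End Conormal.

End Cases.

(** * The inclusion of the projective line *)

Section Inclusion.
Variable R : realType.
Local Notation C := (Cplx R).

Lemma row_mx_vec4 (u : 'rV[C]_(1 + 1)) :
  (row_mx u (0 : 'rV[C]_(1 + 1)) : 'rV_4) = vec4 (u 0 (lshift 1 0)) (u 0 (rshift 1 0)) 0 0.
Proof.
have Eu : u = row_mx (u 0 (lshift 1 0))%:M (u 0 (rshift 1 0))%:M.
  apply/rowP => j; case: (split_ordP j) => i ->;
  by rewrite ord1 ?row_mxEl ?row_mxEr [in RHS]mxE eqxx mulr1n.
have E0 : 0 = row_mx (0%:M : 'M[C]_1) (0%:M : 'M[C]_1).
  by apply/rowP => j; case: (split_ordP j) => i ->; rewrite ?row_mxEl ?row_mxEr !mxE mul0rn.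
exact: (congr2 (fun v w : 'rV[C]_(1 + 1) => row_mx v w : 'rV_4) Eu E0).
Qed.

Lemma P1_incl_image : image setT (@P1_incl C) = @P1_00 C.
Proof.
apply/seteqP; split=> z /=.
  move=> [z' _ <-]; rewrite /P1_incl; have [k _ E] := homog_class (incl_neq0 z').
  rewrite /P1_00 /= /tangent_coord /normal_coord E row_mx_vec4.
  have sc (v : 'rV[C]_4) i : (k *: v) 0 i = k * v 0 i by rewrite mxE.
  set a := homog z' 0 _; set b := homog z' 0 _.
  by have [_ _ e2 e3] := vec4E a b 0 0; rewrite !sc e2 e3 mulr0.
move=> [z2 z3].
pose u : 'rV[C]_(1 + 1) := row_mx (homog z 0 (inord 0))%:M (homog z 0 (inord 1))%:M.
have zE : homog z = row_mx u (0 : 'rV[C]_(1 + 1)).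
  rewrite row_mx_vec4 [LHS]vec4_eta; apply: vec4_congr => //.
  - by rewrite row_mxEl mxE eqxx mulr1n.
  - by rewrite row_mxEr mxE eqxx mulr1n.
have u0 : u != 0.
  by apply: contraNneq (homog_neq0 z) => u0; rewrite zE u0 row_mx0.
exists (projective_class u0) => //; have [k k0 E] := homog_class u0.
apply: (class_homog _ k0); rewrite E zE.
have := scale_row_mx k u (0 : 'rV[C]_(1 + 1)); rewrite scaler0 => ku; exact: esym ku.
Qed.

End Inclusion.

(** * The case B1 = n + 1: D x is negligible against D psi *)

Section ConormalEstimate.
Variable R : realType.
Local Notation C := (Cplx R).
Implicit Types (s t : C).

(** The linear term of psi gives [|D psi| >= |c 1| / 2 * |s - t|], while [|D x| <= n * mu * |s - t|]
    on the disc of radius [mu]. The first bound also makes psi injective there. *)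
Lemma Xn_small_of_simple_slope n (c : nat -> C) (r : R) (psi : C -> C) : (1 < n)%N ->
  is_psum1 c r psi -> c 1%N != 0 ->
  forall e : R, 0 < e -> exists2 d' : R, 0 < d' & forall s t, nm s < d' -> nm t < d' ->
  nm (s ^+ n - t ^+ n) <= e * nm (psi s - psi t) /\ (s != t -> psi s != psi t).
Proof.
move=> n1 hp c1 e e0; have [sg sg0 /(_ 1%N) [K K0 lip]] := psum1_lipschitz hp.
have nc : 0 < nm (c 1%N) by rewrite nm_gt0.
have n0 : (0 : R) < n%:R by rewrite ltr0n ltnW.
have K1 : 0 < 2 * (K + 1) by lra.
pose mu := Num.min (Num.min 1 sg) (Num.min (nm (c 1%N) / (2 * (K + 1))) (e * nm (c 1%N) / (2 * n%:R))).
have mu0 : 0 < mu.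
  by rewrite /mu lt_min [0 < Num.min 1 _]lt_min lt_min ltr01 sg0 !divr_gt0 // mulr_gt0.
have : mu <= mu by []; rewrite {2}/mu !le_min => /andP[/andP[m1 m2]].
rewrite !ler_pdivlMr // ?(mulr_gt0 (ltr0n R 2) n0) // => /andP[m3 m4].
exists mu => // s t /ltW sm /ltW tm.
have := lip _ _ _ sm tm m2; rewrite expr1.
have -> : psum1 c 2 s - psum1 c 2 t = c 1%N * (s - t).
  by rewrite /psum1 !big_ord_recr !big_ord0 /= !expr0 !expr1; ring.
move=> h.
have low : nm (c 1%N) / 2 * nm (s - t) <= nm (psi s - psi t).
  have := nmB (psi s - psi t) (psi s - psi t - c 1%N * (s - t)); rewrite subKr nmM.
  have := ler_wpM2r (nm_ge0 (s - t)) m3.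
  have : 0 <= mu * nm (s - t) by rewrite mulr_ge0 ?nm_ge0 ?ltW.
  lra.
split; last first.
  move=> st; apply: contraTneq low => ->; rewrite subrr nm0 -ltNge.
  by rewrite mulr_gt0 ?divr_gt0 // nm_gt0 subr_eq0.
have := nm_subrX n.-1 sm tm; rewrite prednK ?(ltnW n1) // => h1; apply: le_trans h1 _.
apply: (@le_trans _ _ (n%:R * mu * nm (s - t))).
  rewrite ler_wpM2r ?nm_ge0 // ler_wpM2l ?(ltW n0) // -[leRHS]expr1.
  by rewrite ler_wiXn2l ?(ltW mu0) // -ltnS prednK // ltnW.
have := ler_wpM2l (ltW e0) low; have := ler_wpM2r (nm_ge0 (s - t)) m4; lra.
Qed.

End ConormalEstimate.

Theorem theorem3p9 (R : realType) (f : Cplx R * Cplx R -> Cplx R) (mult : nat)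
    (eta : Cplx R -> Cplx R * Cplx R) (n B1 : nat) (B2 : option nat) :
  irreducible2 f ->
  multiplicity f mult ->
  (1 < mult)%N ->
  standard_normalization f eta n B1 B2 ->
  (B1 = n.+1 ->
     JD_fiber f eta = @P1_00 (Cplx R) /\
     image (JD_minus_fiber f eta) (@P1_incl (Cplx R)) = @P1_00 (Cplx R)) /\
  ((n.+1 < B1)%N -> JD_fiber f eta = @tangent_component (Cplx R)).
Proof.
move=> irr mul mult1 std.
have [b [c [psi [rb [rp [d [hb b0 bB1 psb [hpsi cE d0 near_eta [_ g0]]]]]]]]] :=
  curve_data irr mul mult1 std.
have [_ [n0 nB1 nB _ _]] := std.
(* For [n = 1] the exponent [B1] would be a multiple of [n]. *)
have n1 : (1 < n)%N.
  by rewrite ltn_neqAle n0 andbT; apply: contraNneq nB => <-; exact: dvd1n.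
have sep (z : Cplx R) : z ^+ n = 1 -> z != 1 -> exists k, b k != 0 /\ z ^+ k != 1.
  exact: (root_of_unity_separates std psb).
have small := phi_small n1 nB1 hb hpsi b0 bB1 cE sep.
have psi_cont (e : R) : 0 < e -> exists2 d' : R, 0 < d' & forall t, nm t < d' -> nm (psi t) < e.
  move=> e0; have [sg sg0 [K K0 near]] := psum1_near0 hpsi.
  have psi0 : psi 0 = 0.
    by rewrite (is_psum1_0 hpsi) cE b0 ?mulr0 // addn0.
  exists (Num.min sg (e / K)) => [|t]; first by rewrite lt_min sg0 divr_gt0.
  rewrite lt_min => /andP[ts]; rewrite ltr_pdivlMr // mulrC => te.
  by have := near t (ltW ts); rewrite psi0 subr0 => h; exact: le_lt_trans te.
split=> [B1E|nB1']; last first.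
  apply: (JD_fiber_tangent d0 psi_cont near_eta g0 small) => al be e.
  exact: (limit_directions n1 nB1' nB hb hpsi b0 bB1 cE sep).
(* When [B1 = n + 1], psi starts in degree 1 with coefficient [(n + 1) / n]. *)
have c1 : c 1%N != 0.
  by rewrite cE addn1 -B1E bB1 mulr1 mulf_neq0 ?invr_eq0 ?pnatr_eq0 -?lt0n // B1E.
have x_small := Xn_small_of_simple_slope n1 hpsi c1.
split; first exact: (JD_fiber_conormal d0 psi_cont near_eta g0 small x_small).
rewrite (JD_minus_fiberT d0 near_eta g0 x_small).
exact: P1_incl_image.
Qed.
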